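(* Let $w$ be a word with $|w|=n$, $\mathrm{alph}(w)=\Sigma$ and $\Sigma=\{1,2,\ldots,\sigma\}$ (with $\sigma\le n$), and let $k$ be an integer with $0\le k\le\lfloor n/\sigma\rfloor$. The minimal number of letter substitutions that must be applied to $w$ in order to obtain a word whose universality index (with respect to $\Sigma$) is exactly $k$ can be computed in $O(nk)$ time.
   Context: Computational model: unit-cost word RAM with memory words of $\log n$ bits for inputs of size $n$; the input word is over an integer alphabet $\{1,\ldots,\sigma\}$ with $\sigma\le n$ and contains at least two distinct letters. For a word $w$, $\mathrm{alph}(w)$ is the set of letters occurring in $w$. A word $v=v_1\cdots v_\ell$ is a subsequence of $w$ if $w=x_1v_1x_2v_2\cdots x_\ell v_\ell x_{\ell+1}$ for some words $x_i$. A word $u$ is $k$-universal with respect to $\Sigma$ if every word of length $k$ over $\Sigma$ is a subsequence of $u$; the universality index of $u$ (with respect to $\Sigma$) is the largest $k$ such that $u$ is $k$-universal. A substitution replaces the letter at one position of the word by another letter of $\Sigma$.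
   Formalization: For k = 0 the bound O(nk) would literally allow no time at all, which is impossible (the answer is then the least letter frequency); the time proved is O(n·max(1,k)), i.e. O(nk) for k ≥ 1 and O(n) for k = 0. *)

(* Defs.v *)
From mathcomp Require Import all_boot.

Set Implicit Arguments.
Unset Strict Implicit.
Unset Printing Implicit Defensive.

Definition Sigma (sigma : nat) : seq nat := iota 1 sigma.

Definition universal (sigma k : nat) (u : seq nat) : Prop :=
  forall v : seq nat,
    size v = k -> {subset v <= Sigma sigma} -> subseq v u.

Definition universality_index (sigma : nat) (u : seq nat) (k : nat) : Prop :=
  universal sigma k u /\ forall k', universal sigma k' u -> k' <= k.

Definition substitution (sigma : nat) (w w' : seq nat) : Prop :=
  exists i a : nat,
    [/\ i < size w, a \in Sigma sigma, a != nth 0 w i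
      & w' = set_nth 0 w i a].

Fixpoint substitutions (sigma m : nat) (w w' : seq nat) : Prop :=
  if m is m'.+1 then
    exists2 w1, substitution sigma w w1 & substitutions sigma m' w1 w'
  else w' = w.

Definition min_substitutions (sigma : nat) (w : seq nat) (k m : nat) : Prop :=
  (exists2 w', substitutions sigma m w w' & universality_index sigma w' k)
  /\ (forall m' w', substitutions sigma m' w w' ->
        universality_index sigma w' k -> m <= m').

(* Unit-cost word RAM with words of [b] bits. A program mentions finitely
   many registers, so only O(1) of them are available to it; the memory is
   addressed by the contents of a register, hence has 2 ^ b cells. *)

Inductive binop :=
  BAdd | BSub | BMul | BDiv | BMod | BAnd | BOr | BXor | BShl | BShr.

Inductive instr :=
  | Const (rd c : nat)                (* rd := c *)
  | Move (rd rs : nat)                (* rd := rs *)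
  | Op (o : binop) (rd r1 r2 : nat)   (* rd := r1 o r2 *)
  | Read (rd ra : nat)                (* rd := M[ra] *)
  | Write (ra rs : nat)               (* M[ra] := rs *)
  | Jump (l : nat)
  | JumpEq (r1 r2 l : nat)            (* if r1 = r2 goto l *)
  | JumpLt (r1 r2 l : nat)            (* if r1 < r2 goto l *)
  | Halt.

Definition program := seq instr.

Record state := State { pc : nat; reg : nat -> nat; mem : nat -> nat }.

(* Arithmetic is modulo 2 ^ b; division by 0 yields 0, and x mod 0 is x. *)
Definition eval_binop (b : nat) (o : binop) (x y : nat) : nat :=
  (match o with
   | BAdd => x + y
   | BSub => x + 2 ^ b - y
   | BMul => x * y
   | BDiv => x %/ y
   | BMod => x %% y
   | BAnd => Nat.land x y
   | BOr => Nat.lor x y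
   | BXor => Nat.lxor x y
   | BShl => x * 2 ^ y
   | BShr => x %/ 2 ^ y
   end) %% 2 ^ b.

(* Running off the end of the program halts. *)
Definition fetch (P : program) (s : state) : instr := nth Halt P (pc s).

Definition set_reg (s : state) (rd v : nat) : state :=
  State (pc s).+1 [eta reg s with rd |-> v] (mem s).

Definition goto (s : state) (l : nat) : state := State l (reg s) (mem s).

Definition step (b : nat) (P : program) (s : state) : state :=
  match fetch P s with
  | Const rd c => set_reg s rd (c %% 2 ^ b)
  | Move rd rs => set_reg s rd (reg s rs)
  | Op o rd r1 r2 => set_reg s rd (eval_binop b o (reg s r1) (reg s r2))
  | Read rd ra => set_reg s rd (mem s (reg s ra))
  | Write ra rs =>
      State (pc s).+1 (reg s) [eta mem s with reg s ra |-> reg s rs]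
  | Jump l => goto s l
  | JumpEq r1 r2 l => goto s (if reg s r1 == reg s r2 then l else (pc s).+1)
  | JumpLt r1 r2 l => goto s (if reg s r1 < reg s r2 then l else (pc s).+1)
  | Halt => s
  end.

Definition halted (P : program) (s : state) : Prop := fetch P s = Halt.

(* Register 0 holds |w|, register 1 holds k, and the letters of w occupy the
   cells 0, ..., |w| - 1; everything else is 0. *)
Definition input_state (w : seq nat) (k : nat) : state :=
  State 0 (nth 0 [:: size w; k]) (nth 0 w).

(* The result is read from register 0. *)
Definition outputs_within (P : program) (b : nat) (s : state) (m t : nat) :
    Prop :=
  exists2 t', t' <= t &
    halted P (iter t' (step b P) s) /\ reg (iter t' (step b P) s) 0 = m.

(* [(trunc_log 2 n).+1] is the number of binary digits of n. The constant
   factor [c] gives the usual Theta(log n) word length: with a single factor,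
   the addressable memory would hold little beyond the input. *)
Definition word_length (c n : nat) : nat := c * (trunc_log 2 n).+1.

(* Main.v *)
Require Import Defs.
From mathcomp Require Import all_boot zify.

Set Implicit Arguments.
Unset Strict Implicit.
Unset Printing Implicit Defensive.

(** A substitution changes the universality index by at most one. Hence the answer is
    [D + H], where [D] is the Hamming distance of [w] to the closest [k]-universal word
    and [H] that to the closest word that is not [k.+1]-universal: one of them is 0, and
    a closest word for the other one has index exactly [k].

    For [H], let [G c i] be the least number of changes in the prefix of length [i] after
    which it misses some word of length [j.+1] ending in [c]. Reading a letter only
    affects [G] at that letter, by at most 1, so a histogram of [G] yields its minimum over
    all letters in constant time.

    For [D], let [D j i] be the distance of the prefix of length [i] to [j]-universality.
    Then [D j.+1 i] is the minimum over [a <= i - sigma] of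
    [D j a + sigma - distinct a i], where [distinct a i] counts the letters occurring at
    the positions in (a, i]. When [i] grows, the terms with [a] at least the previous
    position of the [i]-th letter drop by one. To follow the minimum, each drop of all the
    terms from [x] on deletes the last living element of {1, ..., x} of a set of positions;
    the minimum drops exactly if there is none. Deletions take constant amortised time: the
    set is cut into blocks of [log n] bits, each kept in one word and searched by table
    lookup, and the empty blocks are skipped by a union-find structure on [n / log n] blocks
    in which the smaller of two merged intervals is relabelled. *)

(** * Words, substitutions and universality *)

(** General range updates with minimum queries would cost an extra logarithm. Here only drops of all
    terms from some position on occur. If [cX a] counts the drops at positions at most [a], the term
    at [a] is [a - cX a] up to a constant. View a drop at [x] as a job to be placed in a free slot
    among 1, ..., [x]: taking the last free slot is optimal, and as in Hall's theorem the number of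
    unplaced jobs is the largest excess of [cX a] over [a]. So counting failures replaces storing
    the terms. The restriction [a <= i - sigma] comes from lengths: a factor can be made to contain
    all letters only if it has at least [sigma] positions, and then one change per absent letter
    suffices. The term entering at the right end, at [t], gets its value by at most one deletion
    more than the drop of [D j] from [t - 1] to [t]. As [D j] never grows with the prefix, these
    drops telescope, and a layer makes [O(n)] deletions. With [m = O(n / log n)] blocks, relabelling
    smaller intervals costs [O(m log m) = O(n)] per layer. *)

Definition ham (u v : seq nat) := count (fun p => p.1 != p.2) (zip u v).

Lemma ham_cons a u b v : ham (a :: u) (b :: v) = (a != b) + ham u v.
Proof. by []. Qed.

Lemma ham_sym u v : ham u v = ham v u.
Proof. by elim: u v => [|a u IH] [|b v] //; rewrite !ham_cons IH eq_sym. Qed.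

Lemma ham_refl u : ham u u = 0.
Proof. by elim: u => // a u IH; rewrite ham_cons eqxx. Qed.

Lemma ham0_eq u v : size u = size v -> ham u v = 0 -> u = v.
Proof.
elim: u v => [|a u IH] [|b v] //= [suv]; rewrite ham_cons.
by case: eqP => // -> /= h; rewrite (IH _ suv h).
Qed.

Lemma ham_le_size u v : ham u v <= size u.
Proof. by elim: u v => [|a u IH] [|b v] //=; rewrite ham_cons; have := IH v; case: (a != b) => /=; lia. Qed.

Lemma ham_triangle u v t :
  size u = size v -> size v = size t -> ham u t <= ham u v + ham v t.
Proof.
elim: u v t => [|a u IH] [|b v] [|c t] //= [suv] [svt].
rewrite !ham_cons; have := IH _ _ suv svt.
by case: (a =P c) => ?; case: (a =P b) => ?; case: (b =P c) => ? /=; try lia; subst.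
Qed.

Lemma ham_cat u1 u2 v1 v2 :
  size u1 = size v1 -> ham (u1 ++ u2) (v1 ++ v2) = ham u1 v1 + ham u2 v2.
Proof. by move=> s; rewrite /ham zip_cat // count_cat. Qed.

Lemma ham_rcons u v a b :
  size u = size v -> ham (rcons u a) (rcons v b) = ham u v + (a != b).
Proof. by move=> s; rewrite -!cats1 ham_cat // ham_cons addn0. Qed.

Lemma ham_set_nth u i a : i < size u -> ham u (set_nth 0 u i a) <= 1.
Proof.
elim: u i => [|b u IH] [|i] //= hi; rewrite ham_cons.
  by rewrite ham_refl addn0; case: (_ != _).
by rewrite eqxx; apply: IH.
Qed.

(** Provides the word before the last change on a shortest path from [u] to [v], with which
    minimality arguments compare [v]. Quantifying over [P] expresses that no letters beyond those of
    [u] and [v] are used. *)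
Lemma ham_step u v :
  size u = size v -> 0 < ham u v ->
  exists v1, [/\ size v1 = size u, (forall P : {pred nat}, {subset u <= P} -> {subset v <= P} -> {subset v1 <= P}),
    (ham u v1).+1 = ham u v & ham v1 v <= 1].
Proof.
elim: u v => [|a u IH] [|b v] //= [suv]; rewrite ham_cons.
case: (a =P b) => /= [<-|nab].
  rewrite add0n => /(IH _ suv) [v1 [s1 P1 h1 h2]]; exists (a :: v1); split => /=.
  - by rewrite s1.
  - move=> P Pu Pv x; rewrite inE => /orP[/eqP->|xv]; first by apply: Pu; rewrite inE eqxx.
    by apply: (P1 P) => // y yu; [apply: Pu | apply: Pv]; rewrite inE yu orbT.
  - by rewrite ham_cons eqxx.
  - by rewrite ham_cons eqxx.
move=> _; exists (a :: v); split => /=.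
- by rewrite suv.
- move=> P Pu Pv x; rewrite inE => /orP[/eqP->|xv]; first by apply: Pu; rewrite inE eqxx.
  by apply: Pv; rewrite inE xv orbT.
- by rewrite ham_cons eqxx.
- by rewrite ham_cons ham_refl; case: (_ != _).
Qed.

Section Words.
Variable sigma : nat.
Implicit Types (u v w x : seq nat).

Notation over u := {subset u <= Sigma sigma}.

Lemma size_Sigma : size (Sigma sigma) = sigma.
Proof. by rewrite size_iota. Qed.

Lemma uniq_Sigma : uniq (Sigma sigma).
Proof. by rewrite iota_uniq. Qed.

Lemma over_cat u v : over u -> over v -> over (u ++ v).
Proof. by move=> hu hv x; rewrite mem_cat => /orP[/hu|/hv]. Qed.

Lemma over_cons a u : a \in Sigma sigma -> over u -> over (a :: u).
Proof. by move=> ha hu x; rewrite inE => /orP[/eqP->|/hu]. Qed.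

Lemma over_rcons u a : over u -> a \in Sigma sigma -> over (rcons u a).
Proof. by move=> hu ha x; rewrite mem_rcons inE => /orP[/eqP->|/hu]. Qed.

Lemma over_take a u : over u -> over (take a u).
Proof. by move=> hu x /mem_take /hu. Qed.

Lemma over_drop a u : over u -> over (drop a u).
Proof. by move=> hu x /mem_drop /hu. Qed.

Lemma substitution_size w w' : substitution sigma w w' -> size w' = size w.
Proof. by case=> i [a [hi _ _ ->]]; rewrite size_set_nth; apply/maxn_idPr. Qed.

Lemma substitution_over w w' : over w -> substitution sigma w w' -> over w'.
Proof.
move=> hw [i [a [hi ha _ ->]]] x /(nthP 0) [j].
rewrite size_set_nth (maxn_idPr hi) nth_set_nth /= => hj <-.
by case: ifP => // _; apply: hw; apply: mem_nth.
Qed.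

(** Only an inequality, since a chain of substitutions may return to a position. *)
Lemma substitutions_ham m w w' : over w -> substitutions sigma m w w' ->
  [/\ size w' = size w, over w' & ham w w' <= m].
Proof.
elim: m w => [|m IH] w hw /=; first by move=> ->; rewrite ham_refl.
case=> w1 h1 /(IH _ (substitution_over hw h1)) [s2 o2 h2].
have s1 := substitution_size h1; split=> //; first by rewrite s2.
have : ham w w1 <= 1 by case: h1 => i [a [hi _ _ ->]]; apply: ham_set_nth.
have := ham_triangle (esym s1) (esym s2); lia.
Qed.

Lemma substitutions_cons m a w w' :
  substitutions sigma m w w' -> substitutions sigma m (a :: w) (a :: w').
Proof.
elim: m w => [|m IH] w /=; first by move=> ->.
case=> w1 [i [b [hi hb hn ->]]] h2; exists (a :: set_nth 0 w i b); last exact: IH.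
by exists i.+1, b.
Qed.

Lemma ham_substitutions w w' : size w' = size w -> over w' ->
  substitutions sigma (ham w w') w w'.
Proof.
elim: w w' => [|a w IH] [|b w'] //= [s] o.
have ow' : over w' by move=> x hx; apply: o; rewrite inE hx orbT.
rewrite ham_cons; case: eqP => [<-|nab] /=.
  by apply: substitutions_cons; apply: IH.
exists (b :: w); last by apply: substitutions_cons; apply: IH.
exists 0, b; split=> //; first by apply: o; rewrite inE eqxx.
by apply/eqP => e; apply: nab.
Qed.

Lemma subseq_cat_split (x y u : seq nat) :
  subseq (x ++ y) u -> exists2 a, a <= size u & subseq x (take a u) && subseq y (drop a u).
Proof.
elim: u x => [|b u IH] [|c x] /=; try by [exists 0 | exists 0; rewrite // sub0seq].
case: eqP => [->|nbc].
  by move=> /IH [a ha /andP[h1 h2]]; exists a.+1 => //=; rewrite eqxx h1.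
rewrite -cat_cons => /IH [a ha /andP[h1 h2]]; exists a.+1 => //=.
by case: eqP => // _; rewrite h1.
Qed.

Lemma universal0 u : universal sigma 0 u.
Proof. by move=> v /size0nil -> _; rewrite sub0seq. Qed.

Lemma universal_cat j u v :
  universal sigma j u -> {subset Sigma sigma <= v} -> universal sigma j.+1 (u ++ v).
Proof.
move=> hu hv x; elim/last_ind: x => // x c _; rewrite size_rcons => -[sx] ox.
rewrite -cats1; apply: cat_subseq.
  by apply: hu => // y hy; apply: ox; rewrite mem_rcons inE hy orbT.
by rewrite sub1seq; apply: hv; apply: ox; rewrite mem_rcons inE eqxx.
Qed.

Lemma universal_catr j u v : universal sigma j u -> universal sigma j (u ++ v).
Proof. by move=> hu x sx ox; apply: subseq_trans (prefix_subseq u v); apply: hu. Qed.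

Lemma universal_anti j u : 0 < sigma -> universal sigma j.+1 u -> universal sigma j u.
Proof.
move=> s0 hu x sx ox; apply: subseq_trans (subseq_rcons x 1) _.
apply: hu; first by rewrite size_rcons sx.
by apply: over_rcons => //; rewrite mem_iota; lia.
Qed.

Lemma universal_le j j' u : 0 < sigma -> j <= j' -> universal sigma j' u -> universal sigma j u.
Proof.
move=> s0 hj; rewrite -(subnK hj); elim: (j' - j) => // d IH.
by rewrite addSn => /(universal_anti s0).
Qed.

(* Let [c] be the first letter of [x] that greedy matching does not place before the
   modified position. Doubling it in [x] helps: the embedding of its first copy in [u] reaches
   that position, so the part of [x] from [c] on embeds behind it. *)
Lemma universal_change k u v : size v = size u -> ham u v <= 1 ->
  universal sigma k.+1 u -> universal sigma k v.
Proof.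
move=> s; have [/eqP h0|h0] := boolP (ham u v == 0).
  move=> _ hu x sx ox; rewrite -(ham0_eq (esym s) h0).
  case: x sx ox => [|c x] sx ox; first by rewrite sub0seq.
  apply: subseq_trans (subseq_cons (c :: x) c) _.
  apply: hu; first by rewrite /= -sx.
  by apply: over_cons => //; apply: ox; rewrite inE eqxx.
move=> h1; have {h0 h1} : exists u1 a b u2, u = u1 ++ a :: u2 /\ v = u1 ++ b :: u2.
  elim: u v s h0 h1 => [|a u IH] [|b v] //= [s]; rewrite ham_cons.
  case: (a =P b) => [<-|nab] /=.
    rewrite add0n => h0 h1; have [u1 [c [d [u2 [-> ->]]]]] := IH _ s h0 h1.
    by exists (a :: u1), c, d, u2.
  move=> _ h1; have h0 : ham u v = 0 by lia.
  by exists [::], a, b, u; rewrite (ham0_eq (esym s) h0).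
case=> u1 [a [b [u2 [-> ->]]]] hu x sx ox.
have [c|] := boolP (subseq x u1).
  by apply: subseq_trans c _; apply: prefix_subseq.
have {hu} : forall x1 x2, x = x1 ++ x2 -> subseq x1 u1 -> ~~ subseq x u1 ->
    subseq x (u1 ++ u2); last first.
  move=> /(_ [::] x erefl (sub0seq _)) H /H h; apply: subseq_trans h _.
  by apply: cat_subseq => //; apply: subseq_cons.
move=> x1 x2; elim: x2 x1 => [|c x2 IH] x1 ex s1 n1.
  by move: n1; rewrite ex cats0 s1.
have [s2|n2] := boolP (subseq (rcons x1 c) u1).
  by apply: (IH (rcons x1 c)) => //; rewrite cat_rcons.
have : subseq (rcons x1 c ++ (c :: x2)) (u1 ++ a :: u2).
  apply: hu; first by rewrite -sx ex !size_cat size_rcons /=; lia.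
  move=> y; rewrite mem_cat mem_rcons inE => /orP[/orP[/eqP->|hy]|hy]; apply: ox;
    by rewrite ex mem_cat ?hy ?inE ?eqxx ?orbT.
case/subseq_cat_split => p hp /andP[hp1 hp2].
rewrite ex; apply: cat_subseq => //.
have hp3 : size u1 < p.
  rewrite ltnNge; apply: contra n2 => hp3; apply: subseq_trans hp1 _.
  by rewrite take_cat ltn_neqAle hp3 andbT; case: eqP => [->|_] /=;
    [rewrite subnn take0 cats0 | apply: take_subseq].
apply: subseq_trans hp2 _; rewrite drop_cat ltnNge (ltnW hp3) /=.
by rewrite -(subnSK hp3) /=; apply: drop_subseq.
Qed.

(** Enumerating the finitely many words of length [j] makes universality decidable, so that a missed
    word can be produced constructively in [universal_or_missed]. *)
Fixpoint words j : seq (seq nat) :=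
  if j is j'.+1 then [seq c :: v | c <- Sigma sigma, v <- words j'] else [:: [::]].

Lemma mem_words j v : reflect (size v = j /\ over v) (v \in words j).
Proof.
apply: (iffP idP).
  elim: j v => [|j IH] v /=; first by rewrite inE => /eqP->.
  case/allpairsP => -[c v'] [/= hc /IH [sv ov] ->] /=; rewrite sv; split=> //.
  exact: over_cons.
elim: j v => [|j IH] [|c v] //= [] // [sv] ov.
apply: allpairs_f; first by apply: ov; rewrite inE eqxx.
by apply: IH; split=> // x hx; apply: ov; rewrite inE hx orbT.
Qed.

Lemma universal_or_missed j u : universal sigma j u \/
  exists v, [/\ size v = j, over v & ~~ subseq v u].
Proof.
have [/allP h|/allPn[v /mem_words[sv ov] nv]] := boolP (all (fun v => subseq v u) (words j)).
  by left=> v sv ov; apply: h; apply/mem_words.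
by right; exists v.
Qed.

(** Take for [a] the length of the shortest [j]-universal prefix (the first [j] arches of [u]). The
    prefix shorter by one letter misses some [v], so when [v] followed by [c] is embedded in [u],
    the letter [c] lands behind position [a]. *)
Lemma universal_split j u : universal sigma j.+1 u ->
  exists2 a, a <= size u & universal sigma j (take a u) /\ {subset Sigma sigma <= drop a u}.
Proof.
move=> hu.
pose bad (a : nat) := exists v, [/\ size v = j, over v & ~~ subseq v (take a u)].
have [a ha [ua na]] : exists2 a, a <= size u & universal sigma j (take a u) /\
   (a = 0 \/ bad a.-1).
  have : universal sigma j (take (size u) u).
    rewrite take_size; case: (universal_or_missed j u) => [//|[v [sv ov]]].
    (* [universal_anti] needs a letter to append; over the empty alphabet the only word is the empty
       one. *)
    case: (posnP sigma) => [s0|s0]; last first.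
      by rewrite (universal_anti s0 hu).
    case: v sv ov => [|c v] sv ov; first by rewrite sub0seq.
    by have := ov c; rewrite s0 inE eqxx /= => /(_ isT).
  move: (leqnn (size u)); move: {1 3}(size u) => a; elim: a => [|a IH] ha ua.
    by exists 0 => //; split=> //; left.
  case: (universal_or_missed j (take a u)) => [/(IH (ltnW ha)) //|b].
  by exists a.+1 => //; split=> //; right.
exists a => //; split=> // c hc; case: na => [a0|[v [sv ov nv]]].
  (* If the empty prefix is already [j]-universal, embedding the word of [j.+1] copies of [c] shows
     that [c] occurs in [u]. *)
  rewrite a0 drop0; move: (hu (nseq j.+1 c)); rewrite size_nseq => /(_ erefl).
  move=> h; have /h /mem_subseq : over (nseq j.+1 c) by move=> y /nseqP[-> _].
  by move=> /(_ c); apply; rewrite inE eqxx.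
have : subseq (v ++ [:: c]) u.
  by apply: hu; [rewrite size_cat sv addn1 | apply: over_cat => // y; rewrite inE => /eqP->].
case/subseq_cat_split => p hp /andP[hp1]; rewrite sub1seq => hp2.
have hap : a <= p.
  rewrite leqNgt; apply: contra nv => hpa; apply: subseq_trans hp1 _.
  have -> : take p u = take p (take a.-1 u) by rewrite take_takel //; lia.
  exact: take_subseq.
by move: hp2; rewrite -(subnK hap) -drop_drop => /mem_drop.
Qed.

Lemma cover_size u : {subset Sigma sigma <= u} -> sigma <= size u.
Proof. by move=> h; rewrite -{1}size_Sigma; apply: uniq_leq_size => //; apply: uniq_Sigma. Qed.

Lemma universal_size j u : universal sigma j u -> j * sigma <= size u.
Proof.
elim: j u => [|j IH] u; first by rewrite mul0n.
case/universal_split => a ha [/IH h1 /cover_size h2].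
by move: h1 h2; rewrite size_takel // size_drop mulSn; lia.
Qed.

(* Each repeated letter of [f] (all but its last occurrence) may be replaced by a missing one. *)
Fixpoint fill (f ms : seq nat) : seq nat :=
  if f is a :: f' then
    if a \in f' then
      if ms is c :: ms' then c :: fill f' ms' else f
    else a :: fill f' ms
  else [::].

(** The premise of the last conjunct says that there is room: [f] has [size f - size (undup f)]
    repeated positions, and each can take one letter of [ms]. *)
Lemma fill_spec f ms : [/\ size (fill f ms) = size f, {subset f <= fill f ms},
  {subset fill f ms <= f ++ ms}, ham f (fill f ms) <= size ms &
  size (undup f) + size ms <= size f -> {subset ms <= fill f ms}].
Proof.
elim: f ms => [|a f IH] ms /=.
  by split=> // h; case: ms h.
case: ifP => [af|naf].
  case: ms => [|c ms].
    by rewrite ham_refl cats0; split.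
  have [s1 h1 h2 h3 h4] := IH ms; split=> /=.
  - by rewrite s1.
  - by move=> x; rewrite !inE => /orP[/eqP->|/h1->]; rewrite ?(h1 _ af) orbT.
  - move=> x; rewrite !inE mem_cat inE => /orP[->|/h2]; first by rewrite !orbT.
    by rewrite mem_cat => /orP[]->; rewrite !orbT.
  - by rewrite ham_cons; case: (_ != _) => /=; lia.
  - move=> hs x; rewrite !inE => /orP[->//|hx]; apply/orP; right; apply: h4 => //.
    by move: hs; rewrite addnS ltnS.
have [s1 h1 h2 h3 h4] := IH ms; split=> /=.
- by rewrite s1.
- by move=> x; rewrite !inE => /orP[->|/h1->]; rewrite ?orbT.
- move=> x; rewrite !inE mem_cat => /orP[->//|/h2].
  by rewrite mem_cat => ->; rewrite orbT.
- by rewrite ham_cons eqxx.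
- by move=> hs x hx; rewrite inE h4 ?orbT //; lia.
Qed.

Lemma factor_cover f : over f -> sigma <= size f ->
  exists f', [/\ size f' = size f, over f', {subset Sigma sigma <= f'}
    & ham f f' <= sigma - size (undup f)].
Proof.
move=> hf sf; pose ms := [seq c <- Sigma sigma | c \notin f].
have e : size (undup f) + size ms = sigma.
  have h : size (undup f) = size [seq c <- Sigma sigma | c \in f].
    apply: perm_size; apply: uniq_perm; rewrite ?undup_uniq ?filter_uniq ?uniq_Sigma //.
    by move=> x; rewrite mem_undup mem_filter; case hx: (x \in f) => //; rewrite (hf _ hx).
  rewrite h -[RHS]size_Sigma !size_filter addnC addnC.
  by rewrite (count_predC (fun c => c \in f)).
have [s1 h1 h2 h3 h4] := fill_spec f ms.
exists (fill f ms); split=> //.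
- by move=> x /h2; rewrite mem_cat mem_filter => /orP[/hf|/andP[]].
- move=> c hc; have [cf|cf] := boolP (c \in f); first exact: h1.
  by apply: h4; [rewrite e | rewrite mem_filter cf].
- by rewrite (leq_trans h3) // -e addKn.
Qed.

(** Every letter of [f'] occurs in [f] or was written by a change, so [sigma] is at most the number
    of distinct letters of [f] plus the number of changes. *)
Lemma factor_cover_lb f f' : size f' = size f -> {subset Sigma sigma <= f'} ->
  sigma - size (undup f) <= ham f f'.
Proof.
move=> s h; pose ch := [seq p.2 | p <- zip f f' & p.1 != p.2].
have sc : size ch = ham f f' by rewrite size_map size_filter.
have sub : {subset f' <= undup f ++ ch}.
  rewrite /ch => x; rewrite mem_cat mem_undup; move: s {h sc ch}.
  elim: f' f => [|b f' IH] [|a f] //= [s]; rewrite !inE.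
  case: (a =P b) => [->|nab] /=.
    by case: eqP => //= _ /(IH _ s).
  rewrite inE; case: (x =P b) => //= [_ _|_]; first by rewrite orbT.
  by move=> /(IH _ s) /orP[->|->]; rewrite !orbT.
have : size (Sigma sigma) <= size (undup f ++ ch).
  by apply: uniq_leq_size (uniq_Sigma) _ => x /h /sub.
rewrite size_Sigma size_cat sc; lia.
Qed.

End Words.

(** * Distances to universal and to non-universal words *)

Section Distances.
Variable sigma : nat.
Hypothesis sigma_gt1 : 1 < sigma.
Implicit Types (u v w x : seq nat).

Notation over u := {subset u <= Sigma sigma}.

Definition universal_dist x j d :=
  (exists u, [/\ size u = size x, over u, universal sigma j u & ham x u <= d])
  /\ forall u, size u = size x -> over u -> universal sigma j u -> d <= ham x u.

(* The second disjunct lets any [d > size x] stand for infinity (only relevant for [j = 0]). *)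
Definition missing_dist x j d :=
  ((exists u v, [/\ size u = size x, over u, size v = j, over v
                  & ~~ subseq v u /\ ham x u <= d]) \/ size x < d)
  /\ forall u v, size u = size x -> over u -> size v = j -> over v ->
       ~~ subseq v u -> d <= ham x u.

(** Always finite, unlike [missing_dist]: over at least two letters every [c] can be replaced by
    another letter. *)
Definition missing_dist_last x j c d :=
  (exists u v, [/\ size u = size x, over u, size v = j, over v
                 & ~~ subseq (rcons v c) u /\ ham x u <= d])
  /\ forall u v, size u = size x -> over u -> size v = j -> over v ->
       ~~ subseq (rcons v c) u -> d <= ham x u.

Let sigma_gt0 : 0 < sigma. Proof. exact: ltnW. Qed.

Lemma universality_index_exact k u v : size v = k.+1 -> over v -> ~~ subseq v u ->
  universal sigma k u -> universality_index sigma u k.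
Proof.
move=> sv ov nv hk; split=> // k' hk'; rewrite leqNgt; apply: contra nv => lt.
exact: (universal_le sigma_gt0 lt hk').
Qed.

(** Either [w] misses a word of length [k.+1] and [h = 0], or [w] is [k]-universal and [d = 0]. A
    closest word [u'] missing length [k.+1] with [h > 0] has a neighbour one change closer to [w];
    that one is [k.+1]-universal by minimality, so [u'] is still [k]-universal by
    [universal_change]. Dually, for [d > 0] a closest [k]-universal word is not [k.+1]-universal, as
    its neighbour closer to [w] would be [k]-universal. *)
Lemma min_substitutions_add w k d h : over w -> universal_dist w k d ->
  missing_dist w k.+1 h -> h <= size w -> min_substitutions sigma w k (d + h).
Proof.
move=> ow [[u [su ou uu hu]] lbd] [ubh lbh] hw.
case: ubh => [[u' [v' [su' ou' sv' ov' [nv' hu']]]]|]; last by rewrite ltnNge hw.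
have huE : ham w u = d by apply/eqP; rewrite eqn_leq hu lbd.
have hu'E : ham w u' = h by apply/eqP; rewrite eqn_leq hu' (lbh u' v').
split; last first.
  move=> m u1 /(substitutions_ham ow) [s1 o1 h1] [k1 kmax].
  case: (universal_or_missed sigma k.+1 u1) => [/kmax|[v [sv ov nv]]]; first by rewrite ltnn.
  have := lbd u1 s1 o1 k1; have := lbh u1 v s1 o1 sv ov nv.
  have [d0|d0] := posnP d; first by rewrite d0 => h2 _; lia.
  suff -> : h = 0 by lia.
  case: (universal_or_missed sigma k.+1 w) => [/(universal_anti sigma_gt0) wk|].
    by have := lbd w erefl ow wk; rewrite ham_refl; lia.
  case=> v2 [sv2 ov2 nv2].
  by have := lbh w v2 erefl ow sv2 ov2 nv2; rewrite ham_refl; lia.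
have [d0|d0] := posnP d.
  have [h0|h0] := posnP h.
    rewrite d0 h0 /=; exists w => //; have e : w = u' by apply: ham0_eq; lia.
    apply: (universality_index_exact sv' ov'); first by rewrite e.
    by rewrite (ham0_eq (v := u) (u := w)) //; lia.
  exists u'.
    by rewrite d0 -hu'E; apply: ham_substitutions.
  apply: (universality_index_exact sv' ov') => //.
  have [||u1 [s1 P1 e1 h1]] := @ham_step w u'; [by rewrite su'|by rewrite hu'E|].
  apply: (universal_change _ h1); first by rewrite s1.
  case: (universal_or_missed sigma k.+1 u1) => // -[v [sv ov nv]].
  have o1 : over u1 by apply: (P1 (mem (Sigma sigma))).
  by have := lbh u1 v s1 o1 sv ov nv; lia.
have h0 : h = 0.
  case: (universal_or_missed sigma k.+1 w) => [/(universal_anti sigma_gt0) wk|].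
    by have := lbd w erefl ow wk; rewrite ham_refl; lia.
  case=> v2 [sv2 ov2 nv2].
  by have := lbh w v2 erefl ow sv2 ov2 nv2; rewrite ham_refl; lia.
have nuk : ~ universal sigma k.+1 u.
  move=> hk; have [||u1 [s1 P1 e1 h1]] := @ham_step w u; [by rewrite su|by rewrite huE|].
  have u1k : universal sigma k u1.
    by apply: (universal_change _ _ hk); rewrite ?s1 ?su // ham_sym.
  have o1 : over u1 by apply: (P1 (mem (Sigma sigma))).
  by have := lbd u1 s1 o1 u1k; lia.
exists u; first by rewrite h0 addn0 -huE; apply: ham_substitutions.
case: (universal_or_missed sigma k.+1 u) => // -[v [sv ov nv]].
exact: (universality_index_exact sv ov).
Qed.

Lemma universal_dist0 x : over x -> universal_dist x 0 0.
Proof.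
by move=> ox; split=> //; exists x; rewrite ham_refl; split=> //; apply: universal0.
Qed.

Lemma universal_dist_extend w a j d d' : over w -> a < size w ->
  universal_dist (take a w) j d -> universal_dist (take a.+1 w) j d' -> d' <= d.
Proof.
move=> ow aw [[u [su ou uu hu]] _] [_ lb].
have e : take a.+1 w = rcons (take a w) (nth 0 w a) by rewrite (take_nth 0).
apply: leq_trans (lb (rcons u (nth 0 w a)) _ _ _) _.
- by rewrite e !size_rcons su.
- by apply: over_rcons => //; apply: ow; apply: mem_nth.
- by rewrite -cats1; apply: universal_catr.
- by rewrite e ham_rcons // eqxx addn0.
Qed.

(** Upper bound: behind the cut [a], [factor_cover] supplies all letters. Lower bound:
    [universal_split] cuts any competing word, and [universal_size] and [cover_size] force the cut
    into the range considered. *)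
Lemma universal_dist_step w i j f d : over w -> i <= size w ->
  (forall a, j * sigma <= a <= i -> universal_dist (take a w) j (f a)) ->
  (exists a, [/\ j * sigma <= a, a + sigma <= i
     & f a + (sigma - size (undup (drop a (take i w)))) = d]) ->
  (forall a, j * sigma <= a -> a + sigma <= i ->
     d <= f a + (sigma - size (undup (drop a (take i w))))) ->
  universal_dist (take i w) j.+1 d.
Proof.
move=> ow iw hf [a [ja ai <-]] lb.
have cut b : b <= i -> take i w = take b w ++ drop b (take i w).
  by move=> bi; rewrite -[LHS](cat_take_drop b) take_takel.
have ai' : a <= i by lia.
split.
  have [|[u1 [s1 o1 u1j h1]] _] := hf a; first by rewrite ja.
  have [||u2 [s2 o2 c2 h2]] := @factor_cover sigma (drop a (take i w)).
  - by apply/over_drop/over_take.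
  - by rewrite size_drop size_takel //; lia.
  exists (u1 ++ u2); split.
  - by rewrite [in RHS](cut a ai') !size_cat s1 s2.
  - exact: over_cat.
  - exact: universal_cat.
  - by rewrite {1}(cut a ai') ham_cat ?leq_add.
move=> u su ou /universal_split [b bu [ub cb]].
have si : size (take i w) = i by rewrite size_takel.
have jb := universal_size ub; rewrite size_takel // in jb.
have bs := cover_size cb; rewrite size_drop su si in bs.
rewrite su si in bu.
have sbw : size (take b w) = b by rewrite size_takel; lia.
have sbu : size (take b u) = b by rewrite size_takel // su si.
apply: leq_trans (lb b jb _) _; first by lia.
have -> : ham (take i w) u = ham (take b w) (take b u) + ham (drop b (take i w)) (drop b u).
  by rewrite {1}(cut b) // -{1}(cat_take_drop b u) ham_cat // sbw sbu.
apply: leq_add.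
  have [|_] := hf b; first by rewrite jb.
  by apply=> //; [rewrite sbw | apply: over_take].
by apply: factor_cover_lb => //; rewrite !size_drop su.
Qed.

Lemma missing_dist0 x d : size x < d -> missing_dist x 0 d.
Proof. by move=> h; split; [right | move=> u v _ _ /size0nil->; rewrite sub0seq]. Qed.

Lemma missing_dist_last0 j c : missing_dist_last [::] j c 0.
Proof.
split=> //; exists [::], (nseq j 1); rewrite size_nseq; split=> //.
  by move=> y /nseqP[-> _]; rewrite mem_iota; lia.
by split=> //; case: (nseq j 1).
Qed.

Lemma missing_dist_last_size x j c g : missing_dist_last x j c g -> g <= size x.
Proof.
case=> -[u [v [su ou sv ov [nv hu]]]] lb.
exact: leq_trans (lb u v su ou sv ov nv) (ham_le_size _ _).
Qed.

Lemma missing_dist_last_le x j c g h : missing_dist_last x j c g ->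
  missing_dist x j h -> g <= h.
Proof.
move=> G [[[u [v [su ou sv ov [nv hu]]]]|hx] _]; last first.
  by apply: ltnW; apply: leq_ltn_trans (missing_dist_last_size G) hx.
case: G => _ lb; apply: leq_trans (lb u v su ou sv ov _) hu.
by apply: contra nv; apply: subseq_trans; apply: subseq_rcons.
Qed.

Lemma subseq_rcons2 v c u a :
  subseq (rcons v c) (rcons u a) = if a == c then subseq v u else subseq (rcons v c) u.
Proof.
rewrite -subseq_rev !rev_rcons /= eq_sym; case: eqP => _; first by rewrite subseq_rev.
by rewrite -rev_rcons subseq_rev.
Qed.

(** A letter other than [c] is best kept. The letter [c] is either replaced ([g.+1]) or kept, and
    then the word before [c] must already be missed ([h]). Since [g <= h], the value grows by at
    most one, and it does so exactly if [a] is [c] and [g < h]. *)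
Lemma missing_dist_last_step x a j c g h : a \in Sigma sigma ->
  missing_dist_last x j c g -> missing_dist x j h ->
  missing_dist_last (rcons x a) j c (if a == c then minn g.+1 h else g).
Proof.
move=> aS G H; have gx := missing_dist_last_size G; have gh := missing_dist_last_le G H.
case: G H => -[ug [vg [sug oug svg ovg [nvg hug]]]] lbg [ubh lbh].
have [b bS nbc] : exists2 b, b \in Sigma sigma & b != c.
  by case: (c =P 1) => [->|/eqP]; [exists 2 | exists 1]; rewrite // ?mem_iota ?[1 == _]eq_sym //; lia.
split; last first.
  move=> u v; case/lastP: u => [|u e]; first by rewrite size_rcons.
  rewrite !size_rcons => -[su] oue sv ov; rewrite subseq_rcons2 ham_rcons //.
  have ou : over u by move=> y hy; apply: oue; rewrite mem_rcons inE hy orbT.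
  case: (e =P c) => [->|nec] nv.
    have := lbh u v su ou sv ov nv; case: (a =P c) => //=; lia.
  have := lbg u v su ou sv ov nv; case: (a =P c) => [->|_] /=; last by lia.
  by rewrite eq_sym; move/eqP: nec => ->; lia.
case: (a =P c) => [eac|nac]; last first.
  exists (rcons ug a), vg; rewrite !size_rcons sug; split=> //; first exact: over_rcons.
  rewrite subseq_rcons2 ham_rcons // eqxx addn0; split=> //.
  by move/eqP/negPf: nac => ->.
have [hg|hg] := leqP g.+1 h.
  exists (rcons ug b), vg; rewrite !size_rcons sug; split=> //; first exact: over_rcons.
  rewrite subseq_rcons2 ham_rcons // (negPf nbc); split=> //.
  by rewrite -addn1 leq_add // leq_b1.
case: ubh => [[u [v [su ou sv ov [nv hu]]]]|hx]; last by lia.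
exists (rcons u a), v; rewrite !size_rcons su; split=> //; first exact: over_rcons.
by rewrite subseq_rcons2 ham_rcons // eac eqxx addn0.
Qed.

Lemma missing_dist_succ x j g h : 
  (forall c, c \in Sigma sigma -> missing_dist_last x j c (g c)) ->
  (exists2 c, c \in Sigma sigma & g c = h) ->
  (forall c, c \in Sigma sigma -> h <= g c) -> missing_dist x j.+1 h.
Proof.
move=> hg [c cS <-] lb; split.
  left; have [[u [v [su ou sv ov [nv hu]]]] _] := hg c cS.
  by exists u, (rcons v c); rewrite size_rcons sv; split=> //; apply: over_rcons.
move=> u v su ou; case/lastP: v => // v e; rewrite size_rcons => -[sv] ove nv.
have eS : e \in Sigma sigma by apply: ove; rewrite mem_rcons inE eqxx.
apply: leq_trans (lb e eS) _; apply: (hg e eS).2 nv => //.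
by move=> y hy; apply: ove; rewrite mem_rcons inE hy orbT.
Qed.

End Distances.

(** * Distinct letters and deletions *)

Definition distinct (v : seq nat) a i := size (undup (drop a (take i v))).

(* The last position [<= i] of letter [c] in [v], counted from 1; it is 0 if there is none. *)
Fixpoint last_pos (v : seq nat) i c :=
  if i is i'.+1 then if nth 0 v i' == c then i else last_pos v i' c else 0.

Lemma last_pos_le v i c : last_pos v i c <= i.
Proof. by elim: i => //= i IH; case: eqP => // _; apply: leqW. Qed.

Lemma size_undup_rcons (s : seq nat) c : size (undup (rcons s c)) = size (undup s) + (c \notin s).
Proof.
elim: s => //= a s IH; rewrite mem_rcons !inE (eq_sym c a).
have [->|nac] := eqVneq a c => /=; last by case: (a \in s); rewrite /= IH.
by rewrite IH; case: (c \in s); rewrite /= ?addn0 ?addn1.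
Qed.

Section Distinct.
Variable v : seq nat.
Let n := size v.

Lemma drop_take_rcons a i : a <= i -> i < n ->
  drop a (take i.+1 v) = rcons (drop a (take i v)) (nth 0 v i).
Proof.
move=> ai iv; rewrite (take_nth 0) // -!cats1 drop_cat size_takel; last exact: ltnW.
by case: ltngtP ai => // -> _; rewrite subnn drop0 drop_oversize // size_takel // ltnW.
Qed.

Lemma last_pos_notin i c a : a <= i -> i <= n ->
  (last_pos v i c <= a) = (c \notin drop a (take i v)).
Proof.
elim: i a => [|i IH] a ai iv; first by rewrite take0.
have [ai'|ai'] := leqP a i; last first.
  have -> : a = i.+1 by lia.
  by rewrite drop_oversize ?size_takel // last_pos_le.
rewrite drop_take_rcons // mem_rcons inE /= eq_sym.
by case: eqP => /= [_|_]; [apply/negbTE; rewrite -ltnNge | apply: IH => //; lia].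
Qed.

Lemma distinct_succ a i : a <= i -> i < n ->
  distinct v a i.+1 = distinct v a i + (last_pos v i (nth 0 v i) <= a).
Proof.
by move=> ai iv; rewrite /distinct drop_take_rcons // size_undup_rcons last_pos_notin //; lia.
Qed.

Lemma distinct_drop t i : t < i -> i <= n ->
  distinct v t i = distinct v t.+1 i + (last_pos v i (nth 0 v t) <= t.+1).
Proof.
move=> ti iv; rewrite /distinct last_pos_notin // (drop_nth 0) ?size_takel //=.
by rewrite nth_take //; case: (_ \in _); rewrite /= ?addn0 ?addn1.
Qed.

Lemma distinct_id i : i <= n -> distinct v i i = 0.
Proof. by move=> h; rewrite /distinct drop_oversize // size_takel. Qed.

Lemma distinct_le sigma a i : {subset v <= Sigma sigma} -> distinct v a i <= sigma.
Proof.
move=> h; rewrite -[leqRHS](size_Sigma sigma); apply: uniq_leq_size; first exact: undup_uniq.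
by move=> x; rewrite mem_undup => /mem_drop /mem_take /h.
Qed.

End Distinct.

(** * Greedy deletions and their number of failures *)

Fixpoint dead (alive : nat -> bool) a := if a is a'.+1 then dead alive a' + ~~ alive a else 0.

Lemma dead_le alive a : dead alive a <= a.
Proof. by elim: a => //= a IH; case: (alive _); lia. Qed.

(** The value 0 encodes that no element of {1, ..., x} is alive, that is, a failing deletion. *)
Definition is_pred_alive (alive : nat -> bool) x r :=
  [/\ r <= x, r = 0 \/ alive r & forall s, r < s <= x -> ~~ alive s].

(* Bookkeeping of a sequence of deletions: a deletion at [x] kills the last living
   element of {1, ..., x} or, if there is none, increases the number [F] of failures;
   [cX a] counts the deletions at positions at most [a]. *)
Record deletions (M A : nat) (alive : nat -> bool) (F : nat) (cX : nat -> nat) : Prop := {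
  deletions_bound : forall a, a < M -> cX a <= F + dead alive a;
  deletions_alive : forall s, 0 < s < M -> alive s -> cX s.-1 = F + dead alive s.-1;
  deletions_beyond : forall s, A < s < M -> alive s;
  deletions_const : forall a, A <= a -> cX a = cX A;
  deletions_lt : A.+1 < M }.

Lemma dead_del alive alive' M r a : r < M -> a < M ->
  (forall s, 0 < s < M -> alive' s = alive s && (s != r)) -> r = 0 \/ alive r ->
  dead alive' a = dead alive a + (0 < r <= a).
Proof.
move=> rM aM h hr; elim: a aM => [|a IH] aM /=; first by case: r {h hr rM}.
rewrite IH; last by lia.
rewrite h; last by lia.
case: (a.+1 =P r) => [e|ne] /=; rewrite ?andbT ?andbF; last by lia.
subst r; case: hr => [|->] //=; lia.
Qed.

(** A deletion at a position at most [a] fails or kills an element at most [a], whence the bound on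
    [cX]. Below a living [s] it is an equality: a deletion at or behind [s] cannot fail and prefers
    [s] to any smaller element. *)
Lemma deletions_step M A alive alive' F cX x r : deletions M A alive F cX -> x <= A ->
  is_pred_alive alive x r -> (forall s, 0 < s < M -> alive' s = alive s && (s != r)) ->
  deletions M A alive' (F + (r == 0)) (fun a => cX a + (x <= a)).
Proof.
case=> hb ha hA hc AM xA [rx hr hrx] h'.
have rM : r < M by lia.
have dd a (aM : a < M) := dead_del rM aM h' hr.
split=> //.
- move=> a aM; rewrite dd //; have := hb a aM.
  have [xa|ax] := leqP x a; last by lia.
  by case: (posnP r) => [->|r0] /=; lia.
- move=> s sM; rewrite h' // => /andP[hs sr]; rewrite dd; last by lia.
  rewrite (ha s sM hs); have [xs|sx] := ltnP x s; first by case: (posnP r) => [->|r0]; lia.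
  have [sr'|rs] := ltnP s r; last first.
    have rsx : r < s <= x by move/eqP: sr; lia.
    by have := hrx s rsx; rewrite hs.
  lia.
- by move=> s hs; rewrite h' ?hA //=; lia.
- by move=> a hAa; rewrite hc //; lia.
Qed.

(** The maximum of [cX a - a] is attained just before the first living element, since all elements
    up to there are dead. Such an element exists because [A.+1] is alive. *)
Lemma deletions_max M A alive F cX : deletions M A alive F cX ->
  (exists2 a, a <= A & cX a = F + a) /\ (forall a, a < M -> cX a <= F + a).
Proof.
case=> hb ha hA hc AM; split; last first.
  by move=> a aM; rewrite (leq_trans (hb a aM)) // leq_add2l dead_le.
have ex : exists s, (0 < s) && alive s by exists A.+1; rewrite /= hA //; lia.
case: (ex_minnP ex) => s /andP[s0 hs] smin.
have sA : s <= A.+1 by apply: smin; rewrite /= hA //; lia.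
exists s.-1; first by lia.
rewrite (ha s) //; last by lia.
congr addn; have : forall a, a < s -> dead alive a = a.
  elim=> //= a IH las; rewrite IH; last by lia.
  case e: (alive a.+1) => /=; last by lia.
  by have := smin a.+1; rewrite e /= => /(_ isT); lia.
by apply; lia.
Qed.

Lemma deletions_weaken M A alive F cX : deletions M A alive F cX -> A.+2 < M ->
  deletions M A.+1 alive F cX.
Proof.
case=> hb ha hA hc AM AM'; split=> //.
- by move=> s hs; apply: hA; lia.
- by move=> a hAa; rewrite hc ?[RHS]hc //; lia.
Qed.

(** * The recurrence for one layer in terms of deletions *)

Section Layer.
Variables (sigma M : nat) (v : seq nat) (f : nat -> nat).
Hypothesis sigma_gt0 : 0 < sigma.
Hypothesis overv : {subset v <= Sigma sigma}.
Hypothesis fdec : forall a, a < size v -> f a.+1 <= f a.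
Hypothesis sizeM : size v < M.
Implicit Types alive : nat -> bool.

(** Solved for the term of the recurrence, the equation reads [f a + sigma - distinct v a i = f 0 +
    sigma - (cX a - a)]; by [deletions_max] the least term is [f 0 + sigma - F]. *)
Definition layer_inv i alive F := exists2 cX, deletions M (i - sigma) alive F cX &
  forall a, a <= i - sigma -> cX a + f a = a + distinct v a i + f 0.

(* The situation during step [i.+1] after [r] deletions at [t = i.+1 - sigma]. *)
Definition layer_mid i r alive F := exists2 cX, deletions M (i.+1 - sigma) alive F cX &
  (forall a, a < i.+1 - sigma -> cX a + f a = a + distinct v a i + f 0) /\
  cX (i.+1 - sigma) = cX (i - sigma) + r.

(** The growth of [cX] from [t.-1] to [t] that the equation of [layer_inv] at [i.+1] demands: the
    drop of [f], plus one for [a] itself, minus one if dropping the [t]-th letter loses a distinct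
    letter, that is, if this letter does not recur up to [i.+1]. *)
Definition layer_reps i :=
  let t := i.+1 - sigma in
  (t < last_pos v i.+1 (nth 0 v t.-1)) + (f t.-1 - f t).

Definition layer_del alive alive' F F' x := exists2 r, is_pred_alive alive x r &
  (forall s, 0 < s < M -> alive' s = alive s && (s != r)) /\ F' = F + (r == 0).

Lemma layer_inv0 alive : 1 < M -> (forall s, 0 < s < M -> alive s) -> layer_inv 0 alive 0.
Proof.
move=> M1 h; exists (fun _ => 0); last by move=> a; rewrite leqn0 => /eqP->; rewrite distinct_id.
rewrite sub0n; split=> //.
move=> s hs _; rewrite add0n; have : s.-1 < M by lia.
elim: s.-1 => //= a IH aM; rewrite -IH ?h //; lia.
Qed.

Lemma layer_mid0 i alive F : sigma < i.+1 -> i < size v ->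
  layer_inv i alive F -> layer_mid i 0 alive F.
Proof.
move=> si iv [cX D h]; have e : i.+1 - sigma = (i - sigma).+1 by lia.
exists cX; first by rewrite e; apply: deletions_weaken => //; lia.
split=> [a ha|]; first by apply: h; lia.
by rewrite addn0 e (deletions_const D).
Qed.

Lemma layer_mid_step i r alive alive' F F' : sigma < i.+1 ->
  layer_mid i r alive F -> layer_del alive alive' F F' (i.+1 - sigma) ->
  layer_mid i r.+1 alive' F'.
Proof.
move=> si [cX D [h1 h2]] [p hp [h' ->]].
exists (fun a => cX a + (i.+1 - sigma <= a)).
  by apply: (deletions_step D _ hp h').
split=> [a ha|]; first by rewrite leqNgt ha addn0 h1.
rewrite h2 leqnn; lia.
Qed.

(** For [0 < t <= x] the new letter can affect only the term at [t], and [layer_reps] has accounted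
    for it there, using last positions at [i.+1]. The 1 in [maxn 1 t] handles [t = 0]: the only term
    is then at [a = 0], and it drops exactly if [x = 0]. *)
Lemma layer_last_step i alive F (hi : i < size v) :
  let x := last_pos v i (nth 0 v i) in let t := i.+1 - sigma in
  (if sigma < i.+1 then layer_mid i (layer_reps i) alive F else layer_inv i alive F) ->
  (x < maxn 1 t -> forall alive' F', layer_del alive alive' F F' x -> layer_inv i.+1 alive' F') /\
  (maxn 1 t <= x -> layer_inv i.+1 alive F).
Proof.
move=> x t; case: ifP => si.
  have t0 : 0 < t by rewrite subn_gt0.
  have -> : maxn 1 t = t by apply/maxn_idPr.
  case=> cX D [h1]; rewrite -/t => h2.
  have key : forall a, a <= t -> cX a + (x < t) * (x <= a) + f a = a + distinct v a i.+1 + f 0.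
    move=> a; rewrite leq_eqVlt => /orP[/eqP->|ha]; last first.
      rewrite distinct_succ //; last by lia.
      by rewrite -/x addnAC h1 //; case: (leqP x a) => xa; case: (ltnP x t) => xt /=; lia.
    have := h1 t.-1; rewrite -/t => /(_ _) H; have {H} := H ltac:(lia).
    have e : i - sigma = t.-1 by lia.
    rewrite h2 e /layer_reps -/t.
    have t1 : t.-1.+1 = t by lia.
    have := @fdec t.-1; rewrite t1 => /(_ _) H; have {H} := H ltac:(lia).
    have d1 : distinct v t.-1 i.+1 = distinct v t i.+1 + (last_pos v i.+1 (nth 0 v t.-1) <= t).
      by rewrite distinct_drop ?t1 //; lia.
    have d2 := @distinct_succ v t.-1 i ltac:(lia) hi.
    move: d1; rewrite d2 -/x; case: (ltnP t (last_pos v i.+1 (nth 0 v t.-1))) => _;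
    case: (ltnP x t) => xt; case: (leqP x t.-1) => xt1; lia.
  split=> [xt alive' F' [p hp [h' ->]]|xt].
    exists (fun a => cX a + (x <= a)); first by apply: (deletions_step D _ hp h'); lia.
    by move=> a /key; rewrite xt mul1n.
  by exists cX => // a /key; rewrite ltnNge xt addn0.
have e : t = 0 by rewrite /t; lia.
have e' : i - sigma = 0 by lia.
case=> cX; rewrite e' => D h; rewrite e maxn0.
have h0 := h 0 isT; have d := @distinct_succ v 0 i isT hi.
split=> [xt alive' F' [p hp [h' ->]]|xt].
  exists (fun a => cX a + (x <= a)); rewrite -/t e; first by apply: (deletions_step D _ hp h'); lia.
  by move=> a; rewrite leqn0 => /eqP->; rewrite d -/x addnAC h0; lia.
exists cX; rewrite -/t e //; move=> a; rewrite leqn0 => /eqP->; rewrite d -/x h0; lia.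
Qed.

Lemma layer_inv_min i alive F : layer_inv i alive F -> i <= size v ->
  [/\ F <= f 0 + sigma,
    exists a, a <= i - sigma /\ f a + (sigma - distinct v a i) = f 0 + sigma - F
  & forall a, a <= i - sigma -> f 0 + sigma - F <= f a + (sigma - distinct v a i)].
Proof.
case=> cX D h iv; have [[a aA ea] lb] := deletions_max D.
have ha := h a aA; have dl b := distinct_le b i overv.
split; first by have := dl a; lia.
  by exists a; split=> //; have := dl a; lia.
move=> b bA; have hb := h b bA; have := lb b; have := dl b; lia.
Qed.

End Layer.

(** * A while language for the word RAM *)

Inductive cmd :=
  | Cst (x c : nat)                  (* x := c *)
  | Mov (x y : nat)                  (* x := y *)
  | Bin (o : binop) (x y z : nat)    (* x := y o z *)
  | Get (x a y : nat)                (* x := array_a[y] *)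
  | Put (a y z : nat)                (* array_a[y] := z *)
  | Sq (c1 c2 : cmd)
  | If (x y : nat) (c1 c2 : cmd)     (* if x < y then c1 else c2 *)
  | Wh (x y : nat) (c : cmd).        (* while x < y do c *)

Definition upd T (f : nat -> T) x v y := if eqn y x then v else f y.
Arguments upd T f !x v !y /.

Lemma updE T (f : nat -> T) x v y : upd f x v y = if y == x then v else f y.
Proof. by []. Qed.

Lemma upd_neq T (f : nat -> T) x v y : y != x -> upd f x v y = f y.
Proof. by rewrite updE => /negbTE->. Qed.

(** [tm] is a ghost clock counting machine steps. The arrays are separate at this level; [refines]
    packs them into one memory. *)
Record hst := Hst { hreg : nat -> nat; harr : nat -> nat -> nat; tm : nat }.

Definition tick d s := Hst (hreg s) (harr s) (d + tm s).
Definition set_hreg s x v := Hst (upd (hreg s) x v) (harr s) (tm s).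
Definition set_harr s a i v := Hst (hreg s) (upd (harr s) a (upd (harr s a) i v)) (tm s).

Definition binop_val o x y :=
  match o with
  | BAdd => x + y | BSub => x - y | BMul => x * y
  | BDiv => x %/ y | BMod => x %% y | BShl => x * 2 ^ y | _ => 0
  end.

(* Excludes overflow, so that results need not be reduced modulo [W = 2 ^ b]; bitwise
   operations are not needed. *)
Definition binop_ok W o x y :=
  match o with
  | BAdd => x + y < W | BSub => (y <= x) && (x < W) | BMul => x * y < W
  | BDiv => x < W | BMod => x < W | BShl => x * 2 ^ y < W | _ => false
  end.

Lemma eval_binop_ok b o x y : binop_ok (2 ^ b) o x y -> eval_binop b o x y = binop_val o x y.
Proof.
rewrite /eval_binop; case: o => //= h; try by rewrite modn_small.
- case/andP: h => yx xW; have -> : x + 2 ^ b - y = x - y + 2 ^ b by lia.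
  by rewrite modnDr modn_small //; lia.
- by rewrite modn_small //; apply: leq_ltn_trans (leq_div _ _) h.
- by rewrite modn_small //; apply: leq_ltn_trans (leq_mod _ _) h.
Qed.

(** * Weakest preconditions with a step clock *)

Section WP.
(* [W] bounds the values of arithmetic operations, there are [NA] arrays of length [Q]. *)
Variables W Q NA : nat.

(* At most [m.-1] iterations; a test of the loop costs 2 steps in the machine code,
   either as a conditional jump and a jump back or as two forward jumps. *)
Fixpoint wp_loop (body : (hst -> Prop) -> hst -> Prop) x y m (P : hst -> Prop) s : Prop :=
  if m is m'.+1 then
    if hreg s x < hreg s y
    then body (fun s' => wp_loop body x y m' P (tick 1 s')) (tick 1 s)
    else P (tick 2 s)
  else False.

(* New values are named by a quantifier since substituting them in the states would
   make the size of [wp c P s] exponential in that of [c]. *)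
Fixpoint wp c (P : hst -> Prop) s : Prop :=
  match c with
  | Cst x v => v < W /\ P (tick 1 (set_hreg s x v))
  | Mov x y => forall u, u = hreg s y -> P (tick 1 (set_hreg s x u))
  | Bin o x y z => binop_ok W o (hreg s y) (hreg s z) /\
      forall u, u = binop_val o (hreg s y) (hreg s z) -> P (tick 1 (set_hreg s x u))
  | Get x a y => (a < NA) && (hreg s y < Q) /\
      forall u, u = harr s a (hreg s y) -> P (tick 4 (set_hreg s x u))
  | Put a y z => (a < NA) && (hreg s y < Q) /\
      forall i u, i = hreg s y -> u = hreg s z -> P (tick 4 (set_harr s a i u))
  | Sq c1 c2 => wp c1 (wp c2 P) s
  | If x y c1 c2 => if hreg s x < hreg s y then wp c1 P (tick 1 s)
      else wp c2 (fun s' => P (tick 1 s')) (tick 1 s)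
  | Wh x y c1 => exists m, wp_loop (wp c1) x y m P s
  end.

Lemma wp_mono c P P' s : (forall s', P s' -> P' s') -> wp c P s -> wp c P' s.
Proof.
elim: c P P' s => [x v|x y|o x y z|x a y|a y z|c1 IH1 c2 IH2|x y c1 IH1 c2 IH2|x y c1 IH] P P' s h /=.
- by case=> H /h.
- by move=> H u /H/h.
- by case=> ok H; split=> // u /H/h.
- by case=> ok H; split=> // u /H/h.
- by case=> ok H; split=> // i u e /(H _ _ e)/h.
- by apply: IH1 => s'; apply: IH2.
- by case: ifP => _; [apply: IH1 | apply: IH2 => s' /h].
- case=> m H; exists m; elim: m s H => //= m IHm s; case: ifP => _; last exact: h.
  by apply: IH => s'; apply: IHm.
Qed.

Fixpoint modr c v :=
  match c with
  | Cst x _ | Mov x _ | Bin _ x _ _ | Get x _ _ => eqn v x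
  | Put _ _ _ => false
  | Sq c1 c2 | If _ _ c1 c2 => modr c1 v || modr c2 v
  | Wh _ _ c1 => modr c1 v
  end.

Fixpoint moda c a :=
  match c with
  | Put a' _ _ => eqn a a'
  | Sq c1 c2 | If _ _ c1 c2 => moda c1 a || moda c2 a
  | Wh _ _ c1 => moda c1 a
  | _ => false
  end.

Definition frame c s s' :=
  (forall v, modr c v = false -> hreg s' v = hreg s v) /\
  (forall a, moda c a = false -> harr s' a = harr s a).

(** [modr] and [moda] are computed from the syntax, so that for a concrete program the preservation
    of a register or an array is checked by evaluation. *)
Lemma wp_frame c P s : wp c P s -> wp c (fun s' => P s' /\ frame c s s') s.
Proof.
have base (r r0 : nat -> nat) (m m0 : nat -> nat -> nat) (C C' : nat -> bool) :
    (forall v, C v = false -> r v = r0 v) -> (forall v, C' v = false -> m v = m0 v) ->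
    (forall v, C v = false -> r v = r0 v) /\ (forall v, C' v = false -> m v = m0 v) by [].
elim: c P s => [x v|x y|o x y z|x a y|a y z|c1 IH1 c2 IH2|x y c1 IH1 c2 IH2|x y c1 IH] P s /=.
- by case=> h hp; do ![split=> //] => v' /= e; rewrite /upd e.
- by move=> hp u /hp{}hp; do ![split=> //] => v' /= e; rewrite /upd e.
- by case=> h hp; split=> // u /hp{}hp; do ![split=> //] => v' /= e; rewrite /upd e.
- by case=> h hp; split=> // u /hp{}hp; do ![split=> //] => v' /= e; rewrite /upd e.
- case=> h hp; split=> // i u ei /(hp _ _ ei){}hp.
  by do ![split=> //] => v' /= e; rewrite /upd e.
- move=> /IH1; apply: wp_mono => s1 [/IH2 h2 [f1 g1]]; move: h2; apply: wp_mono => s2 [hp [f2 g2]].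
  by do ![split=> //] => v' /= /norP[]/negbTE e1 /negbTE e2; rewrite ?f2 ?f1 ?g2 ?g1.
- case: ifP => _.
    move=> /IH1; apply: wp_mono => s1 [hp [f1 g1]].
    by do ![split=> //] => v' /= /norP[]/negbTE e1 /negbTE e2; rewrite ?f1 ?g1.
  move=> /IH2; apply: wp_mono => s1 [hp [f1 g1]].
  by do ![split=> //] => v' /= /norP[]/negbTE e1 /negbTE e2; rewrite ?f1 ?g1.
- case=> m H; exists m; suff: forall s0, frame c1 s s0 -> wp_loop (wp c1) x y m P s0 ->
     wp_loop (wp c1) x y m (fun s' => P s' /\ frame (Wh x y c1) s s') s0 by apply.
  move=> {H}; elim: m => //= m IHm s0 fs0; case: ifP => _ //.
  move=> /IH; apply: wp_mono => s1 [h [f1 g1]]; apply: IHm h; case: fs0 => f0 g0.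
  by split=> v' e; rewrite /= ?f1 ?g1 //= ?f0 ?g0.
Qed.

Lemma wp_while x y c (I : nat -> hst -> Prop) m (P : hst -> Prop) s : I m s ->
  (forall j s', I j s' -> if hreg s' x < hreg s' y
     then exists2 j', j = j'.+1 & wp c (fun s2 => I j' (tick 1 s2)) (tick 1 s')
     else P (tick 2 s')) ->
  wp (Wh x y c) P s.
Proof.
move=> h0 hI; exists m.+1; elim: m s h0 => [|m IH] s /hI h.
  by rewrite /=; move: h; case: ifP => _ // [].
move: h; rewrite [X in _ -> X]/=; case: ifP => _ //; case=> j' [<-].
by apply: wp_mono => s'; apply: IH.
Qed.

Lemma wp_for_aux x y c (I : nat -> hst -> Prop) lo hi (P : hst -> Prop) s :
  lo <= hi -> hreg s x = lo -> hreg s y = hi -> I lo s ->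
  (forall j s', lo <= j < hi -> hreg s' x = j -> hreg s' y = hi -> I j s' ->
     wp c (fun s2 => [/\ hreg s2 x = j.+1, hreg s2 y = hi & I j.+1 (tick 1 s2)]) (tick 1 s')) ->
  (forall s', hreg s' x = hi -> hreg s' y = hi -> I hi s' -> P (tick 2 s')) ->
  wp (Wh x y c) P s.
Proof.
move=> lh ex ey h0 hstep hend.
pose J m s' := [/\ lo <= hi - m, m <= hi, hreg s' x = hi - m, hreg s' y = hi & I (hi - m) s'].
apply: (@wp_while x y c J (hi - lo)); first by rewrite /J !(subKn lh) leqnn leq_subr.
move=> m s' [lm mh ex' ey' hI]; rewrite ex' ey'; case: ifP => hm.
  case: m lm mh ex' hI hm => [|m] lm mh ex' hI hm; first by lia.
  exists m => //; have hlt : lo <= hi - m.+1 < hi by lia.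
  have := hstep _ s' hlt ex' ey' hI; apply: wp_mono => s2 [e1 e2 h2].
  have e : (hi - m.+1).+1 = hi - m by lia.
  by rewrite e in e1 h2; split=> //; lia.
have m0 : m = 0 by lia.
by rewrite m0 subn0 in ex' hI; apply: hend.
Qed.

Lemma frame_trans c s1 s2 s3 : frame c s1 s2 -> frame c s2 s3 -> frame c s1 s3.
Proof. by move=> [a1 b1] [a2 b2]; split=> v e; rewrite ?a2 ?a1 ?b2 ?b1. Qed.

(** The frame relative to the initial state is carried through the iterations, so that an invariant
    need only mention what the loop changes. *)
Lemma wp_for x y c (I : nat -> hst -> Prop) lo hi (P : hst -> Prop) s :
  lo <= hi -> hreg s x = lo -> hreg s y = hi -> modr c y = false -> I lo s ->
  (forall j s', frame c s s' -> lo <= j < hi -> hreg s' x = j -> hreg s' y = hi -> I j s' ->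
     wp c (fun s2 => hreg s2 x = j.+1 /\ I j.+1 (tick 1 s2)) (tick 1 s')) ->
  (forall s', frame c s s' -> hreg s' x = hi -> hreg s' y = hi -> I hi s' -> P (tick 2 s')) ->
  wp (Wh x y c) P s.
Proof.
move=> lh ex ey my h0 hstep hend.
apply: (@wp_for_aux _ _ _ (fun j s' => I j s' /\ frame c s s') lo hi) => //.
  move=> j s' hj e1 e2 [h3 h4]; have := hstep _ _ h4 hj e1 e2 h3.
  move/wp_frame; apply: wp_mono => s2 [[e3 h5] f5]; split=> //.
    by case: f5 => -> // _; exact: e2.
  by split=> //; apply: frame_trans h4 _; case: f5 => a b; split.
by move=> s' e1 e2 [h3 h4]; apply: hend.
Qed.

End WP.

(** * Compilation to the word RAM and its correctness *)

Fixpoint clen c :=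
  match c with
  | Get _ _ _ | Put _ _ _ => 4
  | Sq c1 c2 => clen c1 + clen c2
  | If _ _ c1 c2 => clen c1 + clen c2 + 2
  | Wh _ _ c1 => clen c1 + 3
  | _ => 1
  end.

(* Machine register 0 is scratch, register 1 holds the array length [Q], and
   register [x.+2] holds variable [x]; entry [i] of array [a] is in cell [a * Q + i]. *)
Fixpoint comp c p : seq instr :=
  match c with
  | Cst x v => [:: Const x.+2 v]
  | Mov x y => [:: Move x.+2 y.+2]
  | Bin o x y z => [:: Op o x.+2 y.+2 z.+2]
  | Get x a y => [:: Const 0 a; Op BMul 0 0 1; Op BAdd 0 0 y.+2; Read x.+2 0]
  | Put a y z => [:: Const 0 a; Op BMul 0 0 1; Op BAdd 0 0 y.+2; Write 0 z.+2]
  | Sq c1 c2 => comp c1 p ++ comp c2 (p + clen c1)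
  | If x y c1 c2 => JumpLt x.+2 y.+2 (p + clen c2 + 2) ::
      comp c2 (p + 1) ++ Jump (p + clen c2 + clen c1 + 2) :: comp c1 (p + clen c2 + 2)
  | Wh x y c1 => [:: JumpLt x.+2 y.+2 (p + 2), Jump (p + clen c1 + 3)
      & comp c1 (p + 2) ++ [:: Jump p]]
  end.

Lemma size_comp c p : size (comp c p) = clen c.
Proof.
elim: c p => //= [c1 IH1 c2 IH2|x y c1 IH1 c2 IH2|x y c1 IH] p.
- by rewrite size_cat IH1 IH2.
- by rewrite size_cat /= IH1 IH2; lia.
- by rewrite size_cat /= IH; lia.
Qed.

Definition code_at (P : program) p l := forall i, i < size l -> nth Halt P (p + i) = nth Halt l i.

Lemma code_at_cat P p l1 l2 : code_at P p (l1 ++ l2) ->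
  code_at P p l1 /\ code_at P (p + size l1) l2.
Proof.
move=> h; split=> i hi.
  by rewrite h ?nth_cat ?hi // size_cat; lia.
rewrite -addnA h ?nth_cat ?size_cat ?ltn_add2l //.
by rewrite ltnNge leq_addr /= addKn.
Qed.

Lemma code_at_cons P p i l : code_at P p (i :: l) ->
  nth Halt P p = i /\ code_at P p.+1 l.
Proof.
move=> h; split; first by have := h 0 isT; rewrite addn0.
by move=> j hj; have := h j.+1 hj; rewrite addnS.
Qed.

Section Simulation.
Variables (b Q NA : nat) (P : program).
Hypothesis Q_gt0 : 0 < Q.
Hypothesis NAQ : NA * Q <= 2 ^ b.

Definition refines (r : state) (s : hst) :=
  [/\ forall x, reg r x.+2 = hreg s x, reg r 1 = Q
    & forall a i, a < NA -> i < Q -> Defs.mem r (a * Q + i) = harr s a i].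

Lemma refines_tick r s d : refines r s -> refines r (tick d s).
Proof. by case. Qed.

Lemma refines_reg pc' r s x v : refines r s ->
  refines (State pc' [eta reg r with x.+2 |-> v] (Defs.mem r)) (set_hreg s x v).
Proof.
case=> h1 h2 h3; split=> //= y; rewrite /upd h1.
by rewrite eqSS eqSS.
Qed.

Lemma addr_inj a i a' i' : i < Q -> i' < Q -> (a * Q + i == a' * Q + i') = (a == a') && (i == i').
Proof.
move=> iQ iQ'; apply/eqP/andP => [e|[/eqP-> /eqP->]] //.
have e1 := congr1 (fun x => x %/ Q) e; have e2 := congr1 (fun x => x %% Q) e.
rewrite /= !divnMDl // !divn_small // !addn0 in e1.
by rewrite /= !modnMDl !modn_small // in e2; rewrite e1 e2.
Qed.

Lemma addr_steps p a y l r s : code_at P p [:: Const 0 a, Op BMul 0 0 1, Op BAdd 0 0 y.+2 & l] ->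
  (a < NA) && (hreg s y < Q) -> refines r s -> pc r = p ->
  exists r', [/\ iter 3 (step b P) r = r', refines r' s, pc r' = p.+3,
    reg r' 0 = a * Q + hreg s y & Defs.mem r' = Defs.mem r].
Proof.
case/code_at_cons=> h1 /code_at_cons[h2 /code_at_cons[h3 _]] /andP[aN yQ] [R1 R2 R3] pr.
have aQ : a * Q + hreg s y < 2 ^ b.
  by apply: leq_trans NAQ; apply: leq_trans (_ : a.+1 * Q <= _); rewrite ?leq_mul2r ?aN ?orbT // mulSn; lia.
have aW : a < 2 ^ b by apply: leq_ltn_trans aQ; apply: leq_trans (leq_addr _ _); rewrite leq_pmulr.
have aQW : a * Q < 2 ^ b by apply: leq_ltn_trans aQ; apply: leq_addr.
pose r1 := set_reg r 0 a; pose r2 := set_reg r1 0 (a * Q).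
have st1 : step b P r = r1 by rewrite /step /fetch pr h1 modn_small.
have st2 : step b P r1 = r2.
  by rewrite /step /fetch /= pr h2 /= R2 eval_binop_ok.
have st3 : step b P r2 = set_reg r2 0 (a * Q + hreg s y).
  by rewrite /step /fetch /= pr h3 /= R1 eval_binop_ok.
by exists (iter 3 (step b P) r); split=> //=; rewrite st1 st2 st3 //= pr.
Qed.

Definition runs_to t r p s (s0 : hst) := exists r', [/\ iter t (step b P) r = r', pc r' = p,
  refines r' s & tm s = tm s0 + t].

Lemma runs_trans t1 t2 r p1 p2 s1 s2 s0 r1 :
  iter t1 (step b P) r = r1 -> pc r1 = p1 -> tm s1 = tm s0 + t1 -> runs_to t2 r1 p2 s2 s1 ->
  runs_to (t1 + t2) r p2 s2 s0.
Proof.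
move=> e1 _ e2 [r2 [e3 e4 h e5]]; exists r2; split=> //; last by rewrite e5 e2 addnA.
by rewrite addnC iterD e1.
Qed.

(** The clock agrees exactly with the number of machine steps, so time bounds proved with [wp] carry
    over without loss. *)
Lemma wp_sim c p Post s r : code_at P p (comp c p) -> wp (2 ^ b) Q NA c Post s ->
  refines r s -> pc r = p -> exists t s', runs_to t r (p + clen c) s' s /\ Post s'.
Proof.
elim: c p Post s r => [x v|x y|o x y z|x a y|a y z|c1 IH1 c2 IH2|x y c1 IH1 c2 IH2|x y c1 IH] p Post s r C.
- case=> h hP R pr; exists 1, (tick 1 (set_hreg s x v)); split=> //.
  exists (step b P r); have [c1 _] := code_at_cons C.
  split=> //; rewrite ?/step ?/fetch ?pr ?c1 /= ?pr ?addn1 //.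
  rewrite modn_small //; exact/refines_tick/refines_reg.
- move=> /(_ _ erefl) hP R pr; exists 1, (tick 1 (set_hreg s x (hreg s y))); split=> //.
  exists (step b P r); have [c1 _] := code_at_cons C; have [R1 _ _] := R.
  split=> //; rewrite ?/step ?/fetch ?pr ?c1 /= ?pr ?addn1 //.
  rewrite R1; exact/refines_tick/refines_reg.
- case=> h /(_ _ erefl) hP R pr; exists 1, (tick 1 (set_hreg s x (binop_val o (hreg s y) (hreg s z)))); split=> //.
  exists (step b P r); have [c1 _] := code_at_cons C; have [R1 _ _] := R.
  split=> //; rewrite ?/step ?/fetch ?pr ?c1 /= ?pr ?addn1 //.
  rewrite !R1 eval_binop_ok //; exact/refines_tick/refines_reg.
- case=> h /(_ _ erefl) hP R pr; have [r1 [e1 R1 p1 a1 m1]] := addr_steps C h R pr.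
  exists 4, (tick 4 (set_hreg s x (harr s a (hreg s y)))); split=> //.
  have c4 : nth Halt P p.+3 = Read x.+2 0 by have := C 3 isT; rewrite addn3.
  exists (step b P r1); split=> //; first by rewrite -e1.
  + by rewrite /step /fetch p1 c4 /= ?p1; lia.
  + rewrite /step /fetch p1 c4 /= a1; have [_ _ R3] := R1.
    case/andP: h => aN yQ; rewrite R3 //; exact/refines_tick/refines_reg.
  + by rewrite /= addnC.
- case=> h /(_ _ _ erefl erefl) hP R pr; have [r1 [e1 R1 p1 a1 m1]] := addr_steps C h R pr.
  exists 4, (tick 4 (set_harr s a (hreg s y) (hreg s z))); split=> //.
  have c4 : nth Halt P p.+3 = Write 0 z.+2 by have := C 3 isT; rewrite addn3.
  exists (step b P r1); split=> //; first by rewrite -e1.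
  + by rewrite /step /fetch p1 c4 /= ?p1; lia.
  + rewrite /step /fetch p1 c4 /=; have [R2 R3 R4] := R1.
    case/andP: h => aN yQ; split=> //= a' i aN' iQ.
    rewrite a1 R2 R4 // addr_inj // !updE.
    by case: (a' =P a) => [->|_] //=; rewrite updE.
  + by rewrite /= addnC.
- move=> /= H R pr; have [C1 C2] := code_at_cat C.
  rewrite size_comp in C2.
  have [t1 [s1 [[r1 [e1 p1 R1 tm1]] H1]]] := IH1 _ _ _ _ C1 H R pr.
  have [t2 [s2 [X H2]]] := IH2 _ _ _ _ C2 H1 R1 p1.
  exists (t1 + t2), s2; split=> //; rewrite addnA.
  exact: runs_trans e1 p1 tm1 X.
- move=> /= H R pr; have [j1 C1] := code_at_cons C; have [C2 C3] := code_at_cat C1.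
  have [j2 C4] := code_at_cons C3; rewrite size_comp in j2 C4.
  have [R1 _ _] := R.
  have st : step b P r = goto r (if hreg s x < hreg s y then p + clen c2 + 2 else p.+1).
    by rewrite /step /fetch pr j1 !R1.
  (* The code of the first branch comes last and is left without a jump, at a cost of one step; the
     other branch pays a second step to jump over it. *)
  move: H st; case: ifP => hxy H st.
    have e : p.+1 + clen c2 + 1 = p + clen c2 + 2 by lia.
    have C4' : code_at P (p + clen c2 + 2) (comp c1 (p + clen c2 + 2)).
      by move: C4; have -> : (p.+1 + clen c2).+1 = p + clen c2 + 2 by lia.
    have [||t1 [s1 [X H1]]] := IH1 _ _ _ (step b P r) C4' H.
      by rewrite st; case: R.
    by rewrite st.
    exists (1 + t1), s1; split=> //.
    have -> : p + (clen c1 + clen c2 + 2) = p + clen c2 + 2 + clen c1 by lia.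
    by apply: runs_trans X; rewrite ?st //= addnC.
  have C2' : code_at P (p + 1) (comp c2 (p + 1)) by move: C2; rewrite -addn1.
  have [||t1 [s1 [[r1 [e1 p1 R1' tm1]] H1]]] := IH2 _ _ _ (step b P r) C2' H.
    by rewrite st; case: R.
  by rewrite st /= addn1.
  exists (1 + t1 + 1), (tick 1 s1); split=> //.
  have p1' : pc r1 = p.+1 + clen c2 by rewrite p1 addn1.
  exists (step b P r1); split=> //.
  + by rewrite addn1 iterS addnC iterD /= e1.
  + by rewrite /step /fetch p1' j2 /=; lia.
  + by rewrite /step /fetch p1' j2 /=; case: R1'.
  + by rewrite /= tm1 /=; lia.
- move=> /= [m H] R pr; have [j1 C1] := code_at_cons C; have [j2 C2] := code_at_cons C1.
  have [C3 C4] := code_at_cat C2; have [j3 _] := code_at_cons C4; rewrite size_comp in j3.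
  have C3' : code_at P (p + 2) (comp c1 (p + 2)) by move: C3; rewrite addn2.
  elim: m s r R pr H => // m IHm s r R pr /=.
  have [R1 _ _] := R.
  have st : step b P r = goto r (if hreg s x < hreg s y then p + 2 else p.+1).
    by rewrite /step /fetch pr j1 !R1.
  move: st; case: ifP => hxy st H; last first.
    exists 2, (tick 2 s); split=> //; exists (step b P (step b P r)); split=> //.
    + by rewrite st /step /fetch /= j2 /=; lia.
    + by rewrite st /step /fetch /= j2 /=; case: R.
    + by rewrite /= addnC.
  have [||t1 [s1 [[r1 [e1 p1 R1' tm1]] H1]]] := IH _ _ _ (step b P r) C3' H.
    by rewrite st; case: R.
  by rewrite st.
  have p1' : pc r1 = p.+2 + clen c1 by rewrite p1 addn2.
  have st1 : step b P r1 = goto r1 p by rewrite /step /fetch p1' j3.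
  have [||t2 [s2 [X H2]]] := IHm _ (step b P r1) _ _ H1.
    by rewrite st1; case: R1'.
  by rewrite st1.
  exists ((1 + t1 + 1) + t2), s2; split=> //.
  apply: runs_trans X; [|by []|].
  + by rewrite addn1 iterS addnC iterD /= e1.
  + by rewrite /= tm1 /=; lia.
Qed.

End Simulation.

(* Registers 0 and 1 are moved to variables 0 and 1, then [Q := (n + 1) ^ 2] is computed. *)
Definition ram_program c x : program :=
  [:: Move 2 0; Move 3 1; Const 0 1; Op BAdd 0 0 2; Op BMul 1 0 0]
    ++ comp c 5 ++ [:: Move 0 x.+2; Halt].

(** Array 0 occupies the first cells of the memory and is therefore the input; the zeros elsewhere
    are the initial contents of the other arrays. *)
Definition input_hst w k := Hst (nth 0 [:: size w; k])
  (fun a i => if a is 0 then nth 0 w i else 0) 0.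

Lemma ram_program_outputs b NA c x w k (R : nat -> Prop) T :
  let Q := (size w).+1 * (size w).+1 in
  0 < NA -> NA * Q < 2 ^ b ->
  wp (2 ^ b) Q NA c (fun s => R (hreg s x) /\ tm s <= T) (input_hst w k) ->
  exists2 r, R r & outputs_within (ram_program c x) b (input_state w k) r (T + 6).
Proof.
move=> Q NA0 NAQ H; set P := ram_program c x.
have QW : Q < 2 ^ b by apply: leq_ltn_trans NAQ; rewrite leq_pmull.
have n0 : (size w).+1 <= Q by rewrite leq_pmulr.
pose n := size w; pose r1 := set_reg (input_state w k) 2 n; pose r2 := set_reg r1 3 k.
pose r3 := set_reg r2 0 1; pose r4 := set_reg r3 0 n.+1; pose r5 := set_reg r4 1 Q.
have st1 : step b P (input_state w k) = r1 by [].
have st2 : step b P r1 = r2 by [].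
have st3 : step b P r2 = r3 by rewrite /step /= modn_small //; lia.
have st4 : step b P r3 = r4 by rewrite /step /= eval_binop_ok //= add1n; lia.
have st5 : step b P r4 = r5 by rewrite /step /= eval_binop_ok.
have e5 : iter 5 (step b P) (input_state w k) = r5.
  by rewrite !iterS st1 st2 st3 st4 st5.
have Q0 : 0 < Q by lia.
have R0 : refines Q NA r5 (input_hst w k).
  split=> //= [y|a i aN iQ]; first by case: y => [|[|y]] //=; rewrite !nth_nil.
  case: a aN => [|a] aN; first by rewrite mul0n.
  by rewrite nth_default // mulSn; lia.
have C0 : code_at P 5 (comp c 5 ++ [:: Move 0 x.+2; Halt]).
  by move=> i hi; rewrite /P /ram_program.
have [C1 C2] := code_at_cat C0; rewrite size_comp in C2.
have [j1 C3] := code_at_cons C2; have [j2 _] := code_at_cons C3.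
have NAQ' : NA * Q <= 2 ^ b by apply: ltnW.
have pr : pc r5 = 5 by [].
have [t [s [[r [e1 e2 [R1 _ _] e3]] [h1 h2]]]] := wp_sim Q0 NAQ' C1 H R0 pr.
exists (hreg s x) => //.
(* Five instructions of the prologue and the final move; being at [Halt] takes no step. *)
exists (t + 6); first by move: e3 h2 => /= ->; lia.
have -> : iter (t + 6) (step b P) (input_state w k) = step b P r.
  by rewrite addnS iterS iterD e5 e1.
rewrite /halted /step {1}/fetch /= /fetch e2 j1 /= e2; split=> //.
Qed.

(** * Blocks of bits with interval union-find *)

Definition bit x i := odd (x %/ 2 ^ i).

Lemma bit0n i : bit 0 i = false.
Proof. by rewrite /bit div0n. Qed.

Lemma bit_small x i : x < 2 ^ i -> bit x i = false.
Proof. by move=> h; rewrite /bit divn_small. Qed.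

Lemma bit_MDl a c d i : i <= d -> bit (a * 2 ^ d + c) i = ((i == d) && odd a) (+) bit c i.
Proof.
move=> id; have [k ->] : exists k, d = k + i by exists (d - i); rewrite subnK.
rewrite /bit expnD mulnA divnMDl ?expn_gt0 // oddD oddM oddX orbF andbC.
by congr (_ && _ (+) _); lia.
Qed.

Lemma bit_mod x r i : bit (x %% 2 ^ r) i = (i < r) && bit x i.
Proof.
case: ltnP => ir /=; last first.
  by rewrite bit_small // (leq_trans (ltn_pmod _ _)) ?expn_gt0 // leq_exp2l.
rewrite {2}(divn_eq x (2 ^ r)) bit_MDl; last exact: ltnW.
by rewrite ltn_eqF.
Qed.

Lemma bit_trunc_log x : 0 < x -> bit x (trunc_log 2 x).
Proof.
move=> x0; have /andP[h1 h2] := trunc_log_bounds (ltnSn 1) x0.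
rewrite /bit; suff -> : x %/ 2 ^ trunc_log 2 x = 1 by [].
apply/eqP; rewrite eqn_leq -ltnS ltn_divLR ?expn_gt0 // -expnS h2 /=.
by rewrite divn_gt0 ?expn_gt0.
Qed.

Lemma bit_gt_trunc_log x i : trunc_log 2 x < i -> bit x i = false.
Proof.
move=> h; apply: bit_small; apply: leq_trans (trunc_log_ltn x (ltnSn 1)) _.
by rewrite leq_exp2l.
Qed.

Lemma bit_leq x i : bit x i -> 2 ^ i <= x.
Proof. by move=> h; rewrite leqNgt; apply/negP => /bit_small; rewrite h. Qed.

(** No borrow occurs: the quotient [a] of [x] by [2 ^ i] is odd, so [a] and [a.-1] differ in their
    lowest bit only. *)
Lemma bit_sub x i j : bit x i -> bit (x - 2 ^ i) j = bit x j && (j != i).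
Proof.
move=> h; set a := x %/ 2 ^ i; set c := x %% 2 ^ i.
have ax : x = a * 2 ^ i + c by apply: divn_eq.
have ci : c < 2 ^ i by rewrite ltn_mod expn_gt0.
have oa : odd a by [].
have a1 : a = a.-1 + 1 by case: (a) oa => //= a' _; rewrite addn1.
have e : x - 2 ^ i = a.-1 * 2 ^ i + c by rewrite {1}ax {1}a1 mulnDl mul1n; lia.
have oa1 : odd a.-1 = false by move: oa; rewrite {1}a1 oddD addbT => /negbTE.
have [ji|ij] := leqP j i.
  rewrite e bit_MDl // {1}ax bit_MDl // oa oa1 andbF andbT.
  case: eqP => [->|_] /=; last by rewrite andbT.
  by rewrite andbF bit_small.
rewrite (gtn_eqF ij) andbT /bit -(subnKC (ltnW ij)) expnD !divnMA.
have -> : (x - 2 ^ i) %/ 2 ^ i = a.-1 by rewrite e divnMDl ?expn_gt0 // divn_small // addn0.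
rewrite -/a; have [d ->] : exists d, j - i = d.+1 by exists (j - i).-1; lia.
rewrite expnS !divnMA; congr (odd (_ %/ _)); rewrite [in RHS]a1.
by rewrite !divn2 halfD oa1 /= addn0.
Qed.

(* Element [q * B + r] is alive iff bit [r] of [mask q] is set. The blocks are grouped into
   intervals with a common label; [st] and [en] are indexed by labels. *)
Record blocks (m B : nat) (mask lab st en : nat -> nat) : Prop := {
  blocks_size : 0 < m /\ 0 < B;
  blocks_lab : forall q, q < m -> lab q < m;
  blocks_itv : forall q, q < m -> [/\ st (lab q) <= q, q <= en (lab q), en (lab q) < m
    & forall q', st (lab q) <= q' <= en (lab q) -> lab q' = lab q];
  blocks_bound : forall q, q < m -> mask q < 2 ^ B;
  (* Exactly the first block of each interval is nonempty. *)
  blocks_mask : forall q, q < m -> (0 < mask q) = (st (lab q) == q);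
  blocks_zero : odd (mask 0) }.

Definition alive_bit B (mask : nat -> nat) s := bit (mask (s %/ B)) (s %% B).

(** Each block is charged the logarithm of the length of its interval. For a relabelled block this
    length at least doubles, so the increase of the potential pays for the relabelling. *)
Definition potential m (lab st en : nat -> nat) :=
  \sum_(q < m) trunc_log 2 ((en (lab q)).+1 - st (lab q)).

Lemma potential_max m lab st en : (forall q, q < m -> en (lab q) < m) ->
  potential m lab st en <= m * trunc_log 2 m.
Proof.
move=> h; apply: leq_trans (_ : \sum_(q < m) trunc_log 2 m <= _).
  by apply: leq_sum => q _; apply: leq_trunc_log; have := h q (ltn_ord q); lia.
by rewrite sum_nat_const card_ord.
Qed.

Section Blocks.
Variables (m B : nat) (mask lab st en : nat -> nat).
Hypothesis BS : blocks m B mask lab st en.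
Notation alive := (alive_bit B mask).

Let B_gt0 : 0 < B. Proof. by case: BS => -[]. Qed.

Lemma block_lt y : y < m * B -> y %/ B < m.
Proof. by move=> h; rewrite ltn_divLR. Qed.

(* The block of the last living element up to [y], with the mask of its elements up to [y]. *)
Definition find_block y := let q := y %/ B in
  if 0 < mask q %% 2 ^ (y %% B).+1 then (q, mask q %% 2 ^ (y %% B).+1)
  else (st (lab q.-1), mask (st (lab q.-1))).

(** Element 0 is a sentinel that is never deleted, so a search in block 0 always succeeds and a
    preceding block exists whenever it is needed. *)
Lemma find_block_gt0 y : y < m * B -> mask (y %/ B) %% 2 ^ (y %% B).+1 = 0 -> 0 < y %/ B.
Proof.
move=> ym h; rewrite lt0n; apply/eqP => q0; move: h; rewrite q0 => h.
have := bit_mod (mask 0) (y %% B).+1 0; rewrite h bit0n /bit expn0 divn1 /=.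
by rewrite (blocks_zero BS).
Qed.

(** Reduction modulo a power of 2 cuts off the elements behind [y], and the logarithm gives the last
    remaining one. If none remains, the search moves to the first block of the interval containing
    the preceding block: the other blocks of that interval are empty. *)
Lemma find_blockP y : y < m * B -> let: (q, mk) := find_block y in
  [/\ q <= y %/ B, st (lab q) = q, (0 < mk < 2 ^ B) && (trunc_log 2 mk < B), bit (mask q) (trunc_log 2 mk)
    & is_pred_alive alive y (q * B + trunc_log 2 mk)].
Proof.
move=> ym; rewrite /find_block; set q := y %/ B; set r := y %% B.
have qm : q < m := block_lt ym.
have rB : r < B by rewrite ltn_mod.
have ey : y = q * B + r by apply: divn_eq.
have split_s s : s = s %/ B * B + s %% B by apply: divn_eq.
have tlB x : 0 < x < 2 ^ B -> trunc_log 2 x < B.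
  case/andP=> x0 xB; have /andP[h1 _] := trunc_log_bounds (ltnSn 1) x0.
  by rewrite -(ltn_exp2l _ _ (ltnSn 1)); apply: leq_ltn_trans h1 xB.
case: posnP => [mk0|mk_gt0].
  have q0 : 0 < q := find_block_gt0 ym mk0.
  have q1 : q.-1 < m by lia.
  have [h1 h2 h3 h4] := blocks_itv BS q1.
  set q' := st (lab q.-1) in h1 h4 *.
  have lq' : lab q' = lab q.-1 by apply: h4; rewrite leqnn /=; lia.
  have q'm : q' < m by lia.
  have mk1 : 0 < mask q' by rewrite (blocks_mask BS q'm) lq' /q'.
  have mkB := blocks_bound BS q'm.
  have tB := tlB (mask q') ltac:(by rewrite mk1 mkB).
  have eq' : (q' * B + trunc_log 2 (mask q')) %/ B = q' by rewrite divnMDl // divn_small // addn0.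
  split=> //; first by lia.
  - by rewrite lq'.
  - by rewrite mk1 mkB tB.
  - exact: bit_trunc_log.
  split.
  - rewrite ey; have : q'.+1 * B <= q * B by rewrite leq_mul2r; lia.
    rewrite mulSn; lia.
  - by right; rewrite /alive_bit eq' modnMDl modn_small //; apply: bit_trunc_log.
  move=> s /andP[ls sy]; rewrite /alive_bit.
  have q's : q' <= s %/ B by rewrite -eq' leq_div2r // ltnW.
  have sq : s %/ B <= q by rewrite /q leq_div2r.
  have [e|ne] := eqVneq (s %/ B) q'.
    rewrite e bit_gt_trunc_log //; move: ls; rewrite {1}(split_s s) e; lia.
  have [e|ne2] := eqVneq (s %/ B) q.
    have := bit_mod (mask q) r.+1 (s %% B); rewrite mk0 bit0n e.
    have -> : s %% B < r.+1 by move: sy; rewrite {1}(split_s s) e {1}ey; lia.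
    by rewrite /= => <-.
  have sl : st (lab q.-1) <= s %/ B <= en (lab q.-1) by rewrite -/q'; lia.
  have sm : s %/ B < m by lia.
  have := blocks_mask BS sm; rewrite (h4 _ sl) -/q' eq_sym (negbTE ne).
  by case: (mask (s %/ B)) => // _; rewrite bit0n.
set mk := mask q %% 2 ^ r.+1 in mk_gt0 *.
have mkr : mk < 2 ^ r.+1 by rewrite ltn_mod expn_gt0.
have mq : 0 < mask q by apply: leq_trans (leq_mod _ _); exact: mk_gt0.
have /andP[h1 _] := trunc_log_bounds (ltnSn 1) mk_gt0.
have tr : trunc_log 2 mk < r.+1.
  by rewrite -(ltn_exp2l _ _ (ltnSn 1)); apply: leq_ltn_trans h1 mkr.
have tB : trunc_log 2 mk < B by lia.
have bt : bit (mask q) (trunc_log 2 mk).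
  by have := bit_trunc_log mk_gt0; rewrite {1}/mk bit_mod => /andP[].
have eq : (q * B + trunc_log 2 mk) %/ B = q by rewrite divnMDl // divn_small // addn0.
split=> //; first by apply/eqP; rewrite -(blocks_mask BS).
- by rewrite mk_gt0 tB andbT; apply: leq_ltn_trans (leq_mod _ _) (blocks_bound BS qm).
split; first by rewrite ey; lia.
  by right; rewrite /alive_bit eq modnMDl modn_small.
move=> s /andP[ls sy]; rewrite /alive_bit.
have e : s %/ B = q.
  apply/eqP; rewrite eqn_leq {1}/q leq_div2r //=.
  by rewrite -eq leq_div2r // ltnW.
have := bit_mod (mask q) r.+1 (s %% B); rewrite -/mk e.
have -> : s %% B < r.+1 by move: sy; rewrite {1}(split_s s) e {1}ey; lia.
rewrite /= => <-; rewrite bit_gt_trunc_log //.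
by move: ls; rewrite {1}(split_s s) e; lia.
Qed.

Lemma alive_bit_sub (mask' : nat -> nat) q i s : i < B -> bit (mask q) i ->
  (forall x, mask' x = if x == q then mask q - 2 ^ i else mask x) ->
  alive_bit B mask' s = alive s && (s != q * B + i).
Proof.
move=> iB bi h; rewrite /alive_bit h.
have -> : (s == q * B + i) = (s %/ B == q) && (s %% B == i).
  apply/eqP/andP => [->|[/eqP e1 /eqP e2]]; last by rewrite (divn_eq s B) e1 e2.
  by rewrite divnMDl // divn_small // addn0 modnMDl modn_small.
by case: eqP => [->|_] /=; rewrite ?andbT // bit_sub.
Qed.

(** The case without merging: block [q] stays nonempty and hence the first of its interval. The
    condition [(0 < q) || (0 < i)] protects the sentinel. *)
Lemma blocks_sub (mask' : nat -> nat) q i : q < m -> st (lab q) = q -> bit (mask q) i ->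
  (0 < q) || (0 < i) -> 0 < mask q - 2 ^ i ->
  (forall x, mask' x = if x == q then mask q - 2 ^ i else mask x) ->
  blocks m B mask' lab st en.
Proof.
move=> qm sq bi qi mk h; case: (BS) => h1 h2 h3 h4 h5 h6; split=> //.
- by move=> x xm; rewrite h; case: eqP => _; [have := h4 q qm; lia | apply: h4].
- by move=> x xm; rewrite h; case: eqP => [->|_]; [rewrite mk sq eqxx | apply: h5].
- rewrite h; case: eqP => // e; rewrite -e /= in qi.
  have := @bit_sub (mask q) i 0 bi; rewrite /bit expn0 !divn1 -e h6 /= => ->.
  by rewrite eq_sym; lia.
Qed.

End Blocks.

(** * Merging the interval of an emptied block with the preceding one *)

Section Merge.
Variables (m B : nat) (mask lab st en : nat -> nat) (q : nat).
Hypothesis BS : blocks m B mask lab st en.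
Hypothesis q_gt0 : 0 < q.
Hypothesis qm : q < m.
Hypothesis sq : st (lab q) = q.
Let l1 := lab q.
Let l2 := lab q.-1.
Let e1 := en l1.
Let s2 := st l2.

Lemma merge_facts : [/\ [/\ s2 < q, q <= e1, e1 < m & en l2 = q.-1], l1 != l2,
  forall x, q <= x <= e1 -> lab x = l1,
  forall x, s2 <= x < q -> lab x = l2 &
  forall x, x < m -> ~~ (s2 <= x <= e1) -> lab x != l1 /\ lab x != l2].
Proof.
have q1 : q.-1 < m by lia.
have [a1 a2 a3 a4] := blocks_itv BS qm; have [b1 b2 b3 b4] := blocks_itv BS q1.
have s2q : s2 < q by rewrite /s2 /l2; lia.
have ne : l1 != l2 by apply/eqP => e; move: s2q; rewrite /s2 -e /l1 sq ltnn.
have e2 : en l2 = q.-1.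
  apply/eqP; rewrite eqn_leq b2 andbT leqNgt; apply/negP => h.
  have := b4 q; rewrite -/l2 -/s2; have -> : s2 <= q <= en l2 by lia.
  by move=> /(_ isT) e; move: ne; rewrite /l1 e eqxx.
have i1 x : q <= x <= e1 -> lab x = l1 by move=> h; apply: a4; rewrite sq.
have i2 x : s2 <= x < q -> lab x = l2 by move=> h; apply: b4; rewrite -/l2 -/s2 e2; lia.
split=> // x xm nx; have [c1 c2 c3 c4] := blocks_itv BS xm; split.
  apply: contra nx => /eqP e; rewrite e /l1 sq -/l1 -/e1 in c1 c2; lia.
apply: contra nx => /eqP e; rewrite e -/s2 e2 in c1 c2.
by apply/andP; split=> //; rewrite /e1 /l1; lia.
Qed.

Variables (lab' st' en' mask' : nat -> nat) (L : nat).
Hypothesis hL : (L == l1) || (L == l2).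
Hypothesis hin : forall x, s2 <= x <= e1 -> lab' x = L.
Hypothesis hst : st' L = s2.
Hypothesis hen : en' L = e1.
Hypothesis hout : forall x, x < m -> ~~ (s2 <= x <= e1) -> lab' x = lab x.
Hypothesis hst' : forall l, l != l1 -> l != l2 -> st' l = st l.
Hypothesis hen' : forall l, l != l1 -> l != l2 -> en' l = en l.
Hypothesis hmask : forall x, mask' x = if x == q then 0 else mask x.

(** The surviving label [L] may be either of the two, which covers both directions of relabelling.
    The bounds stored for the other label are left arbitrary, as no block carries it any more. *)
Lemma blocks_merge : blocks m B mask' lab' st' en'.
Proof.
have [[s2q qe e1m e2] ne i1 i2 out] := merge_facts.
case: (BS) => h1 h2 h3 h4 h5 h6; split=> //.
- move=> x xm; case hx: (s2 <= x <= e1); last by rewrite hout ?hx // h2.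
  by rewrite hin //; case/orP: hL => /eqP->; apply: h2; lia.
- move=> x xm; case hx: (s2 <= x <= e1).
    rewrite hin // hst hen; split=> //; try by case/andP: hx.
  have nx := negbT hx; have [n1 n2] := out x xm nx; have [c1 c2 c3 c4] := h3 x xm.
  rewrite hout // hst' // hen' //; split=> // x' hx'.
  rewrite hout; [exact: c4 | by lia |].
  apply/negP => hx2; have e := c4 x' hx'.
  have [hq|hq] := leqP q x'.
    by move: n1; rewrite -e i1 ?eqxx //; lia.
  by move: n2; rewrite -e i2 ?eqxx //; lia.
- by move=> x xm; rewrite hmask; case: eqP => _; rewrite ?expn_gt0 // h4.
- move=> x xm; rewrite hmask; case hx: (s2 <= x <= e1).
    rewrite hin // hst; case: (x =P q) => [->|nxq]; first by rewrite ltn_eqF.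
    rewrite h5 //; have [hq|hq] := leqP q x.
      by rewrite i1; [rewrite /l1 sq; lia | lia].
    by rewrite i2; [rewrite -/s2 | lia].
  have nx := negbT hx; have [n1 n2] := out x xm nx.
  rewrite hout // hst' //; case: (x =P q) => [e|_]; last exact: h5.
  by move: nx; rewrite e; lia.
- by rewrite hmask; case: eqP q_gt0 => // <-.
Qed.

(** For [0 < a <= b] the logarithm of [a + b] exceeds that of [a] by at least one. So every block of
    the smaller interval gains one, and no other block loses. *)
Lemma potential_merge : potential m lab st en + minn (e1.+1 - q) (q - s2) <=
  potential m lab' st' en'.
Proof.
have [[s2q qe e1m e2] ne i1 i2 out] := merge_facts.
pose small (x : nat) := if e1.+1 - q <= q - s2 then q <= x < e1.+1 else s2 <= x < q.
have cnt a b : a <= b <= m -> \sum_(x < m) (a <= x < b) = b - a.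
  move=> /andP[ab bm]; rewrite (eq_bigr (fun x : 'I_m => if a <= x < b then 1 else 0)); last first.
    by move=> x _; case: (_ && _).
  rewrite -big_mkcond /= -(big_mkord (fun x => a <= x < b) (fun=> 1)).
  rewrite (@big_cat_nat _ _ _ b) //= (@big_cat_nat _ _ _ a) //=.
  rewrite big_nat_cond big1 => [|x]; last by lia.
  rewrite [X in _ + X]big_nat_cond [X in _ + X]big1 => [|x]; last by lia.
  rewrite big_nat_cond (eq_bigl (fun x => a <= x < b)) => [|x]; last by lia.
  by rewrite -big_nat sum_nat_const_nat muln1 addn0.
apply: leq_trans (_ : \sum_(x < m) (trunc_log 2 ((en (lab x)).+1 - st (lab x)) + small x) <= _).
  rewrite big_split leq_add2l /= /small; case: (leqP (e1.+1 - q) (q - s2)) => h /=; rewrite cnt; lia.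
apply: leq_sum => x _; have xm := ltn_ord x.
case hx: (s2 <= x <= e1); last first.
  have nx := negbT hx; have [n1 n2] := out x xm nx.
  rewrite hout // hst' // hen' //.
  have -> : small x = false by rewrite /small; case: ifP; lia.
  by rewrite addn0.
rewrite hin // hst hen; have tl2 a b : 0 < a -> a <= b -> trunc_log 2 a + 1 <= trunc_log 2 (a + b).
  move=> a0 ab; apply: leq_trans (_ : trunc_log 2 (2 * a) <= _); last by apply: leq_trunc_log; lia.
  by rewrite trunc_logMp // addn1.
have [hq|hq] := leqP q x.
  rewrite i1 /l1 ?sq -/l1 -/e1; last by lia.
  case hs: (small x); last by rewrite addn0; apply: leq_trunc_log; lia.
  have -> : e1.+1 - s2 = (e1.+1 - q) + (q - s2) by lia.
  by apply: tl2; move: hs; rewrite /small; case: ifP; lia.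
rewrite i2 -/s2 ?e2; last by lia.
case hs: (small x); last by rewrite addn0; apply: leq_trunc_log; lia.
have -> : e1.+1 - s2 = (q - s2) + (e1.+1 - q) by lia.
by rewrite prednK //; apply: tl2; move: hs; rewrite /small; case: ifP; lia.
Qed.

End Merge.

(** * Deletion in constant amortised time *)

Notation "c1 ;; c2" := (Sq c1 c2) (at level 61, right associativity).

Notation rn := 0 (only parsing).
Notation rk := 1 (only parsing).
Notation rone := 2 (only parsing).
Notation rsg := 3 (only parsing).
Notation rB := 4 (only parsing).
Notation rnp := 5 (only parsing).
Notation rzero := 6 (only parsing).
Notation rpB := 7 (only parsing).
Notation rfull := 8 (only parsing).
Notation rm := 9 (only parsing).
Notation rtwo := 10 (only parsing).
Notation ry := 20 (only parsing).
Notation rF := 21 (only parsing).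
Notation rq := 22 (only parsing).
Notation rr := 23 (only parsing).
Notation rpw := 24 (only parsing).
Notation rmk := 25 (only parsing).
Notation rl := 26 (only parsing).
Notation rbit := 27 (only parsing).
Notation rz := 28 (only parsing).
Notation rl1 := 29 (only parsing).
Notation rq1 := 30 (only parsing).
Notation rl2 := 31 (only parsing).
Notation re1 := 32 (only parsing).
Notation rs2 := 33 (only parsing).
Notation re1p := 34 (only parsing).
Notation rd1 := 35 (only parsing).
Notation rd2 := 36 (only parsing).
Notation rh := 37 (only parsing).

(* aW: input; aT: binary logarithms; aM, aLab, aSt, aEn: see [blocks]. The other arrays
   are two-dimensional, with row [j] for layer [j] starting at index [j * n.+1].
   aLast: last positions of the letters; aD, aH: universal and missing distances of the
   prefixes; aG: [missing_dist_last] of the letters; aCnt: histogram of row [j] of aG. *)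
Notation aW := 0 (only parsing).
Notation aT := 1 (only parsing).
Notation aM := 2 (only parsing).
Notation aLab := 3 (only parsing).
Notation aSt := 4 (only parsing).
Notation aEn := 5 (only parsing).
Notation aLast := 6 (only parsing).
Notation aD := 7 (only parsing).
Notation aH := 8 (only parsing).
Notation aG := 9 (only parsing).
Notation aCnt := 10 (only parsing).
Notation nArr := 11 (only parsing).

Definition relabel_cmd y l := Wh rh y (Put aLab rh l ;; Bin BAdd rh rh rone).

Definition merge_cmd :=
  Get rl1 aLab rq ;; Bin BSub rq1 rq rone ;; Get rl2 aLab rq1 ;;
  Get re1 aEn rl1 ;; Get rs2 aSt rl2 ;; Bin BAdd re1p re1 rone ;;
  Bin BSub rd1 re1p rq ;; Bin BSub rd2 rq rs2 ;;
  If rd2 rd1 (Put aSt rl1 rs2 ;; Mov rh rs2 ;; relabel_cmd rq rl1)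
             (Put aEn rl2 re1 ;; Mov rh rq ;; relabel_cmd re1p rl2).

(** [Mov rq rq] stands for an empty command. *)
Definition find_cmd :=
  Bin BDiv rq ry rB ;; Bin BMod rr ry rB ;; Bin BAdd rr rr rone ;;
  Bin BShl rpw rone rr ;; Get rmk aM rq ;; Bin BMod rmk rmk rpw ;;
  If rzero rmk (Mov rq rq)
    (Bin BSub rq rq rone ;; Get rl aLab rq ;; Get rq aSt rl ;; Get rmk aM rq).

Definition remove_cmd :=
  Bin BShl rpw rone rbit ;; Get rmk aM rq ;; Bin BSub rmk rmk rpw ;; Put aM rq rmk ;;
  If rmk rone merge_cmd (Mov rq rq).

(** The sum [rz] of block index and bit is 0 exactly if the search ended at the sentinel, that is,
    if the deletion fails. *)
Definition del_cmd :=
  find_cmd ;; Get rbit aT rmk ;; Bin BAdd rz rq rbit ;;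
  If rzero rz remove_cmd (Bin BAdd rF rF rone).

Section Del.
Variables W Q B m : nat.
Hypothesis QW : Q < W.
Hypothesis mQ : m <= Q.
Hypothesis BQ : 2 ^ B <= Q.
Hypothesis mBW : m * B + m < W.
Notation wpr := (wp W Q nArr).

Definition blocks_st s := blocks m B (harr s aM) (harr s aLab) (harr s aSt) (harr s aEn).
Definition potential_st s := potential m (harr s aLab) (harr s aSt) (harr s aEn).

Lemma relabel_wp y l lo hi (P : hst -> Prop) s :
  hreg s rh = lo -> hreg s y = hi -> lo <= hi -> hi <= m -> hreg s rone = 1 -> y != rh -> l != rh ->
  (forall s', frame (relabel_cmd y l) s s' ->
     (forall x, harr s' aLab x = if lo <= x < hi then hreg s l else harr s aLab x) ->
     tm s' = tm s + 7 * (hi - lo) + 2 -> P s') ->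
  wpr (relabel_cmd y l) P s.
Proof.
move=> eh ey lh hm e1 yh lnh hP.
apply: (@wp_for _ _ _ _ _ _ (fun j s' =>
  (forall x, harr s' aLab x = if lo <= x < j then hreg s l else harr s aLab x) /\
  tm s' = tm s + 7 * (j - lo)) lo hi) => //.
- exact: negbTE yh.
- by split=> [x|]; [case: ifP => //; lia | lia].
- move=> j s' [fr fa] hj ej eyh [h1 h2] /=.
  rewrite ej (fr rone) // e1; split; first by lia.
  move=> _ _ -> ->; split; first by lia.
  move=> _ ->; split; first by lia.
  split; last by lia.
  move=> x; rewrite updE h1 fr; last exact: negbTE lnh.
  by case: (x =P j) => [->|ne]; do ![case: ifP] => //; lia.
move=> s' f ej eyh [h1 h2]; apply: hP => //=; lia.
Qed.

(** The factor 7 is the cost of relabelling one block: a test, four steps for the write, the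
    increment and the jump back. *)
Lemma merge_wp mask q s :
  blocks m B mask (harr s aLab) (harr s aSt) (harr s aEn) ->
  hreg s rq = q -> 0 < q < m -> harr s aSt (harr s aLab q) = q ->
  (forall x, harr s aM x = if x == q then 0 else mask x) -> hreg s rone = 1 ->
  wpr merge_cmd (fun s' => blocks_st s' /\
     tm s' + 7 * potential_st s <= tm s + 60 + 7 * potential_st s') s.
Proof.
move=> BS eq /andP[q0 qm] sq hmask e1.
have [[s2q qe e1m e2] ne i1 i2 out] := merge_facts BS q0 qm sq.
have lm := blocks_lab BS; have q1 : q.-1 < m by lia.
have lq := lm q qm; have lq1 := lm _ q1.
have eq1 : q - 1 = q.-1 by lia.
rewrite /= !eq e1 eq1.
do 8![split; [lia | move=> _ ->]].
set l1 := harr s aLab q in sq s2q qe e1m e2 ne i1 i2 out lq *.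
set l2 := harr s aLab q.-1 in s2q e2 ne i1 i2 out lq1 *.
set hi := harr s aEn l1 in qe e1m i1 out *; set lo := harr s aSt l2 in s2q i2 out *.
have fin s' L : (L == l1) || (L == l2) ->
    (forall x, lo <= x <= hi -> harr s' aLab x = L) ->
    (forall x, ~~ (lo <= x <= hi) -> harr s' aLab x = harr s aLab x) ->
    harr s' aSt L = lo -> harr s' aEn L = hi ->
    (forall l, l != l1 -> l != l2 -> harr s' aSt l = harr s aSt l) ->
    (forall l, l != l1 -> l != l2 -> harr s' aEn l = harr s aEn l) ->
    harr s' aM = harr s aM -> tm s' <= tm s + 60 + 7 * minn (hi.+1 - q) (q - lo) ->
    blocks_st s' /\ tm s' + 7 * potential_st s <= tm s + 60 + 7 * potential_st s'.
  move=> hL hin hout hst hen hst' hen' hM ht; split.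
    by apply: (blocks_merge BS q0 qm sq hL) => //; [move=> x _; apply: hout | rewrite hM].
  have := potential_merge BS q0 qm sq hL hin hst hen (fun x _ => @hout x) hst' hen'.
  rewrite -/l1 -/l2 -/lo -/hi -/(potential_st s) -/(potential_st s'); lia.
case: ifP => hd.
  split; [lia | move=> _ _ -> -> _ ->].
  apply: (@relabel_wp _ _ lo q) => //=; try lia.
  move=> s' [_ fa] hlab ht; have hM := fa aM erefl.
  have e3 := fa aSt erefl; have e4 := fa aEn erefl; rewrite /= in e3 e4 hlab ht hM.
  apply: (fin s' l1); rewrite ?eqxx ?e3 ?e4 //.
  - by move=> x hx; rewrite hlab; case: ifP => // hx'; apply: i1; lia.
  - by move=> x hx; rewrite hlab; case: ifP => // hx'; lia.
  - by rewrite updE eqxx.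
  - by move=> l nl _; rewrite updE (negbTE nl).
  - rewrite ht; lia.
split; [lia | move=> _ _ -> -> _ ->].
apply: (@relabel_wp _ _ q (hi + 1)) => //=; try lia.
move=> s' [_ fa] hlab ht; have hM := fa aM erefl.
have e3 := fa aSt erefl; have e4 := fa aEn erefl; rewrite /= in e3 e4 hlab ht hM.
apply: (fin (tick 1 s') l2); rewrite /= ?eqxx ?orbT ?e3 ?e4 //.
- by move=> x hx; rewrite hlab; case: ifP => // hx'; apply: i2; lia.
- by move=> x hx; rewrite hlab; case: ifP => // hx'; lia.
- by rewrite updE eqxx.
- by move=> l _ nl; rewrite updE (negbTE nl).
- rewrite ht; lia.
Qed.

Lemma find_wp y s : blocks_st s -> hreg s ry = y -> y < m * B ->
  hreg s rB = B -> hreg s rone = 1 -> hreg s rzero = 0 ->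
  wpr find_cmd (fun s' => [/\ tm s' <= tm s + 30,
    hreg s' rq = (find_block B (harr s aM) (harr s aLab) (harr s aSt) y).1 &
    hreg s' rmk = (find_block B (harr s aM) (harr s aLab) (harr s aSt) y).2]) s.
Proof.
move=> BS ey ym eB e1 e0; have [[m0 B0] _ _ _ _ _] := BS.
have qm := block_lt BS ym; have rB : y %% B < B by rewrite ltn_mod.
have fb := find_block_gt0 BS ym; have lm := blocks_lab BS.
have bnd := blocks_bound BS.
have pB : 2 ^ (y %% B).+1 <= 2 ^ B by rewrite leq_exp2l.
have qyB := leq_div y B.
rewrite /= ey eB e1 e0 /find_block.
set q := y %/ B in qm fb *; set mk := _ %% _ in fb *.
have mqB := bnd q qm.
do 6![split; [lia | move=> _ ->; rewrite ?addn1 ?mul1n]].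
case: posnP => [mk0|mk0] /=; last by move=> _ ->; split=> //; lia.
have q0 := fb mk0; have eq1 : q - 1 = q.-1 by lia.
have q1 : q.-1 < m by lia.
have l1 := lm _ q1; have [s1 _ _ _] := blocks_itv BS q1.
rewrite eq1; do 4![split; [lia | move=> _ ->]].
by split=> //; lia.
Qed.

#[local] Opaque merge_cmd.

Lemma remove_wp q i s : blocks_st s -> hreg s rq = q -> hreg s rbit = i ->
  q < m -> i < B -> harr s aSt (harr s aLab q) = q -> bit (harr s aM q) i -> 0 < q + i ->
  hreg s rone = 1 ->
  wpr remove_cmd (fun s' => [/\ blocks_st s',
    forall x, alive_bit B (harr s' aM) x = alive_bit B (harr s aM) x && (x != q * B + i) &
    tm s' + 7 * potential_st s <= tm s + 80 + 7 * potential_st s']) s.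
Proof.
move=> BS eq ei qm iB sq bi qi e1.
have bnd := blocks_bound BS qm; have ilt := bit_leq bi.
have pB : 2 ^ i <= 2 ^ B by rewrite leq_exp2l // ltnW.
rewrite /= eq ei e1 mul1n.
do 3![split; [lia | move=> _ ->]].
split; [lia | move=> _ _ -> ->].
pose mask' := upd (harr s aM) q (harr s aM q - 2 ^ i).
have hmask' x : mask' x = if x == q then harr s aM q - 2 ^ i else harr s aM x by rewrite /mask' updE.
have al x := alive_bit_sub BS x iB bi hmask'.
case: ifP => h0; last first.
  split=> //=; last by rewrite /potential_st /=; lia.
  by apply: (blocks_sub BS qm sq bi _ _ hmask'); lia.
have m0 : harr s aM q - 2 ^ i = 0 by lia.
(* Block 0 cannot become empty, since its sentinel bit remains; so there is a preceding interval to
   merge with. *)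
have q0 : 0 < q.
  case: (posnP q) => // q0; have := blocks_zero BS.
  have := @bit_sub (harr s aM q) i 0 bi; rewrite m0 bit0n /bit expn0 divn1 q0 => e o.
  by move: e; rewrite o /=; lia.
match goal with |- wp _ _ _ _ _ ?s1 => have := @merge_wp (harr s aM) q s1 end.
move=> /(_ BS eq _ sq _ e1) H; have {H} := H _ _.
move=> H; apply: (wp_mono _ (wp_frame (H _ _))).
- move=> s' /= [[h1 h2] [_ fa]]; split=> //.
    by move=> x; rewrite -al (fa aM).
  by move: h2; rewrite /potential_st /=; lia.
- by rewrite q0.
- by move=> x; rewrite /= updE m0.
Qed.

#[local] Opaque find_cmd remove_cmd.

Lemma del_wp y s : blocks_st s -> hreg s ry = y -> y < m * B ->
  hreg s rB = B -> hreg s rone = 1 -> hreg s rzero = 0 ->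
  (forall x, 0 < x < 2 ^ B -> harr s aT x = trunc_log 2 x) -> (hreg s rF).+1 < W ->
  wpr del_cmd (fun s' => [/\ blocks_st s',
    layer_del (m * B) (alive_bit B (harr s aM)) (alive_bit B (harr s' aM)) (hreg s rF) (hreg s' rF) y &
    tm s' + 7 * potential_st s <= tm s + 130 + 7 * potential_st s']) s.
Proof.
move=> BS ey ym eB e1 e0 hT FW; rewrite /del_cmd.
move: (find_blockP BS ym); case Ef: (find_block _ _ _ _ _) => [q mk] [qy sq /andP[mkB tB] bi hp].
have qm := leq_ltn_trans qy (block_lt BS ym).
rewrite /=; apply: (wp_mono _ (wp_frame (find_wp BS ey ym eB e1 e0))).
move=> s1 [[t1 eq emk] [fr fa]]; rewrite Ef /= in eq emk.
have f2 := fa aM erefl; have f3 := fa aLab erefl; have f4 := fa aSt erefl; have f5 := fa aEn erefl.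
have eF := fr rF erefl; have e1' := fr rone erefl; have e0' := fr rzero erefl.
have eT := fa aT erefl.
rewrite /= eq emk eT (hT _ mkB) e0' e0.
have mkQ : mk < Q by case/andP: mkB; lia.
have [[m0 B0] _ _ _ _ _] := BS.
have hq : (q * B + trunc_log 2 mk == 0) = (q + trunc_log 2 mk == 0).
  by rewrite !addn_eq0 muln_eq0 (gtn_eqF B0) orbF.
split; [by [] | move=> _ ->]; split.
  by have : B <= m * B; [rewrite leq_pmull | lia].
move=> _ ->; case: posnP => z0.
  rewrite z0 /= in hq; move/eqP: hq => hq.
  split; first by rewrite eF e1' e1; lia.
  move=> _ ->; split.
  - by rewrite /blocks_st /= f2 f3 f4 f5.
  - exists 0; first by move: hp; rewrite hq.
    rewrite f2 eF e1' e1; split=> // x /andP[x0 _].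
    by rewrite -lt0n x0 andbT.
  - by rewrite /potential_st /= f3 f4 f5; lia.
match goal with |- wp _ _ _ _ _ ?s2 => have R := @remove_wp q (trunc_log 2 mk) s2 end.
rewrite /blocks_st /potential_st /= f2 f3 f4 f5 e1' in R.
have {R} := R BS eq erefl qm tB sq bi z0 e1.
move=> /wp_frame; apply: wp_mono => s2 [[h1 h2 h3] [fr2 _]]; split=> //.
  exists (q * B + trunc_log 2 mk) => //; split; first by move=> x _; apply: h2.
  by rewrite (fr2 rF) //= eF hq (gtn_eqF z0) addn0.
by rewrite /potential_st; lia.
Qed.

End Del.

(** * One layer of the universal distances *)

Notation rj := 40 (only parsing).
Notation roff := 41 (only parsing).
Notation ra0 := 42 (only parsing).
Notation roff2 := 43 (only parsing).
Notation rbase := 44 (only parsing).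
Notation rnn := 45 (only parsing).
Notation ri := 46 (only parsing).
Notation rad := 47 (only parsing).
Notation rc := 48 (only parsing).
Notation rx := 49 (only parsing).
Notation rt := 50 (only parsing).
Notation rct := 51 (only parsing).
Notation rlt := 52 (only parsing).
Notation rrep := 53 (only parsing).
Notation rcnt := 54 (only parsing).
Notation rad1 := 55 (only parsing).
Notation rix := 57 (only parsing).
Notation rp0 := 58 (only parsing).
Notation rat := 59 (only parsing).
Notation rat1 := 60 (only parsing).
Notation rdx := 61 (only parsing).
Notation rdy := 62 (only parsing).
Notation ru := 63 (only parsing).

Definition reps_cmd := Wh rcnt rrep (del_cmd ;; Bin BAdd rcnt rcnt rone).

Definition include_cmd :=
  Bin BSub rt ri rsg ;; Bin BAdd rat ra0 rt ;; Bin BSub rat1 rat rone ;; Get rct aW rat1 ;;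
  Bin BAdd rix roff rct ;; Get rlt aLast rix ;;
  Bin BAdd rp0 roff rat1 ;; Get rdx aD rp0 ;; Bin BAdd rp0 roff rat ;; Get rdy aD rp0 ;;
  Bin BSub rrep rdx rdy ;; If rt rlt (Bin BAdd rrep rrep rone) (Mov ry rt) ;;
  Mov ry rt ;; Mov rcnt rzero ;; reps_cmd.

Definition query_test_cmd := If rx ru (Mov ry rx ;; del_cmd) (Mov ry rx).

Definition query_cmd :=
  Mov ru rt ;; If rt rone (Mov ru rone) (Mov ry rx) ;; query_test_cmd.

Definition store_cmd :=
  query_cmd ;; Bin BAdd rp0 roff2 rad ;; Bin BSub rdx rbase rF ;; Put aD rp0 rdx.

(** [aLast] is updated before [include_cmd], because [layer_reps] refers to last positions at
    [i.+1]; the old value is kept in [rx] for the deletion caused by the letter itself. Zeroing [rt]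
    matches the truncated difference [i.+1 - sigma] when no term enters. *)
Definition step_cmd :=
  Bin BAdd ri ri rone ;; Bin BAdd rad ra0 ri ;; Bin BSub rad1 rad rone ;;
  Get rc aW rad1 ;; Bin BAdd rix roff rc ;; Get rx aLast rix ;; Put aLast rix ri ;;
  Mov rt rzero ;; If rsg ri include_cmd (Mov ry rt) ;; store_cmd.

Section Layers.
Variables (w : seq nat) (sigma k W : nat).
Let n := size w.
Let Q := n.+1 * n.+1.
Let B := trunc_log 2 n.
Let m := (n %/ B).+1.
Hypothesis sigma_gt1 : 1 < sigma.
Hypothesis sigma_le : sigma <= n.

Lemma three_succ_le_sqr : n.+1 + n.+1 + n.+1 <= Q.
Proof. by rewrite /Q -addnA addnn -mul2n -mulSn leq_mul2r; lia. Qed.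

Lemma block_size_gt0 : 0 < B.
Proof. by rewrite trunc_log_gt0; lia. Qed.

Lemma exp_block_size_le : 2 ^ B <= n.
Proof. by apply: trunc_logP; lia. Qed.

Lemma nblocks_le : m <= n.+1.
Proof. by rewrite /m ltnS leq_div. Qed.

Lemma block_size_le : B <= n.
Proof. by apply: leq_trans exp_block_size_le; apply: ltnW; apply: ltn_expl. Qed.

Lemma blocks_cover : n < m * B.
Proof. by rewrite /m -ltn_divLR ?block_size_gt0. Qed.

Lemma blocks_cover_le : m * B <= n + n.
Proof. by rewrite /m mulSn addnC leq_add ?leq_divM ?block_size_le. Qed.

Hypothesis overw : {subset w <= Sigma sigma}.
Hypothesis k_le : k * sigma <= n.
Hypothesis QW : 11 * Q < W.
Notation wpr := (wp W Q nArr).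

Record env s : Prop := {
  env_n : hreg s rn = n; env_k : hreg s rk = k; env_one : hreg s rone = 1;
  env_sg : hreg s rsg = sigma; env_B : hreg s rB = B; env_np : hreg s rnp = n.+1;
  env_zero : hreg s rzero = 0; env_full : hreg s rfull = (2 ^ B).-1; env_m : hreg s rm = m;
  env_w : harr s aW = nth 0 w;
  env_T : forall x, 0 < x < 2 ^ B -> harr s aT x = trunc_log 2 x }.

Definition env_safe c := all (fun v => ~~ modr c v) [:: rn; rk; rone; rsg; rB; rnp; rzero; rfull; rm]
  && all (fun a => ~~ moda c a) [:: aW; aT].

Lemma env_frame c s s' : env_safe c -> env s -> frame c s s' -> env s'.
Proof.
rewrite /env_safe [all _ _]/= => /andP[/and5P[a0 a1 a2 a3 /and5P[a4 a5 a6 a7 /andP[a8 _]]] /and3P[a9 a10 _]].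
case=> e0 e1 e2 e3 e4 e5 e6 e7 e8 e9 e10 [fr fa].
by split; rewrite ?fr ?fa //; apply: negbTE.
Qed.

Lemma env_same s s' : env s ->
  [/\ hreg s' rn = hreg s rn, hreg s' rk = hreg s rk, hreg s' rone = hreg s rone,
      hreg s' rsg = hreg s rsg & hreg s' rB = hreg s rB] ->
  [/\ hreg s' rnp = hreg s rnp, hreg s' rzero = hreg s rzero, hreg s' rfull = hreg s rfull
    & hreg s' rm = hreg s rm] ->
  harr s' aW = harr s aW -> harr s' aT = harr s aT -> env s'.
Proof.
case=> e0 e1 e2 e3 e4 e5 e6 e7 e8 e9 e10 [h0 h1 h2 h3 h4] [h5 h6 h7 h8] a0 a1.
by split; rewrite ?h0 ?h1 ?h2 ?h3 ?h4 ?h5 ?h6 ?h7 ?h8 ?a0 ?a1 // => x hx; rewrite e10.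
Qed.

Section Layer.
Variables (j : nat) (D0 : nat -> nat).
Let off := j * n.+1.
Let a0 := j * sigma.
Let off2 := off + n.+1.
Let v := drop a0 w.
Let f a := D0 (off + (a0 + a)).
Hypothesis jk : a0 + sigma <= n.
Hypothesis offQ : off2 + n < Q.
Hypothesis Dspec : forall a, a0 <= a <= n -> universal_dist sigma (take a w) j (D0 (off + a)).

Lemma size_suffix : size v = n - a0.
Proof. by rewrite size_drop. Qed.

Lemma over_suffix : {subset v <= Sigma sigma}.
Proof. exact: over_drop. Qed.

Lemma suffix_dist_dec a : a < size v -> f a.+1 <= f a.
Proof.
rewrite size_suffix => h; have wa : a0 + a < size w by rewrite -/n; lia.
have d1 := @Dspec (a0 + a) ltac:(lia); have d2 := @Dspec (a0 + a).+1 ltac:(lia).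
have := universal_dist_extend overw wa d1 d2. by rewrite /f !addnS.
Qed.

Lemma suffix_dist0_le : f 0 <= a0.
Proof.
rewrite /f addn0; have [[u [su ou uu hu]] lb] := @Dspec a0 ltac:(lia).
apply: leq_trans (lb u su ou uu) _; apply: leq_trans (ham_le_size _ _) _.
by rewrite size_take_min geq_minl.
Qed.

Let sg0 : 0 < sigma. Proof. exact: ltnW. Qed.

Let sizeM : size v < m * B.
Proof. by rewrite size_suffix; apply: leq_ltn_trans (leq_subr _ _) blocks_cover. Qed.

Lemma nth_suffix i : nth 0 v i = nth 0 w (a0 + i).
Proof. by rewrite nth_drop. Qed.

Lemma letter_le i : i < n -> nth 0 w i <= n.
Proof. by move=> h; have := overw (mem_nth 0 h); rewrite mem_iota add1n ltnS => /andP[_ /leq_trans]; apply. Qed.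

Notation layer_inv := (layer_inv sigma (m * B) v f).
Notation layer_mid := (layer_mid sigma (m * B) v f).
Notation alive_st s := (alive_bit B (harr s aM)).

Record layer_env s : Prop := {
  le_env : env s; le_off : hreg s roff = off; le_a0 : hreg s ra0 = a0;
  le_off2 : hreg s roff2 = off2; le_base : hreg s rbase = f 0 + sigma;
  le_D : forall x, x < off2 -> harr s aD x = D0 x;
  le_blocks : blocks_st B m s }.

Definition layer_safe c := env_safe c && all (fun v => ~~ modr c v) [:: roff; ra0; roff2; rbase].

Lemma layer_env_frame c s s' : layer_safe c -> ~~ moda c aD -> layer_env s -> frame c s s' ->
  blocks_st B m s' -> layer_env s'.
Proof.
case/andP=> es; rewrite [all _ _]/= => /and5P[b1 b2 b3 b4 _] mD [e0 e1 e2 e3 e4 e5 e6] F bl.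
have e0' := env_frame es e0 F; case: F => fr fa.
split=> //; rewrite ?fr //; try exact: negbTE.
by move=> x xo; rewrite fa ?e5 //; apply: negbTE.
Qed.

Lemma layer_env_same s s' : layer_env s ->
  [/\ hreg s' rn = hreg s rn, hreg s' rk = hreg s rk, hreg s' rone = hreg s rone,
      hreg s' rsg = hreg s rsg & hreg s' rB = hreg s rB] ->
  [/\ hreg s' rnp = hreg s rnp, hreg s' rzero = hreg s rzero, hreg s' rfull = hreg s rfull
    & hreg s' rm = hreg s rm] ->
  [/\ hreg s' roff = hreg s roff, hreg s' ra0 = hreg s ra0, hreg s' roff2 = hreg s roff2
    & hreg s' rbase = hreg s rbase] ->
  (forall a, a != aLast -> harr s' a = harr s a) -> layer_env s'.
Proof.
case=> e b1 b2 b3 b4 b5 b6 h h' [g1 g2 g3 g4] ha.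
split; rewrite ?g1 ?g2 ?g3 ?g4 //; last by rewrite /blocks_st !ha.
  by apply: env_same e h h' _ _; rewrite ha.
by move=> x hx; rewrite ha // b5.
Qed.

(** Each layer has its own row of [aLast], still zero when the layer starts, so that nothing has to
    be cleared. *)
Definition last_ok s i := forall c, c <= n -> harr s aLast (off + c) = last_pos v i c.

#[local] Opaque del_cmd.

Lemma reps_wp i r0 s : let t := i.+1 - sigma in
  layer_env s -> sigma < i.+1 -> i < size v ->
  hreg s ry = t -> hreg s rcnt = 0 -> hreg s rrep = r0 -> r0 <= n.+1 -> hreg s rF <= n + n ->
  layer_mid i 0 (alive_st s) (hreg s rF) ->
  wpr reps_cmd (fun s' => [/\ blocks_st B m s', layer_mid i r0 (alive_st s') (hreg s' rF),
    hreg s' rF <= hreg s rF + r0 &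
    tm s' + 7 * potential_st m s <= tm s + 2 + 140 * r0 + 7 * potential_st m s']) s.
Proof.
move=> t Ls si iv ey ec er r0n Fn M0.
have nQ := three_succ_le_sqr; have pB := exp_block_size_le; have mn := nblocks_le; have mB := blocks_cover_le; have mB' := blocks_cover.
have sv := size_suffix.
rewrite /reps_cmd.
apply: (@wp_for W Q nArr rcnt rrep _ (fun r s' => [/\ blocks_st B m s',
    layer_mid i r (alive_st s') (hreg s' rF), hreg s' rF <= hreg s rF + r &
    tm s' + 7 * potential_st m s <= tm s + 140 * r + 7 * potential_st m s']) 0 r0).
- by [].
- exact: ec.
- exact: er.
- by vm_compute.
- by split; rewrite ?muln0 ?addn0 //; case: Ls.
- move=> r s' F hr er' er2 [h1 h2 h3 h4].
  have {Ls} Ls' : layer_env s' by apply: layer_env_frame F h1 => //.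
  have [E' _ _ _ _ _ _] := Ls'; have [fr _] := F.
  rewrite [wp _ _ _ _ _ _]/=.
  have ey' : hreg s' ry = t by rewrite fr.
  have D := @del_wp W Q B m ltac:(lia) ltac:(lia) ltac:(lia) ltac:(lia) t (tick 1 s') h1 ey'
    ltac:(rewrite /t; lia) (env_B E') (env_one E') (env_zero E') (env_T E') ltac:(rewrite /=; lia).
  apply: (wp_mono _ (wp_frame D)) => s2 [[k1 k2 k3] [fr2 fa2]].
  rewrite (fr2 rcnt) //= (fr2 rone) //= er' (env_one E').
  split; [lia | move=> _ ->].
  split; first by lia.
  split=> //.
  + exact: (layer_mid_step sg0 sizeM si h2 k2).
  + by case: k2 => p _ [_]; rewrite /= => ->; lia.
  + by move: k3 h4; rewrite /potential_st /=; lia.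
move=> s' F er' er2 [h1 h2 h3 h4]; split=> //=.
by move: h4; rewrite /potential_st /=; lia.
Qed.

#[local] Opaque reps_cmd.

Lemma include_wp i s : layer_env s -> sigma < i.+1 -> i < size v ->
  hreg s ri = i.+1 -> last_ok s i.+1 -> hreg s rF <= n + n ->
  layer_inv i (alive_st s) (hreg s rF) ->
  wpr include_cmd (fun s' => [/\ blocks_st B m s',
    layer_mid i (layer_reps sigma v f i) (alive_st s') (hreg s' rF) /\ hreg s' rt = i.+1 - sigma,
    hreg s' rF <= hreg s rF + n.+1 &
    tm s' + 7 * potential_st m s <=
      tm s + 300 + 140 * (f (i - sigma) - f (i.+1 - sigma)) + 7 * potential_st m s']) s.
Proof.
move=> Ls si iv ei lo Fn L0.
have nQ := three_succ_le_sqr; have sv := size_suffix.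
have M0 := layer_mid0 sg0 sizeM si iv L0.
have [E eoff ea0 _ _ eD bl] := Ls.
have [_ _ e1 esg _ _ e0 _ _ ew _] := E.
have et : i.+1 - sigma = (i - sigma).+1 by lia.
set t := i.+1 - sigma in et *.
have at0 : a0 + t - 1 = a0 + t.-1 by lia.
have oq : off + n < off2 by rewrite /off2; lia.
have W3 : Q + Q < W by lia.
have lt1 : nth 0 w (a0 + t.-1) <= n by apply: letter_le; lia.
rewrite /include_cmd; rewrite [wp _ _ _ _ _ _]/=.
have ct : nth 0 w (a0 + t.-1) = nth 0 v t.-1 by rewrite nth_suffix.
rewrite ct in lt1; have loL := lo _ lt1.
have d1 : harr s aD (off + (a0 + t)) = f t by rewrite eD //; lia.
have d2 : harr s aD (off + (a0 + t.-1)) = f t.-1 by rewrite eD //; lia.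
have d3 : f t <= f t.-1 by rewrite et; apply: suffix_dist_dec; lia.
have d4 : f t.-1 <= f 0.
  have : forall a, a <= t.-1 -> f a <= f 0.
    elim=> // a IH ha; apply: leq_trans (IH _); last by lia.
    by apply: suffix_dist_dec; lia.
  by apply.
have f0 := suffix_dist0_le.
have lp := last_pos_le v i.+1 (nth 0 v t.-1).
have Dt : f t.-1 <= n by lia.
rewrite ei esg -/t ea0 e1 ew eoff e0.
do 11![split; [lia | move=> _ ->; rewrite ?at0 ?ct ?loL ?d1 ?d2]].
have er : layer_reps sigma v f i = (t < last_pos v i.+1 (nth 0 v t.-1)) + (f t.-1 - f t) by [].
have t1 : t.-1 = i - sigma by lia.
have fin u s1 : u = layer_reps sigma v f i -> (forall a, harr s1 a = harr s a) ->
    layer_env s1 -> hreg s1 rF = hreg s rF -> hreg s1 ry = t -> hreg s1 rcnt = 0 ->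
    hreg s1 rrep = u -> hreg s1 rt = t -> tm s1 <= tm s + 100 ->
    wpr reps_cmd (fun s' => [/\ blocks_st B m s',
      layer_mid i (layer_reps sigma v f i) (alive_st s') (hreg s' rF) /\ hreg s' rt = t,
      hreg s' rF <= hreg s rF + n.+1 &
      tm s' + 7 * potential_st m s <= tm s + 300 + 140 * (f (i - sigma) - f t)
        + 7 * potential_st m s']) s1.
  move=> eu ea Ls1 eF ey ec eru ert tm1.
  have R := @reps_wp i u s1 Ls1 si iv ey ec eru ltac:(rewrite eu er; lia) ltac:(rewrite eF //).
  rewrite ea eF in R; apply: (wp_mono _ (wp_frame (R M0))).
  move=> s2 [[h1 h2 h3 h4] [fr _]]; rewrite -eu; split=> //.
  - by rewrite (fr rt).
  - by apply: leq_trans h3 _; rewrite eu er; lia.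
  - by move: h4; rewrite /potential_st !ea eu er -t1; lia.
case: ifP => hl.
  split; [lia | move=> _ -> _ -> _ ->]; apply: (fin (f t.-1 - f t + 1)) => //; [by rewrite er hl addnC | exact: (layer_env_same Ls) | by rewrite /=; lia].
move=> _ -> _ -> _ ->; apply: (fin (f t.-1 - f t)) => //; [by rewrite er hl | exact: (layer_env_same Ls) | by rewrite /=; lia].
Qed.

#[local] Opaque include_cmd.

Lemma query_test_wp i s : let x := last_pos v i (nth 0 v i) in
  layer_env s -> i < size v -> hreg s rx = x -> hreg s ru = maxn 1 (i.+1 - sigma) ->
  (if sigma < i.+1 then layer_mid i (layer_reps sigma v f i) (alive_st s) (hreg s rF)
   else layer_inv i (alive_st s) (hreg s rF)) -> hreg s rF <= n + n + n.+1 ->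
  wpr query_test_cmd (fun s' => [/\ blocks_st B m s', layer_inv i.+1 (alive_st s') (hreg s' rF) &
    tm s' + 7 * potential_st m s <= tm s + 140 + 7 * potential_st m s']) s.
Proof.
move=> x Ls iv ex eu M0 Fn; have bl := le_blocks Ls; have E := le_env Ls.
have nQ := three_succ_le_sqr; have pB := exp_block_size_le; have mn := nblocks_le; have mB := blocks_cover_le; have mB' := blocks_cover.
have xi : x <= i := last_pos_le v i _.
have [c1 c2] := layer_last_step sg0 suffix_dist_dec sizeM iv M0.
rewrite /= ex eu; case: ltnP => hx; last first.
  by move=> _ ->; split=> //=; [apply: c2 | rewrite /potential_st /=; lia].
move=> _ ->.
match goal with |- wp _ _ _ _ _ ?s2 =>
  have D := @del_wp W Q B m ltac:(lia) ltac:(lia) ltac:(lia) ltac:(lia) x s2 bl erefl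
    ltac:(lia) (env_B E) (env_one E) (env_zero E) (env_T E) ltac:(rewrite /=; lia) end.
apply: (wp_mono _ D) => s2 [h1 h2 h3]; split=> //; first exact: c1 h2.
by move: h3; rewrite /potential_st /=; lia.
Qed.

#[local] Opaque query_test_cmd.

Lemma query_wp i s : let x := last_pos v i (nth 0 v i) in
  layer_env s -> i < size v -> hreg s rx = x -> hreg s rt = i.+1 - sigma ->
  (if sigma < i.+1 then layer_mid i (layer_reps sigma v f i) (alive_st s) (hreg s rF)
   else layer_inv i (alive_st s) (hreg s rF)) -> hreg s rF <= n + n + n.+1 ->
  wpr query_cmd (fun s' => [/\ blocks_st B m s', layer_inv i.+1 (alive_st s') (hreg s' rF) &
    tm s' + 7 * potential_st m s <= tm s + 150 + 7 * potential_st m s']) s.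
Proof.
move=> x Ls iv ex et M0 Fn; have e1 := env_one (le_env Ls).
have fin s1 : layer_env s1 -> (forall a, harr s1 a = harr s a) -> hreg s1 rF = hreg s rF ->
    hreg s1 rx = x -> hreg s1 ru = maxn 1 (i.+1 - sigma) -> tm s1 <= tm s + 5 ->
    wpr query_test_cmd (fun s' => [/\ blocks_st B m s', layer_inv i.+1 (alive_st s') (hreg s' rF) &
      tm s' + 7 * potential_st m s <= tm s + 150 + 7 * potential_st m s']) s1.
  move=> Ls1 ea eF ex1 eu tm1; have R := @query_test_wp i s1 Ls1 iv ex1 eu.
  rewrite ea eF in R; apply: (wp_mono _ (R M0 Fn)) => s2 [h1 h2 h3]; split=> //.
  by move: h3; rewrite /potential_st !ea; lia.
rewrite /= et e1 => _ ->.
case: ltnP => ht.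
  move=> _ ->; apply: fin => //=; [exact: (layer_env_same Ls) | lia | lia].
move=> _ ->; apply: fin => //=; [exact: (layer_env_same Ls) | lia | lia].
Qed.

#[local] Opaque query_cmd.

(** The range starts at [sigma] because no word of length less than [a0 + sigma] is
    [j.+1]-universal. *)
Definition new_ok s i := forall i', sigma <= i' <= i ->
  universal_dist sigma (take (a0 + i') w) j.+1 (harr s aD (off2 + (a0 + i'))).

(** [T] and [p0] abstract the time budget of the step and the initial potential times 7, so that the
    lemma applies after either branch of [step_cmd]. *)
Lemma store_wp i s1 T p0 : let x := last_pos v i (nth 0 v i) in
  layer_env s1 -> i < size v -> hreg s1 ri = i.+1 -> hreg s1 rad = a0 + i.+1 ->
  hreg s1 rx = x -> hreg s1 rt = i.+1 - sigma -> last_ok s1 i.+1 ->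
  (forall x, off2 <= x -> harr s1 aLast x = 0) ->
  (if sigma < i.+1 then layer_mid i (layer_reps sigma v f i) (alive_st s1) (hreg s1 rF)
   else layer_inv i (alive_st s1) (hreg s1 rF)) -> hreg s1 rF <= n + n + n.+1 -> new_ok s1 i ->
  tm s1 + p0 + 160 <= T + 7 * potential_st m s1 ->
  wpr store_cmd
    (fun s' => [/\ [/\ layer_env s', hreg s' ri = i.+1, last_ok s' i.+1 &
      forall x, off2 <= x -> harr s' aLast x = 0],
      layer_inv i.+1 (alive_st s') (hreg s' rF), new_ok s' i.+1 &
      tm s' + p0 <= T + 7 * potential_st m s']) s1.
Proof.
move=> x Ls1 iv ei1 ead ex et lo1 lz1 M1 Fn1 no1 t1.
have nQ := three_succ_le_sqr; have sv := size_suffix; have f0 := suffix_dist0_le.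
have oq : off + n < off2 by rewrite /off2; lia.
have W3 : Q + Q < W by lia.
rewrite /=; apply: (wp_mono _ (wp_frame (query_wp Ls1 iv ex et M1 Fn1))).
move=> s2 [[h1 h2 h3] F].
have Ls2 : layer_env s2 by apply: layer_env_frame F h1.
have [fr fa] := F; have [_ _ _ eo2 eb2 eD2 _] := Ls2.
have [Fle2 ex_min lb_min] := layer_inv_min sg0 over_suffix sizeM h2 iv.
rewrite eo2 eb2 (fr rad) // ead.
split; [lia | move=> _ ->]; split; [lia | move=> _ ->]; split; [lia | move=> _ _ -> ->].
have eL : harr s2 aLast = harr s1 aLast by rewrite fa.
split.
- split.
  + have [E2 b2 b3 b4 b5 b6 b7] := Ls2; split=> //; first exact: env_same E2 _ _ _ _.
    by move=> y hy; rewrite /= updE eD2 //; case: eqP => // hy'; lia.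
  + by rewrite /= (fr ri) // ei1.
  + by move=> c hc; rewrite /= eL lo1.
  + by move=> y hy; rewrite /= eL lz1.
- exact: h2.
- move=> i' /andP[si' i'i]; rewrite /= updE eqn_add2l eqn_add2l.
  case: (i' =P i.+1) => [->|ni]; last by rewrite fa //; apply: no1; lia.
  have [a [a1 a2]] := ex_min.
  have dist_eq b : b <= i.+1 ->
      size (undup (drop (a0 + b) (take (a0 + i.+1) w))) = distinct v b i.+1.
    by move=> hb; rewrite /distinct /v addnC -drop_drop take_drop addnC.
  apply: (@universal_dist_step sigma sigma_gt1 w (a0 + i.+1) j (fun b => D0 (off + b))) => //.
  + by rewrite -/n; lia.
  + by move=> b hb; apply: Dspec; lia.
  + exists (a0 + a); split; [lia | lia |].
    by rewrite dist_eq; [exact: a2 | lia].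
  + move=> b hb1 hb2; have := lb_min (b - a0).
    rewrite -dist_eq; last by lia.
    by rewrite /f subnKC //; apply; lia.
- by move: h3 t1; rewrite /potential_st /=; lia.
Qed.

#[local] Opaque store_cmd.

Lemma step_wp i s : layer_env s -> i < size v -> hreg s ri = i -> last_ok s i ->
  (forall x, off2 <= x -> harr s aLast x = 0) ->
  layer_inv i (alive_st s) (hreg s rF) -> new_ok s i ->
  wpr step_cmd (fun s' => [/\ [/\ layer_env s', hreg s' ri = i.+1, last_ok s' i.+1 &
    forall x, off2 <= x -> harr s' aLast x = 0],
    layer_inv i.+1 (alive_st s') (hreg s' rF), new_ok s' i.+1 &
    tm s' + 7 * potential_st m s <=
      tm s + 500 + 140 * (f (i - sigma) - f (i.+1 - sigma)) + 7 * potential_st m s']) s.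
Proof.
move=> Ls iv ei lo lz L0 no; have [E eoff ea0 eoff2 ebase eD bl] := Ls.
have [_ _ e1 esg _ _ e0 _ _ ew _] := E.
have nQ := three_succ_le_sqr; have sv := size_suffix; have f0 := suffix_dist0_le.
have oq : off + n < off2 by rewrite /off2; lia.
have W3 : Q + Q < W by lia.
have [Fle _ _] := layer_inv_min sg0 over_suffix sizeM L0 (ltnW iv).
pose x := last_pos v i (nth 0 v i).
have ct : nth 0 w (a0 + i) = nth 0 v i by rewrite nth_suffix.
have lt1 : nth 0 v i <= n by rewrite -ct; apply: letter_le; lia.
have loL := lo _ lt1.
have ad1 : a0 + i.+1 - 1 = a0 + i by lia.
rewrite /step_cmd /= ei ea0 e1 ew eoff esg e0 addn1.
split; [lia | move=> _ ->; rewrite ?addn1].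
do 3![split; [lia | move=> _ ->; rewrite ?ad1 ?ct]].
split; [lia | move=> _ ->].
split; [lia | move=> _ ->; rewrite loL].
split; [lia | move=> _ _ -> -> _ ->].
have lo' s1 : harr s1 aLast = upd (harr s aLast) (off + nth 0 v i) i.+1 -> last_ok s1 i.+1.
  move=> e c hc; rewrite e updE eqn_add2l /= eq_sym.
  by case: eqP => // _; apply: lo.
have lz' s1 : harr s1 aLast = upd (harr s aLast) (off + nth 0 v i) i.+1 ->
    forall x, off2 <= x -> harr s1 aLast x = 0.
  by move=> e y hy; rewrite e updE lz //; case: eqP => // hy'; lia.
case: ifP => si.
  match goal with |- wp _ _ _ _ _ ?t => pose s1 := t end.
  have Ls1 : layer_env s1 by apply: (layer_env_same Ls) => // a h6; rewrite /= upd_neq.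
  have I := @include_wp i s1 Ls1 si iv erefl (lo' s1 erefl) ltac:(rewrite /=; lia) L0.
  apply: (wp_mono _ (wp_frame I)) => s2 [[h1 [h2 h2'] h3 h4] F2].
  have [fr2 fa2] := F2.
  apply: store_wp => //; rewrite ?si //.
  - exact: layer_env_frame F2 h1.
  - by rewrite (fr2 ri).
  - by rewrite (fr2 rad).
  - by rewrite (fr2 rx).
  - by apply: lo'; rewrite fa2.
  - by apply: lz'; rewrite fa2.
  - by move: h3; rewrite /=; lia.
  - by move=> i' hi'; rewrite fa2 //; apply: no.
  - by move: h4; rewrite /potential_st /=; lia.
move=> _ ->; apply: store_wp => //; rewrite ?si //=.
- by apply: (layer_env_same Ls) => // a h6; rewrite /= upd_neq.
- by lia.
- exact: lo'.
- exact: (lz' (Hst (hreg s) (fun=> upd (harr s aLast) (off + nth 0 v i) i.+1) 0)).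
- by lia.
- by rewrite /potential_st /=; lia.
Qed.

End Layer.
End Layers.

(** * All layers of the universal distances *)

Definition init_loop_cmd := Wh rq rm
  (Put aM rq rfull ;; Put aLab rq rq ;; Put aSt rq rq ;; Put aEn rq rq ;; Bin BAdd rq rq rone).

Definition steps_cmd := Wh ri rnn step_cmd.

Definition layer_cmd :=
  Mov rq rzero ;; init_loop_cmd ;; Mov rF rzero ;; Mov ri rzero ;; Bin BSub rnn rn ra0 ;;
  Bin BAdd rp0 roff ra0 ;; Get rbase aD rp0 ;; Bin BAdd rbase rbase rsg ;;
  Bin BAdd roff2 roff rnp ;; steps_cmd ;;
  Bin BAdd ra0 ra0 rsg ;; Mov roff roff2 ;; Bin BAdd rj rj rone.

Definition layers_cmd := Wh rj rk layer_cmd.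

Lemma bit_ones B i : i < B -> bit (2 ^ B).-1 i.
Proof.
move=> iB; have e : (2 ^ B).-1 = (2 ^ (B - i)).-1 * 2 ^ i + (2 ^ i).-1.
  have p1 : 0 < 2 ^ i by rewrite expn_gt0.
  have p2 : 0 < 2 ^ (B - i) by rewrite expn_gt0.
  by rewrite -{1}(subnK (ltnW iB)) expnD; case: (2 ^ (B - i)) p2 => // x _; rewrite mulSn /=; lia.
rewrite e bit_MDl // eqxx /= bit_small ?prednK ?expn_gt0 // addbF.
have [d ->] : exists d, B - i = d.+1 by exists (B - i).-1; lia.
have : 0 < 2 ^ d by rewrite expn_gt0.
rewrite expnS; case: (2 ^ d) => // x _.
by rewrite mul2n doubleS /= odd_double.
Qed.

Section LayersLoop.
Variables (w : seq nat) (sigma k W : nat).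
Let n := size w.
Let Q := n.+1 * n.+1.
Let B := trunc_log 2 n.
Let m := (n %/ B).+1.
Hypothesis sigma_gt1 : 1 < sigma.
Hypothesis sigma_le : sigma <= n.
Hypothesis overw : {subset w <= Sigma sigma}.
Hypothesis k_le : k * sigma <= n.
Hypothesis QW : 11 * Q < W.
Notation wpr := (wp W Q nArr).
Notation env := (env w sigma k).

Let nQ : n.+1 + n.+1 + n.+1 <= Q. Proof. exact: three_succ_le_sqr sigma_gt1 sigma_le. Qed.
Let pB : 2 ^ B <= n. Proof. exact: exp_block_size_le sigma_gt1 sigma_le. Qed.
Let mn : m <= n.+1. Proof. exact: nblocks_le. Qed.
Let mB : m * B <= n + n. Proof. exact: blocks_cover_le sigma_gt1 sigma_le. Qed.
Let mB' : n < m * B. Proof. exact: blocks_cover sigma_gt1 sigma_le. Qed.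
Let B0 : 0 < B. Proof. exact: block_size_gt0 sigma_gt1 sigma_le. Qed.

Lemma init_wp s : env s -> hreg s rq = 0 ->
  wpr init_loop_cmd (fun s' => [/\ blocks_st B m s',
    forall x, x < m * B -> alive_bit B (harr s' aM) x & tm s' <= tm s + 19 * m + 2]) s.
Proof.
move=> E eq0; have e1 := env_one E; have ef := env_full E; have em := env_m E.
have pB1 : 0 < (2 ^ B).-1 by move: B0; case: (B) => // b _; rewrite expnS; have : 0 < 2 ^ b; rewrite ?expn_gt0 //; lia.
have W3 : Q + Q < W by lia.
rewrite /init_loop_cmd.
apply: (@wp_for W Q nArr rq rm _ (fun q s' => [/\ forall x, x < q -> harr s' aM x = (2 ^ B).-1,
  forall x, x < q -> harr s' aLab x = x, forall x, x < q -> harr s' aSt x = x,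
  forall x, x < q -> harr s' aEn x = x & tm s' = tm s + 19 * q]) 0 m) => //.
- by split=> //; lia.
- move=> q s' [fr fa] /andP[_ qm] eq em' [h1 h2 h3 h4 h5].
  rewrite /= eq (fr rone) // (fr rfull) // e1 ef.
  do 4![split; [lia | move=> _ _ -> ->]]; split; [lia | move=> _ ->].
  split; first by lia.
  have key (a : nat -> nat) u : (forall x, x < q -> a x = u x) ->
      forall x, x < q.+1 -> upd a q (u q) x = u x.
    by move=> ha x xq; rewrite updE; case: eqP => [->//|ne]; apply: ha; lia.
  split; [exact: (key _ (fun=> _)) | exact: (key _ id) | exact: (key _ id) | exact: (key _ id) |].
  by rewrite /= h5; lia.
move=> s' _ _ _ [h1 h2 h3 h4 h5]; split.
- split=> //=.
  + by move=> q qm; rewrite h2.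
  + move=> q qm; rewrite h2 // h3 // h4 //; split=> // q' /andP[a b].
    have -> : q' = q by lia.
    exact: h2.
  + by move=> q qm; rewrite h1 //; lia.
  + by move=> q qm; rewrite h1 // h2 // h3 // eqxx; lia.
  + rewrite h1 //; have := bit_ones B0; by rewrite /bit expn0 divn1.
- move=> x xm; rewrite /alive_bit /= h1; last by rewrite ltn_divLR.
  by apply: bit_ones; rewrite ltn_mod.
- by rewrite /=; lia.
Qed.

Definition layers_inv j s := [/\ env s, hreg s roff = j * n.+1 /\ hreg s ra0 = j * sigma,
  forall x, j * n.+1 <= x -> harr s aLast x = 0 &
  forall a, j * sigma <= a <= n -> universal_dist sigma (take a w) j (harr s aD (j * n.+1 + a))].

#[local] Opaque init_loop_cmd step_cmd.

Section OneLayer.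
Variables (j : nat) (D0 : nat -> nat).
Hypothesis jk : j < k.
Hypothesis Dspec : forall a, j * sigma <= a <= n ->
  universal_dist sigma (take a w) j (D0 (j * n.+1 + a)).
Let v := drop (j * sigma) w.
Let f a := D0 (j * n.+1 + (j * sigma + a)).
Notation layer_env := (layer_env w sigma k j D0).
Notation layer_inv := (layer_inv sigma (m * B) v f).

Lemma layer_end_le : j * sigma + sigma <= n.
Proof. by apply: leq_trans k_le; rewrite -[leqLHS]addnC -mulSn leq_mul2r jk orbT. Qed.

(** Since [sigma >= 2], there are at most [n / 2] layers, so their rows of length [n + 1] fit into
    [Q = (n + 1) ^ 2] entries. *)
Lemma layer_offset_lt : j * n.+1 + n.+1 + n < Q.
Proof.
have kn : k.*2 <= n by rewrite -muln2; apply: leq_trans k_le; rewrite leq_mul2l sigma_gt1 orbT.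
have : j.+2 * n.+1 <= Q by rewrite leq_mul2r; lia.
by rewrite !mulSn; lia.
Qed.

Lemma steps_wp s : layer_env s -> hreg s ri = 0 -> hreg s rnn = size v ->
  (forall x, x < m * B -> alive_bit B (harr s aM) x) -> hreg s rF = 0 ->
  (forall x, j * n.+1 <= x -> harr s aLast x = 0) ->
  wpr steps_cmd (fun s' => [/\ layer_env s',
    forall x, j.+1 * n.+1 <= x -> harr s' aLast x = 0,
    forall a, j.+1 * sigma <= a <= n ->
      universal_dist sigma (take a w) j.+1 (harr s' aD (j.+1 * n.+1 + a)) &
    tm s' <= tm s + 700 * n + 100]) s.
Proof.
move=> Ls ei enn al eF lz.
have js := layer_end_le; have oQ := layer_offset_lt.
have sv : size v = n - j * sigma by rewrite size_drop.
have f0 : f 0 <= j * sigma := suffix_dist0_le sigma_gt1 sigma_le k_le QW js oQ Dspec.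
rewrite /steps_cmd.
apply: (@wp_for W Q nArr ri rnn _ (fun i s' => [/\ [/\ layer_env s', last_ok w sigma j s' i &
    forall x, j * n.+1 + n.+1 <= x -> harr s' aLast x = 0],
    layer_inv i (alive_bit B (harr s' aM)) (hreg s' rF), new_ok w sigma j s' i &
    tm s' + 7 * potential_st m s <=
      tm s + 502 * i + 140 * (f 0 - f (i - sigma)) + 7 * potential_st m s']) 0 (size v)) => //.
- split=> //.
  + by split=> //; [move=> c hc; rewrite lz // leq_addr | move=> x hx; apply: lz; lia].
  + have sM : size v < m * B by rewrite sv; apply: leq_ltn_trans (leq_subr _ _) mB'.
    have M1 : 1 < m * B by lia.
    by rewrite eF; apply: (layer_inv0 f (ltnW sigma_gt1) sM M1) => x /andP[_ hx]; apply: al.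
  + by move=> i' /andP[]; lia.
  + by lia.
- move=> i s' F /andP[_ iv] ei' en' [[h1 h2 h3] h4 h5 h6].
  have h1' : layer_env (tick 1 s') by apply: (layer_env_same h1).
  have R := @step_wp w sigma k W sigma_gt1 sigma_le overw k_le QW j D0 js oQ Dspec i (tick 1 s')
    h1' iv ei' h2 h3 h4 h5.
  apply: (wp_mono _ R) => s2 [[k1 k2 k3 k4] k5 k6 k7]; split=> //; split=> //; first by split=> //; apply: (layer_env_same k1).
  (* Monotonicity lets the truncated differences of [f] add up to [f 0 - f (i.+1 - sigma)]. *)
  have dec : f (i.+1 - sigma) <= f (i - sigma) <= f 0.
    have fd := @suffix_dist_dec w sigma k W sigma_gt1 sigma_le overw k_le QW j D0 js oQ Dspec.
    have mono a : a <= size v -> f a <= f 0.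
      by elim: a => // a IH ha; apply: leq_trans (IH (ltnW ha)); apply: fd.
    rewrite mono; last by lia.
    rewrite andbT; case: (leqP sigma i) => si; first by rewrite subSn //; apply: fd; rewrite -/v; lia.
    have -> : i - sigma = 0 by lia.
    by have -> // : i.+1 - sigma = 0 by lia.
  have {}k7 : tm s2 + 7 * potential_st m s' <= 1 + tm s' + 500
      + 140 * (f (i - sigma) - f (i.+1 - sigma)) + 7 * potential_st m s2 := k7.
  have : 1 + tm s2 + 7 * potential_st m s <= tm s + 502 * i.+1
      + 140 * (f 0 - f (i.+1 - sigma)) + 7 * potential_st m s2 by lia.
  by [].
move=> s' F ei' en' [[h1 h2 h3] h4 h5 h6]; split=> //; first exact: (layer_env_same h1).
- by move=> x hx; apply: h3; move: hx; rewrite mulSn; lia.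
- move=> a /andP[a1 a2]; rewrite mulSn in a1.
  have := h5 (a - j * sigma); have -> : j * sigma + (a - j * sigma) = a by lia.
  by rewrite mulSn [n.+1 + _]addnC; apply; lia.
have pm : potential_st m s' <= m * trunc_log 2 m.
  by apply: potential_max => q qm; have [_ _ ? _] := blocks_itv (le_blocks h1) qm.
have tlm : trunc_log 2 m <= B.+1.
  apply: leq_trans (leq_trunc_log _ mn) _.
  rewrite -ltnS -(ltn_exp2l _ _ (ltnSn 1)); apply: leq_ltn_trans (trunc_logP (ltnSn 1) _) _ => //.
  have := trunc_log_ltn n (ltnSn 1); rewrite -/B !expnS; lia.
(* Uses [m * B <= 2 * n] and [m <= n + 1]; the blocks of logarithmic size make the relabelling cost
   of a layer linear. *)
have mm : m * trunc_log 2 m <= 3 * n + 1.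
  apply: leq_trans (_ : m * B.+1 <= _); first by rewrite leq_mul2l tlm orbT.
  by rewrite mulnS; lia.
have : 2 + tm s' <= tm s + 700 * n + 100 by rewrite sv in h6; lia.
by [].
Qed.
End OneLayer.
#[local] Opaque steps_cmd.

Lemma layer_wp j s : j < k -> layers_inv j s -> hreg s rj = j ->
  wpr layer_cmd (fun s' => [/\ hreg s' rj = j.+1, layers_inv j.+1 s' &
    tm s' <= tm s + 800 * n + 200]) s.
Proof.
move=> jk [E [eoff ea0] lz Dspec] ej.
have js := layer_end_le jk; have oQ := layer_offset_lt jk.
have W3 : Q + Q + Q < W by lia.
rewrite /layer_cmd /= (env_zero E) => _ ->.
match goal with |- wp _ _ _ _ _ ?t => pose s0 := t end.
have E0 : env s0 by apply: (env_same E).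
apply: (wp_mono _ (wp_frame (init_wp E0 erefl))) => s1 [[h1 h2 h3] F1].
have E1 : env s1 := env_frame (isT : env_safe init_loop_cmd) E0 F1.
have [fr fa] := F1.
rewrite (env_zero E1) (env_n E1) (env_sg E1) (env_np E1) (fr roff) // (fr ra0) // (fa aD) //=.
rewrite eoff ea0.
move=> _ -> _ ->.
have f0 : harr s aD (j * n.+1 + j * sigma) <= j * sigma.
  by have := suffix_dist0_le sigma_gt1 sigma_le k_le QW js oQ Dspec; rewrite addn0.
do 5![split; [lia | move=> _ ->]].
match goal with |- wp _ _ _ _ _ ?t => pose s2 := t end.
have Ls2 : layer_env w sigma k j (harr s aD) s2.
  split=> //=.
  - exact: (env_same E1).
  - by rewrite (fr roff).
  - by rewrite (fr ra0).
  - by rewrite addn0.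
  - by rewrite fa.
have sv : size (drop (j * sigma) w) = n - j * sigma by rewrite size_drop.
have R := steps_wp jk Dspec Ls2 erefl (esym sv) h2 erefl _.
apply: (wp_mono _ (wp_frame (R _))); last by rewrite /= fa.
move=> s3 [[k1 k2 k3 k4] [fr3 fa3]].
rewrite (le_a0 k1) (le_off2 k1) (env_sg (le_env k1)) (env_one (le_env k1)) (fr3 rj) //= (fr rj) //= ej.
split; [lia | move=> _ -> _ ->].
split; first by lia.
move=> _ ->; split => //=; first by rewrite addn1.
  split=> //=.
  - exact: (env_same (le_env k1)).
  - by rewrite mulSn addnC; split=> //; rewrite mulSn addnC.
have : tm s2 <= tm s + 19 * n.+1 + 20 by rewrite /s2 /=; move: h3; rewrite /s0 /=; lia.
lia.
Qed.

#[local] Opaque layer_cmd.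

Lemma layers_wp s : layers_inv 0 s -> hreg s rj = 0 ->
  wpr layers_cmd (fun s' => env s' /\
    [/\ hreg s' roff = k * n.+1, universal_dist sigma w k (harr s' aD (k * n.+1 + n)) &
    tm s' <= tm s + (800 * n + 202) * k + 2]) s.
Proof.
move=> L0 ej; have [E _ _ _] := L0.
rewrite /layers_cmd; apply: (@wp_for W Q nArr rj rk _ (fun j s' => layers_inv j s' /\
  tm s' <= tm s + (800 * n + 202) * j) 0 k) => //.
- exact: env_k E.
- by rewrite muln0 addn0.
- move=> j s' F jk ej' ek' [h1 h2].
  have h1' : layers_inv j (tick 1 s') by case: h1 => a b c d; split=> //; apply: (env_same a).
  apply: (wp_mono _ (layer_wp jk h1' ej')) => s2 [k1 k2 k3]; split=> //; split.
    by case: k2 => a b c d; split=> //; apply: (env_same a).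
  by move: k3; rewrite /= mulnS; lia.
move=> s' F ej' ek' [[a [b1 b2] c d] h2]; split; first exact: (env_same a).
split=> //; last by rewrite /=; lia.
have := d n; rewrite take_size; apply.
by rewrite k_le leqnn.
Qed.

End LayersLoop.

(** * Missing distances and the complete program *)

Notation rg := 70 (only parsing).
Notation rhp := 71 (only parsing).
Notation rg1 := 72 (only parsing).
Notation rci := 73 (only parsing).
Notation rcc := 74 (only parsing).
Notation rcj := 75 (only parsing).
Notation rcd := 76 (only parsing).
Notation rmu := 77 (only parsing).
Notation rkk := 78 (only parsing).

(** Moves one letter from cell [g] to cell [g + 1] of the histogram. The minimum changes only if it
    was [g] and cell [g] becomes empty; it is then [g + 1], the new value of this very letter. *)
Definition update_cmd :=
  Bin BAdd rg1 rg rone ;; Put aG rix rg1 ;;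
  Bin BAdd rci roff rg ;; Get rcc aCnt rci ;; Bin BSub rcc rcc rone ;; Put aCnt rci rcc ;;
  Bin BAdd rcj rci rone ;; Get rcd aCnt rcj ;; Bin BAdd rcd rcd rone ;; Put aCnt rcj rcd ;;
  If rcc rone (If rmu rg (Mov rx rg) (Mov rmu rg1)) (Mov rx rg).

Definition missing_store_cmd :=
  Bin BAdd ri ri rone ;; Bin BAdd rp0 roff2 ri ;; Put aH rp0 rmu.

Definition missing_step_cmd :=
  Get rc aW ri ;; Bin BAdd rix roff rc ;; Get rg aG rix ;;
  Bin BAdd rp0 roff ri ;; Get rhp aH rp0 ;; If rg rhp update_cmd (Mov rx rg) ;;
  missing_store_cmd.

Definition missing_steps_cmd := Wh ri rn missing_step_cmd.

Definition missing_layer_cmd :=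
  Bin BAdd roff2 roff rnp ;; Mov rmu rzero ;; Put aCnt roff rsg ;; Put aH roff2 rzero ;;
  Mov ri rzero ;; missing_steps_cmd ;; Mov roff roff2 ;; Bin BAdd rj rj rone.

Definition missing_layers_cmd := Wh rj rkk missing_layer_cmd.

(** [n + 1] represents infinity in row 0, as the empty word is never missed. *)
Definition fill_cmd := Wh ri rnp (Put aH ri rnp ;; Bin BAdd ri ri rone).

(** The alphabet size is not part of the input; it is the largest letter, as the letters of [w] are
    exactly 1, ..., [sigma]. *)
Definition sigma_cmd :=
  Wh ri rn (Get rc aW ri ;; If rsg rc (Mov rsg rc) (Mov rx rc) ;; Bin BAdd ri ri rone).

(** [rx] stays one power of 2 ahead of [rpB], so the loop stops with the largest power that is at
    most [n]. *)
Definition log_cmd :=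
  Wh rx rnp (Mov rpB rx ;; Bin BAdd rx rpB rpB ;; Bin BAdd rB rB rone).

(** Halving lowers the logarithm by one. The loop starts at 2, as the entry for 1 is the initial
    zero. *)
Definition table_cmd :=
  Wh ri rpB (Bin BDiv rx ri rtwo ;; Get rc aT rx ;; Bin BAdd rc rc rone ;; Put aT ri rc ;;
             Bin BAdd ri ri rone).

Definition setup_cmd :=
  Cst rone 1 ;; Bin BAdd rnp rn rone ;; Mov ri rzero ;; sigma_cmd ;;
  Cst rtwo 2 ;; Cst rpB 1 ;; Cst rx 2 ;; log_cmd ;; Bin BSub rfull rpB rone ;;
  Mov ri rtwo ;; table_cmd ;; Bin BDiv rm rn rB ;; Bin BAdd rm rm rone.

Definition main_cmd :=
  setup_cmd ;; Mov rj rzero ;; Mov roff rzero ;; Mov ra0 rzero ;; layers_cmd ;;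
  Mov ri rzero ;; fill_cmd ;; Mov rj rzero ;; Mov roff rzero ;; Bin BAdd rkk rk rone ;;
  missing_layers_cmd ;;
  Bin BMul rp0 rk rnp ;; Bin BAdd rp0 rp0 rn ;; Get rx aD rp0 ;;
  Bin BAdd rp0 roff rn ;; Get ry aH rp0 ;; Bin BAdd rx rx ry.

Lemma count_upd (s : seq nat) (G : nat -> nat) c u x : uniq s -> c \in s ->
  count (fun y => upd G c u y == x) s + (G c == x) = count (fun y => G y == x) s + (u == x).
Proof.
elim: s => //= a s IH /andP[as_ us]; rewrite inE; case: (c =P a) => [->|nca] /=.
  move=> _; rewrite updE eqxx; have -> : count (fun y => upd G a u y == x) s =
      count (fun y => G y == x) s.
    by apply: eq_in_count => y ys; rewrite updE; case: (y =P a) => // e; rewrite -e ys in as_.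
  by lia.
move=> /(IH us) e; rewrite updE; case: (a =P c) => [e'|_]; [by rewrite e' in nca | lia].
Qed.

(** * Missing distances by histograms *)

Section Missing.
Variables (w : seq nat) (sigma k W : nat).
Let n := size w.
Let Q := n.+1 * n.+1.
Hypothesis sigma_gt1 : 1 < sigma.
Hypothesis sigma_le : sigma <= n.
Hypothesis overw : {subset w <= Sigma sigma}.
Hypothesis k_le : k * sigma <= n.
Hypothesis QW : 11 * Q < W.
Notation wpr := (wp W Q nArr).
Notation env := (env w sigma k).

Let nQ : n.+1 + n.+1 + n.+1 <= Q. Proof. exact: three_succ_le_sqr sigma_gt1 sigma_le. Qed.

Section OneLayer.
Variables (j : nat).
Let off := j * n.+1.
Let off2 := off + n.+1.
Hypothesis offQ : off2 + n < Q.

Record missing_inv i s : Prop := {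
  mi_env : env s; mi_off : hreg s roff = off; mi_off2 : hreg s roff2 = off2;
  mi_G : forall c, c \in Sigma sigma -> missing_dist_last sigma (take i w) j c (harr s aG (off + c));
  mi_cnt : forall x, x <= n ->
    harr s aCnt (off + x) = count (fun c => harr s aG (off + c) == x) (Sigma sigma);
  mi_mu : (forall c, c \in Sigma sigma -> hreg s rmu <= harr s aG (off + c)) /\
    (exists2 c, c \in Sigma sigma & harr s aG (off + c) = hreg s rmu);
  mi_old : forall i', i' <= n -> missing_dist sigma (take i' w) j (harr s aH (off + i'));
  mi_new : forall i', i' <= i -> missing_dist sigma (take i' w) j.+1 (harr s aH (off2 + i')) /\
    harr s aH (off2 + i') <= n;
  mi_zero : forall x, off2 <= x -> harr s aG x = 0 /\ harr s aCnt x = 0 }.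

Lemma missing_inv_same i s s' : missing_inv i s ->
  [/\ hreg s' rn = hreg s rn, hreg s' rk = hreg s rk, hreg s' rone = hreg s rone,
      hreg s' rsg = hreg s rsg & hreg s' rB = hreg s rB] ->
  [/\ hreg s' rnp = hreg s rnp, hreg s' rzero = hreg s rzero, hreg s' rfull = hreg s rfull
    & hreg s' rm = hreg s rm] ->
  [/\ hreg s' roff = hreg s roff, hreg s' roff2 = hreg s roff2 & hreg s' rmu = hreg s rmu] ->
  (forall a, harr s' a = harr s a) -> missing_inv i s'.
Proof.
case=> a1 a2 a3 a4 a5 a6 a7 a8 a9 h1 h2 [g1 g2 g3] ha.
by split; rewrite ?g1 ?g2 ?g3 ?ha //; apply: (env_same a1).
Qed.

(* Everything except the new entry of [aH] after reading letter [i]. *)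
Definition missing_mid i s := [/\ env s, hreg s roff = off /\ hreg s roff2 = off2,
  forall c, c \in Sigma sigma -> missing_dist_last sigma (take i.+1 w) j c (harr s aG (off + c)),
  forall x, x <= n -> harr s aCnt (off + x) = count (fun c => harr s aG (off + c) == x) (Sigma sigma) &
  (forall c, c \in Sigma sigma -> hreg s rmu <= harr s aG (off + c)) /\
    (exists2 c, c \in Sigma sigma & harr s aG (off + c) = hreg s rmu)].

Lemma update_wp i s : i < n -> missing_inv i s ->
  let c := nth 0 w i in
  hreg s rix = off + c -> hreg s rg = harr s aG (off + c) ->
  harr s aG (off + c) < harr s aH (off + i) ->
  wpr update_cmd (fun s' => [/\ missing_mid i s', tm s' <= tm s + 50 &
    forall x, off2 <= x -> harr s' aG x = 0 /\ harr s' aCnt x = 0]) s.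
Proof.
move=> iw I c eix eg gh; have [E eo eo2 IG Icnt [Imu1 Imu2] Iold Inew Iz] := I.
set g := harr s aG (off + c) in eg gh *.
have cS : c \in Sigma sigma by apply: overw; apply: mem_nth.
have cn : c <= n by apply: letter_le sigma_le overw _ iw.
have gi : g <= i.
  by apply: leq_trans (missing_dist_last_size (IG c cS)) _; rewrite size_take_min geq_minl.
have cnt_le x : count (fun c => harr s aG (off + c) == x) (Sigma sigma) <= n.
  by apply: leq_trans (count_size _ _) _; rewrite size_Sigma.
have cnt1 : 0 < count (fun c => harr s aG (off + c) == g) (Sigma sigma).
  by rewrite -has_count; apply/hasP; exists c; rewrite // /g eqxx.
have oq : off + n < off2 by rewrite /off2; lia.
have W3 : Q + Q + Q < W by lia.
have cg := Icnt g ltac:(lia); have cg1 := Icnt g.+1 ltac:(lia).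
have l1 := cnt_le g; have l2 := cnt_le g.+1.
rewrite /update_cmd /= eix eg eo (env_one E) addn1.
split; [lia | move=> _ ->].
split; [lia | move=> _ _ -> ->].
split; [lia | move=> _ ->].
split; [lia | move=> _ ->]; rewrite cg.
split; [lia | move=> _ ->].
split; [lia | move=> _ _ -> ->].
split; [lia | move=> _ ->].
have e1 : off + g + 1 = off + g.+1 by lia.
rewrite e1.
split; [lia | move=> _ ->].
have ne : off + g.+1 != off + g by lia.
rewrite (upd_neq _ _ ne) cg1.
split; [lia | move=> _ ->].
split; [lia | move=> _ _ -> ->].
set G' := upd (harr s aG) (off + c) g.+1.
have G'E x : G' (off + x) = upd (fun y => harr s aG (off + y)) c g.+1 x.
  by rewrite /G' !updE eqn_add2l.
have step : forall x, x \in Sigma sigma -> missing_dist_last sigma (take i.+1 w) j x (G' (off + x)).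
  move=> x xS; rewrite (take_nth 0) //.
  have := missing_dist_last_step sigma_gt1 cS (IG x xS) (Iold i (ltnW iw)).
  rewrite G'E updE eq_sym; case: eqP => // ->; rewrite -/g.
  by rewrite (minn_idPl _).
set C' := upd _ _ _.
have cntE x : x <= n -> C' (off + x) = count (fun c => G' (off + c) == x) (Sigma sigma).
  move=> xn; rewrite (eq_count (a2 := fun y => upd (fun y => harr s aG (off + y)) c g.+1 y == x)); last first.
    by move=> y; rewrite G'E.
  have := count_upd (fun y => harr s aG (off + y)) g.+1 x (uniq_Sigma sigma) cS; rewrite -/g.
  rewrite /C' !updE !eqn_add2l; case: (x =P g.+1) => [->|n1].
    by rewrite eqxx; lia.
  case: (x =P g) => [->|n2]; first by rewrite eqxx; lia.
  by rewrite Icnt //; lia.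
have cntg := cntE g ltac:(lia).
have cg' : C' (off + g) = count (fun c0 => harr s 9 (off + c0) == g) (Sigma sigma) - 1.
  by rewrite /C' !updE !eqn_add2l eqxx; case: eqP => //; lia.
have G'le x : harr s aG (off + x) <= G' (off + x).
  by rewrite G'E updE; case: eqP => [->|]; rewrite -/g; lia.
have zero x : off2 <= x -> G' x = 0 /\ C' x = 0.
  move=> hx; have [z1 z2] := Iz x hx; rewrite /G' /C' !updE z1 z2.
  by do ![case: eqP => [?|_]]; lia.
have fin s1 : env s1 -> hreg s1 roff = off /\ hreg s1 roff2 = off2 -> harr s1 aG = G' ->
    harr s1 aCnt = C' -> tm s1 <= tm s + 50 ->
    (forall x, x \in Sigma sigma -> hreg s1 rmu <= G' (off + x)) ->
    (exists2 x, x \in Sigma sigma & G' (off + x) = hreg s1 rmu) ->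
    [/\ missing_mid i s1, tm s1 <= tm s + 50 &
      forall x, off2 <= x -> harr s1 aG x = 0 /\ harr s1 aCnt x = 0].
  by move=> E1 eo1 hG hC t1 m1 m2; split; rewrite /missing_mid ?hG ?hC //; split.
have [d dS ed] := Imu2; have mug : hreg s rmu <= g by apply: Imu1.
have old_mu x : x \in Sigma sigma -> hreg s rmu <= G' (off + x).
  by move=> xS; apply: leq_trans (Imu1 x xS) (G'le x).
case: ltnP => hc; [case: ltnP => hmu|].
- move=> _ ->; apply: fin => //=; [exact: (env_same E) | by lia | exists d => //].
  by rewrite G'E updE; case: eqP => // e; move: hmu; rewrite -ed e -/g ltnn.
- have emu : hreg s rmu = g by lia.
  move=> _ ->; apply: fin => //=; [exact: (env_same E) | by lia | | ].
    move=> x xS; have := old_mu x xS; rewrite emu ltn_neqAle => ->; rewrite andbT.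
    have : ~~ has (fun y => G' (off + y) == g) (Sigma sigma).
      by rewrite has_count -cntg cg'; lia.
    by move/hasPn => /(_ x xS); rewrite eq_sym.
  by exists c => //; rewrite G'E updE eqxx.
- move=> _ ->; apply: fin => //=; [exact: (env_same E) | by lia | ].
  have [emu|nmu] := eqVneq (hreg s rmu) g.
    have : has (fun y => G' (off + y) == g) (Sigma sigma).
      by rewrite has_count -cntg cg'; lia.
    by case/hasP=> y yS /eqP ey; exists y => //; rewrite ey.
  exists d => //; rewrite G'E updE; case: eqP => // e.
  by move: nmu; rewrite -ed e eqxx.
Qed.

#[local] Opaque update_cmd.

Lemma missing_store_wp i s s1 : i < n -> missing_inv i s -> missing_mid i s1 ->
  (forall x, off2 <= x -> harr s1 aG x = 0 /\ harr s1 aCnt x = 0) ->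
  harr s1 aH = harr s aH -> hreg s1 ri = i -> tm s1 <= tm s + 70 ->
  wpr missing_store_cmd
    (fun s' => [/\ hreg s' ri = i.+1, missing_inv i.+1 s' & tm s' <= tm s + 80]) s1.
Proof.
move=> iw I; have [_ _ _ _ _ _ Iold Inew _] := I.
have W3 : Q + Q + Q < W by lia.
case=> E1 [o1 o2] G1 C1 M1 z1 hH ei1 t1.
rewrite /= ei1 o2 (env_one E1) addn1.
split; [lia | move=> _ ->]; split; [lia | move=> _ ->]; split; [lia | move=> _ _ -> ->].
split=> //=; last by lia.
have md : missing_dist sigma (take i.+1 w) j.+1 (hreg s1 rmu).
  exact: missing_dist_succ G1 M1.2 M1.1.
split=> //=; first exact: (env_same E1).
- by move=> i' hi'; rewrite updE hH; case: eqP => [e|_]; [lia | apply: Iold].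
move=> i' hi'; rewrite updE eqn_add2l hH; case: (i' =P i.+1) => [->|ni]; last by apply: Inew; lia.
split=> //; have [[c cS' <-] _] := (M1.2, tt).
apply: leq_trans (missing_dist_last_size (G1 c cS')) _; rewrite size_take_min.
exact: geq_minr.
Qed.

#[local] Opaque missing_store_cmd.

Lemma missing_step_wp i s : i < n -> missing_inv i s -> hreg s ri = i ->
  wpr missing_step_cmd (fun s' => [/\ hreg s' ri = i.+1, missing_inv i.+1 s' & tm s' <= tm s + 80]) s.
Proof.
move=> iw I ei; have [E eo eo2 IG Icnt Imu Iold Inew Iz] := I.
have cS : nth 0 w i \in Sigma sigma by apply: overw; apply: mem_nth.
have cn : nth 0 w i <= n by apply: letter_le sigma_le overw _ iw.
have oq : off + n < off2 by rewrite /off2; lia.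
have W3 : Q + Q + Q < W by lia.
rewrite /missing_step_cmd /= ei eo (env_w E).
split; [lia | move=> _ ->]; split; [lia | move=> _ ->]; split; [lia | move=> _ ->].
split; [lia | move=> _ ->]; split; [lia | move=> _ ->].
case: ltnP => hg.
  match goal with |- wp _ _ _ _ _ ?t => pose s1 := t end.
  have I1 : missing_inv i s1 by apply: (missing_inv_same I).
  apply: (wp_mono _ (wp_frame (update_wp iw I1 erefl erefl hg))) => s2 [[h1 h2 h3] [fr fa]].
  apply: (missing_store_wp iw I) => //; first by rewrite fa.
    by rewrite fr.
  by move: h2; rewrite /s1 /=; lia.
move=> _ ->; apply: (missing_store_wp iw I) => //=; last by lia.
split=> //=; first exact: (env_same E).
move=> x xS; rewrite (take_nth 0) //.
have := missing_dist_last_step sigma_gt1 cS (IG x xS) (Iold i (ltnW iw)).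
case: eqP => // e; rewrite -e in hg *; rewrite (minn_idPr _); last by lia.
have gh := missing_dist_last_le (IG _ cS) (Iold i (ltnW iw)).
by have -> : harr s aH (off + i) = harr s aG (off + nth 0 w i) by lia.
Qed.

#[local] Opaque missing_step_cmd.

Lemma missing_steps_wp s : missing_inv 0 s -> hreg s ri = 0 ->
  wpr missing_steps_cmd (fun s' => missing_inv n s' /\ tm s' <= tm s + 82 * n + 2) s.
Proof.
move=> I ei; rewrite /missing_steps_cmd.
apply: (@wp_for W Q nArr ri rn _ (fun i s' => missing_inv i s' /\ tm s' <= tm s + 82 * i) 0 n) => //.
- exact: env_n (mi_env I).
- by split=> //; lia.
- move=> i s' F /andP[_ iw] ei' en' [h1 h2].
  have h1' : missing_inv i (tick 1 s') by apply: (missing_inv_same h1).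
  apply: (wp_mono _ (missing_step_wp iw h1' ei')) => s2 [k1 k2 k3]; split=> //; split.
    exact: (missing_inv_same k2).
  by move: k3; rewrite /=; lia.
move=> s' F ei' en' [h1 h2]; split; first exact: (missing_inv_same h1).
by rewrite /=; lia.
Qed.

End OneLayer.
#[local] Opaque missing_steps_cmd.

Definition missing_layers_inv j s := [/\ env s, hreg s roff = j * n.+1,
  forall i', i' <= n -> missing_dist sigma (take i' w) j (harr s aH (j * n.+1 + i')),
  forall x, j * n.+1 <= x -> harr s aG x = 0 /\ harr s aCnt x = 0 &
  0 < j -> harr s aH (j * n.+1 + n) <= n].

Lemma missing_offset_lt j : j <= k -> j * n.+1 + n.+1 + n < Q.
Proof.
move=> jk; have kn : k.*2 <= n by rewrite -muln2; apply: leq_trans k_le; rewrite leq_mul2l sigma_gt1 orbT.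
have : j.+2 * n.+1 <= Q by rewrite leq_mul2r; lia.
by rewrite !mulSn; lia.
Qed.

Lemma missing_layer_wp j s : j <= k -> missing_layers_inv j s -> hreg s rj = j ->
  wpr missing_layer_cmd (fun s' => [/\ hreg s' rj = j.+1, missing_layers_inv j.+1 s' &
    tm s' <= tm s + 82 * n + 30]) s.
Proof.
move=> jk [E eo old zero _] ej; have oQ := missing_offset_lt jk.
have W3 : Q + Q + Q < W by lia.
rewrite /missing_layer_cmd /= eo (env_np E) (env_zero E) (env_sg E).
split; [lia | move=> _ -> _ ->]; split; [lia | move=> _ _ -> ->]; split; [lia | move=> _ _ -> -> _ ->].
match goal with |- wp _ _ _ _ _ ?t => pose s1 := t end.
have I1 : missing_inv j 0 s1.
  have G0 c : harr s aG (j * n.+1 + c) = 0 by have [] := zero (j * n.+1 + c) (leq_addr _ _).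
  have gl c : c \in Sigma sigma -> missing_dist_last sigma (take 0 w) j c (harr s1 aG (j * n.+1 + c)).
    by move=> _; rewrite take0 /= G0; apply: missing_dist_last0.
  have one : 1 \in Sigma sigma by rewrite mem_iota; lia.
  split=> //=.
  - exact: (env_same E).
  (* For the empty prefix all [sigma] values are 0, so the whole histogram sits in cell 0. *)
  - move=> x xn; rewrite (eq_count (a2 := fun=> x == 0)); last first.
      by move=> c /=; rewrite G0 eq_sym.
    have z0 := (zero (j * n.+1 + x) (leq_addr _ _)).2.
    have [->|x0] := posnP x; first by rewrite addn0 updE eqxx count_predT size_Sigma.
    by rewrite upd_neq ?z0 ?(gtn_eqF x0) ?count_pred0 //; lia.
  - by split=> //; exists 1.
  - by move=> i' hi'; rewrite updE; case: eqP => [e|_]; [lia | apply: old].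
  - move=> i'; rewrite leqn0 => /eqP->; rewrite addn0 updE eqxx; split=> //.
    by apply: (missing_dist_succ gl); [exists 1; rewrite // /= G0 | move=> c _].
  - move=> x hx; rewrite updE; case: eqP => [e|_]; first by lia.
    by apply: zero; lia.
apply: (wp_mono _ (wp_frame (missing_steps_wp oQ I1 erefl))) => s2 [[h1 h2] [fr fa]].
rewrite (mi_off2 h1) (fr rj) //= ej (env_one (mi_env h1)).
move=> _ ->; split; [lia | move=> _ ->].
have e : j.+1 * n.+1 = j * n.+1 + n.+1 by rewrite mulSn addnC.
split=> //=; [by rewrite addn1 | | by move: h2; rewrite /s1 /=; lia].
split=> //=; first exact: (env_same (mi_env h1)).
- by move=> i' hi'; rewrite e; apply: (mi_new h1 hi').1.
- by rewrite e; apply: mi_zero h1.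
- by move=> _; rewrite e; apply: (mi_new h1 (leqnn _)).2.
Qed.

#[local] Opaque missing_layer_cmd.

Lemma missing_layers_wp s : missing_layers_inv 0 s -> hreg s rj = 0 -> hreg s rkk = k.+1 ->
  wpr missing_layers_cmd (fun s' => missing_layers_inv k.+1 s' /\
    tm s' <= tm s + (82 * n + 32) * k.+1 + 2) s.
Proof.
move=> I ej ek; rewrite /missing_layers_cmd.
have same j s1 s2 : missing_layers_inv j s1 -> hreg s2 = hreg s1 -> harr s2 = harr s1 ->
    missing_layers_inv j s2.
  by case=> a b c d e h1 h2; split; rewrite ?h1 ?h2 //; apply: (env_same a); rewrite ?h1 ?h2.
apply: (@wp_for W Q nArr rj rkk _ (fun j s' => missing_layers_inv j s' /\
  tm s' <= tm s + (82 * n + 32) * j) 0 k.+1) => //.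
- by rewrite muln0 addn0.
- move=> j s' F jk ej' ek' [h1 h2]; have h1' := same j s' (tick 1 s') h1 erefl erefl.
  apply: (wp_mono _ (missing_layer_wp (s := tick 1 s') jk h1' ej')) => s2 [k1 k2 k3].
  split=> //; split; first exact: same k2 _ _.
  by move: k3; rewrite /= mulnS; lia.
move=> s' F ej' ek' [h1 h2]; split; first exact: same h1 _ _.
by rewrite /=; lia.
Qed.

Lemma fill_wp s : env s -> hreg s ri = 0 ->
  wpr fill_cmd (fun s' => (forall i, i <= n -> harr s' aH i = n.+1) /\
    tm s' <= tm s + 7 * n.+1 + 2) s.
Proof.
move=> E ei; rewrite /fill_cmd; have W3 : Q + Q + Q < W by lia.
apply: (@wp_for W Q nArr ri rnp _ (fun i s' => (forall x, x < i -> harr s' aH x = n.+1) /\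
  tm s' = tm s + 7 * i) 0 n.+1) => //.
- exact: env_np E.
- by split=> //; lia.
- move=> i s' [fr _] hi ei' en' [h1 h2].
  rewrite /= ei' en' (fr rone) // (env_one E).
  split; [lia | move=> _ _ -> ->]; split; [lia | move=> _ ->]; rewrite addn1.
  split=> //; split; last by rewrite h2; lia.
  by move=> x xi; rewrite updE; case: eqP => // ne; apply: h1; lia.
by move=> s' F _ _ [h1 h2]; split=> //=; rewrite h2; lia.
Qed.

End Missing.

(** * Preprocessing and assembly of the whole program *)

Section Setup.
Variables (w : seq nat) (sigma k W : nat).
Let n := size w.
Let Q := n.+1 * n.+1.
Let B := trunc_log 2 n.
Hypothesis sigma_gt1 : 1 < sigma.
Hypothesis sigma_le : sigma <= n.
Hypothesis alphw : w =i Sigma sigma.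
Hypothesis QW : 11 * Q < W.
Notation wpr := (wp W Q nArr).

Let nQ : n.+1 + n.+1 + n.+1 <= Q. Proof. exact: three_succ_le_sqr sigma_gt1 sigma_le. Qed.
Let W3 : Q + Q + Q < W. Proof. lia. Qed.

Lemma sigma_wp s : hreg s rn = n -> hreg s rone = 1 -> hreg s ri = 0 -> hreg s rsg = 0 ->
  harr s aW = nth 0 w ->
  wpr sigma_cmd (fun s' => hreg s' rsg = sigma /\ tm s' <= tm s + 12 * n + 2) s.
Proof.
move=> en e1 ei es ew; rewrite /sigma_cmd.
apply: (@wp_for W Q nArr ri rn _ (fun i s' => [/\ hreg s' rsg <= sigma,
  forall x, x < i -> nth 0 w x <= hreg s' rsg & tm s' <= tm s + 12 * i]) 0 n) => //.
- by rewrite es; split=> //; lia.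
- move=> i s' [fr fa] /andP[_ iw] ei' en' [h1 h2 h3].
  have lw : nth 0 w i <= sigma.
    by have := mem_nth 0 iw; rewrite alphw mem_iota add1n ltnS => /andP[].
  rewrite /= ei' (fr rone) // e1 (fa aW) // ew.
  split; [lia | move=> _ ->]; case: ltnP => hw; [move=> _ -> | move=> u _];
    (split; [lia | move=> _ ->]); rewrite addn1; split=> //; split=> //; try by lia.
    move=> x xi; case: (ltnP x i) => [/h2|ix]; first by lia.
    by have -> : x = i by lia.
  move=> x xi; case: (ltnP x i) => [/h2|ix]; first by lia.
  by have -> : x = i by lia.
move=> s' F ei' en' [h1 h2 h3]; split; last by rewrite /=; lia.
apply/eqP; rewrite eqn_leq h1 /=.
have sw : sigma \in w by rewrite alphw mem_iota; lia.
have := h2 (index sigma w); rewrite nth_index //; apply.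
by rewrite /n index_mem.
Qed.

Lemma log_wp s : hreg s rnp = n.+1 -> hreg s rone = 1 -> hreg s rB = 0 -> hreg s rpB = 1 ->
  hreg s rx = 2 ->
  wpr log_cmd (fun s' => [/\ hreg s' rB = B, hreg s' rpB = 2 ^ B & tm s' <= tm s + 5 * n + 2]) s.
Proof.
move=> en e1 eB ep ex; rewrite /log_cmd.
pose I j s' := exists b, [/\ hreg s' rnp = n.+1 /\ hreg s' rone = 1, hreg s' rB = b, hreg s' rpB = 2 ^ b,
  hreg s' rx = 2 ^ b.+1 & [/\ 2 ^ b <= n, j = n - b & tm s' <= tm s + 5 * b]].
apply: (@wp_while W Q nArr rx rnp _ I n).
  by exists 0; split=> //; split; rewrite ?expn0 ?subn0 //; lia.
move=> j s' [b [[en' e1'] h1 h2 h3 [h4 h5 h6]]].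
have bn : b < 2 ^ b by apply: ltn_expl.
rewrite h3 en'; case: ltnP => hb.
  exists (n - b.+1); first by lia.
  rewrite /= h1 h3 e1' => _ ->.
  split; [lia | move=> _ ->]; split; [lia | move=> _ ->].
  by exists b.+1; split=> //=; [lia | rewrite [in RHS]expnS; lia | split; lia].
have eb : B = b.
  by apply: trunc_log_eq => //; rewrite h4.
by split; rewrite ?eb //= ?h6; lia.
Qed.

Lemma table_wp s : hreg s rpB = 2 ^ B -> hreg s rone = 1 -> hreg s rtwo = 2 -> hreg s ri = 2 ->
  (forall x, harr s aT x = 0) ->
  wpr table_cmd (fun s' => (forall x, 0 < x < 2 ^ B -> harr s' aT x = trunc_log 2 x) /\
    tm s' <= tm s + 13 * n + 2) s.
Proof.
move=> ep e1 e2 ei eT; rewrite /table_cmd.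
have pB := exp_block_size_le sigma_gt1 sigma_le; rewrite -/n -/B in pB.
have B0 := block_size_gt0 sigma_gt1 sigma_le; rewrite -/n -/B in B0.
have two : 2 <= 2 ^ B by rewrite -{1}(expn1 2) leq_exp2l.
apply: (@wp_for W Q nArr ri rpB _ (fun i s' =>
  (forall x, 0 < x < i -> harr s' aT x = trunc_log 2 x) /\ tm s' = tm s + 13 * (i - 2)) 2 (2 ^ B)) => //.
- split; last by lia.
  by move=> x hx; have -> : x = 1 by lia; rewrite eT trunc_log1.
- move=> i s' [fr _] hi ei' ep' [h1 h2].
  have i2 : 0 < i %/ 2 < i by rewrite divn_gt0 // ltn_Pdiv //; lia.
  rewrite /= ei' (fr rone) // (fr rtwo) // e1 e2.
  split; [lia | move=> _ ->]; split; [lia | move=> _ ->]; rewrite h1 //.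
  have tl : trunc_log 2 i = (trunc_log 2 (i %/ 2)).+1.
    by rewrite trunc_log2S ?divn2 //; lia.
  have tn : trunc_log 2 i <= n.
    apply: leq_trans (ltnW (ltn_expl _ (ltnSn 1))) _; apply: leq_trans (trunc_logP (ltnSn 1) _) _; lia.
  split; [lia | move=> _ ->]; split; [lia | move=> _ _ -> ->]; split; [lia | move=> _ ->].
  rewrite !addn1; split=> //; split; last by rewrite h2; lia.
  by move=> x hx; rewrite updE; case: eqP => [->|ne]; rewrite ?tl // h1 //; lia.
by move=> s' F ei' ep' [h1 h2]; split=> //=; rewrite h2; lia.
Qed.

#[local] Opaque sigma_cmd log_cmd table_cmd.

Lemma setup_wp : let s := input_hst w k in
  wpr setup_cmd (fun s' => env w sigma k s' /\ tm s' <= 30 * n + 30) s.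
Proof.
move=> s; have pB := exp_block_size_le sigma_gt1 sigma_le; rewrite -/n -/B in pB.
rewrite /setup_cmd /=.
split; [lia | split; [lia | move=> _ -> _ ->]].
match goal with |- wp _ _ _ _ _ ?t => pose s0 := t end.
apply: (wp_mono _ (wp_frame (@sigma_wp s0 erefl erefl erefl erefl erefl))) => s1 [[es t1] [fr1 fa1]].
split; [lia | split; [lia | split; [lia|]]].
match goal with |- wp _ _ _ _ _ ?t => pose s2 := t end.
have R2 := @log_wp s2; rewrite /s2 /= (fr1 rnp) // (fr1 rone) // (fr1 rB) // in R2.
apply: (wp_mono _ (wp_frame (R2 (addn1 n) erefl erefl erefl erefl))) => s3 [[eB ep t3] [fr3 fa3]].
have e3 : hreg s3 rone = 1 by rewrite fr3 //= fr1.
rewrite ep e3 (fr3 rtwo) //=; split; [lia | move=> _ -> _ ->].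
match goal with |- wp _ _ _ _ _ ?t => pose s4 := t end.
have R4 := @table_wp s4; rewrite /s4 /= e3 ep (fr3 rtwo) //= (fa3 aT) //= (fa1 aT) // in R4.
apply: (wp_mono _ (wp_frame (R4 erefl erefl erefl erefl (fun=> erefl)))) => s5 [[eT t5] [fr5 fa5]].
have e5 : hreg s5 rone = 1 by rewrite fr5.
have e5n : hreg s5 rn = n by rewrite fr5 //= fr3 //= fr1.
have e5B : hreg s5 rB = B by rewrite fr5.
have div_le : n %/ B <= n by apply: leq_div.
rewrite e5 e5n e5B; split; [lia | move=> _ ->]; split; [lia | move=> _ ->].
split.
  split; rewrite /= ?addn1 //.
  - by rewrite fr5 //= fr3 //= fr1.
  - by rewrite fr5 //= fr3 //= es.
  - by rewrite fr5 //= fr3 //= fr1 //= addn1.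
  - by rewrite fr5 //= fr3 //= fr1.
  - by rewrite fr5 //= subn1.
  - by rewrite fa5 //= fa3 //= fa1.
rewrite /s4 /= in t5; rewrite /s2 /= in t3; rewrite /s0 /= in t1.
by rewrite /=; move: t1 t3 t5; lia.
Qed.

#[local] Opaque setup_cmd layers_cmd fill_cmd missing_layers_cmd.

Hypothesis k_le : k * sigma <= n.

Definition main_time := (30 * n + 30) + ((800 * n + 202) * k + 2) + (7 * n.+1 + 2)
  + ((82 * n + 32) * k.+1 + 2) + 40.

Lemma main_wp :
  wpr main_cmd (fun s => min_substitutions sigma w k (hreg s rx) /\ tm s <= main_time) (input_hst w k).
Proof.
have overw : {subset w <= Sigma sigma} by move=> x; rewrite alphw.
have oQ := missing_offset_lt sigma_gt1 sigma_le k_le QW (leqnn k); rewrite -/n -/Q in oQ.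
have kn : k * n.+1 <= Q by lia.
rewrite /main_cmd /=; apply: (wp_mono _ (wp_frame setup_wp)) => s1 [[E1 t1] [_ fa1]].
rewrite (env_zero E1) => _ -> _ -> _ ->.
match goal with |- wp _ _ _ _ _ ?t => pose s2 := t end.
have L2 : layers_inv w sigma k 0 s2.
  split=> //=; first exact: (env_same E1).
  - by move=> x _; rewrite fa1.
  - by move=> a _; rewrite fa1 //=; apply: universal_dist0; apply: over_take.
have R := layers_wp sigma_gt1 sigma_le overw k_le QW L2 erefl.
apply: (wp_mono _ (wp_frame R)) => s3 [[E3 [eo3 D3 t3]] [_ fa3]].
rewrite (env_zero E3) => _ ->.
match goal with |- wp _ _ _ _ _ ?t => pose s4 := t end.
have E4 : env w sigma k s4 by apply: (env_same E3).
apply: (wp_mono _ (wp_frame (fill_wp sigma_gt1 sigma_le k_le QW E4 erefl))) => s5 [[eH t5] F5].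
have E5 := env_frame (isT : env_safe fill_cmd) E4 F5; have [_ fa5] := F5.
rewrite (env_zero E5) (env_one E5) (env_k E5) => _ -> _ ->.
split; [lia | move=> _ ->]; rewrite addn1.
match goal with |- wp _ _ _ _ _ ?t => pose s6 := t end.
have L6 : missing_layers_inv w sigma k 0 s6.
  split=> //=; first exact: (env_same E5).
  - move=> i hi; rewrite eH //; apply: missing_dist0.
    by rewrite size_take_min ltnS; apply: leq_trans (geq_minl _ _) hi.
  - by move=> x _; rewrite !fa5 //= !fa3 //= !fa1.
have R6 := missing_layers_wp sigma_gt1 sigma_le overw k_le QW L6 erefl erefl.
apply: (wp_mono _ (wp_frame R6)) => s7 [[[E7 eo7 H7 _ Hn] t7] [_ fa7]].
rewrite (env_k E7) (env_np E7) (env_n E7) eo7 (fa7 aD) //= (fa5 aD) //=.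
have e1 : k.+1 * n.+1 = k * n.+1 + n.+1 by rewrite mulSn addnC.
rewrite -e1 in oQ; rewrite -/n in Hn H7 D3 *.
have W4 : Q + Q + Q + Q < W by lia.
(* Row [k.+1] is not row 0, so its last entry is at most [n]; this rules out infinity, as
   [min_substitutions_add] requires. *)
have hn := Hn isT; have d_le : harr s3 aD (k * n.+1 + n) <= n.
  case: D3 => -[u [su ou uu _]] lb.
  exact: leq_trans (lb u su ou uu) (ham_le_size _ _).
split; [lia | move=> _ ->]; split; [lia | move=> _ ->]; split; [lia | move=> _ ->].
split; [lia | move=> _ ->]; split; [lia | move=> _ ->]; split; [lia | move=> _ ->].
split.
  have mk := H7 n (leqnn n); rewrite take_size in mk.
  by apply: (min_substitutions_add sigma_gt1 overw D3 mk).
rewrite /main_time; move: t1 t3 t5 t7; rewrite /s6 /s4 /s2 /=; lia.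
Qed.

End Setup.

(* The factor [maxn 1 k] is k for k >= 1; for k = 0 the bound is O(n). *)
Theorem theorem5 :
  exists (P : program) (c C : nat), 0 < c /\
    forall (w : seq nat) (sigma k : nat),
      2 <= sigma -> sigma <= size w -> w =i Sigma sigma ->
      k <= size w %/ sigma ->
      exists2 m, min_substitutions sigma w k m
        & outputs_within P (word_length c (size w)) (input_state w k) m
            (C * (size w * maxn 1 k)).
Proof.
(* The factor 4 makes the 11 arrays fit: if [N] is the power of 2 whose exponent is the number of
   binary digits of [n], then [n < N] and [4 <= N], hence [11 * Q < 16 * N ^ 2 <= N ^ 4]. The
   constant 2000 generously bounds the sum of the coefficients of [main_time]. *)
exists (ram_program main_cmd rx), 4, 2000; split=> // w sigma k s2 sn alphw kn.
have k_le : k * sigma <= size w by rewrite -leq_divRL //; lia.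
have n2 : 1 < size w by lia.
pose Q := (size w).+1 * (size w).+1.
have QW : 11 * Q < 2 ^ word_length 4 (size w).
  rewrite /word_length [4 * _]mulnC expnM; set N := 2 ^ _.
  have N1 : size w < N by apply: trunc_log_ltn.
  have N4 : 4 <= N.
    have t1 : 0 < trunc_log 2 (size w) by rewrite trunc_log_gt0.
    by rewrite -[4]/(2 ^ 2) leq_exp2l.
  have -> : N ^ 4 = (N * N) * (N * N) by rewrite !expnS expn0; lia.
  apply: leq_trans (_ : 16 * (N * N) <= _).
    have : Q <= N * N by apply: leq_mul.
    have : 0 < Q by [].
    lia.
  by rewrite leq_mul2r; apply/orP; right; apply: (leq_mul N4 N4).
have M := main_wp s2 sn alphw QW k_le.
have [m hm [t ht h]] := ram_program_outputs (isT : 0 < nArr) QW M.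
exists m => //; exists t => //; apply: leq_trans ht _.
rewrite /main_time; have h1 : size w <= size w * maxn 1 k by rewrite leq_pmulr // leq_max.
have h2 : size w * k <= size w * maxn 1 k by rewrite leq_mul2l leq_maxr orbT.
have h3 : k <= size w * k by rewrite leq_pmull //; lia.
have -> : (800 * size w + 202) * k = 800 * (size w * k) + 202 * k by rewrite mulnDl mulnA.
have -> : (82 * size w + 32) * k.+1 = 82 * (size w * k) + 82 * size w + 32 * k + 32.
  by rewrite mulnS mulnDl mulnA; lia.
lia.
Qed.
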